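(* Let $V$ be a convex polynomial of even degree $p\ge 2$ and let $\beta>0$. Then the sequence of distributions of $(\mu_N)_N$ under $\mathbb P^N_{V,\beta}$ satisfies a weak large deviation principle in $(M_1^p(\mathbb R^+), d_{W_p})$ at speed $\beta N^2/2$ with rate function $$I_V^{\mathrm{DOS}}(\nu) := \inf_{c\in(-\infty,\infty)} \mathcal I_V(c,\nu) = -\Sigma(\nu) + G_V(\nu) - c_V ,\qquad G_V(\nu) := \inf_{c\in(-\infty,\infty)} \int V(c-x)\, d\nu(x).$$
   Context: Let $\mathbb P^N_{V,\beta}$ be the probability measure on $\mathbb R^N$ given by $$\mathbb P^N_{V,\beta}(d\lambda_1,\dots,d\lambda_N) = (Z^N_{V,\beta})^{-1}\,|\Delta(\lambda)|^\beta \exp\Big(-\frac{N\beta}{2}\sum_{k=1}^N V(\lambda_k)\Big)\prod_{k=1}^N d\lambda_k ,$$ where $\Delta(\lambda)=\prod_{i<j}(\lambda_j-\lambda_i)$ is the Vandermonde determinant and $Z^N_{V,\beta}$ is the normalizing constant. Let $\lambda_{(1)}<\dots<\lambda_{(N)}$ be the increasing rearrangement of $\lambda_1,\dots,\lambda_N$ (a.s. distinct). For $N\ge 2$ define the random probability measure on $\mathbb R^+=[0,\infty)$ $$\mu_N := \frac1{N-1}\sum_{k=1}^{N-1}\delta_{\lambda_{(N)}-\lambda_{(k)}} .$$ $M_1(E)$ denotes the set of Borel probability measures on $E$, and $M_1^p(E)$ the set of $\nu\in M_1(E)$ with $\int |x|^p d\nu(x)<\infty$. The Wasserstein distance is $d_{W_p}(\mu,\nu)=\big(\inf_{\pi\in\Pi(\mu,\nu)}\int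 |x-y|^p d\pi(x,y)\big)^{1/p}$, where $\Pi(\mu,\nu)$ is the set of couplings of $\mu$ and $\nu$. For a measure $\mu$ put $\Sigma(\mu)=\iint \ln|x-y|\,d\mu(x)d\mu(y)$, $c_V=\inf_{\nu}\big(-\Sigma(\nu)+\int V d\nu\big)$ (infimum over probability measures $\nu$ on $\mathbb R$ with $\int|V|d\nu<\infty$), and $I_V(\mu)=-\Sigma(\mu)+\int V d\mu-c_V$ if $\int|V|d\mu<\infty$, $I_V(\mu)=+\infty$ otherwise. For $c\in\mathbb R$, $\tau_c\mu$ is the probability defined by $\int f(x)\,\tau_c\mu(dx)=\int f(c-x)\,\mu(dx)$, and $\mathcal I_V(c,\nu):=I_V(\tau_c\nu)$. A sequence of random variables $X_N$ with values in a topological space satisfies a weak large deviation principle at speed $v_N$ with rate function $I$ (a lower semicontinuous function with values in $[0,\infty]$) if $\liminf_N v_N^{-1}\ln \mathbb P(X_N\in G)\ge -\inf_G I$ for every open $G$, and $\limsup_N v_N^{-1}\ln\mathbb P(X_N\in K)\le -\inf_K I$ for every compact $K$. *)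

(* Defs.v *)
From HB Require Import structures.
From mathcomp Require Import all_boot all_order all_algebra.
From mathcomp Require Import all_classical all_reals all_analysis measurable_realfun.

Set Implicit Arguments.
Unset Strict Implicit.
Unset Printing Implicit Defensive.

Import Order.TTheory GRing.Theory Num.Theory.
Import numFieldNormedType.Exports.

Local Open Scope classical_set_scope.
Local Open Scope ring_scope.

Notation probR R := (probability (measurableTypeR R) R).

Section lebesgue_tuple.
Context {R : realType}.
Local Open Scope ereal_scope.

Definition consR n (z : measurableTypeR R * n.-tuple (measurableTypeR R)) :
  n.+1.-tuple (measurableTypeR R) := [tuple of z.1 :: z.2].

Lemma measurable_consR n : measurable_fun [set: _] (@consR n).
Proof. exact: measurable_cons. Qed.

HB.instance Definition _ n :=
  isMeasurableFun.Build _ _ _ _ (@consR n) (@measurable_consR n).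

Section step.
Variables (n : nat)
  (m : {sigma_finite_measure set (n.-tuple (measurableTypeR R)) -> \bar R}).

Definition lebesgue_consR :
    set (n.+1.-tuple (measurableTypeR R)) -> \bar R :=
  pushforward ((@lebesgue_measure R) \x m) (@consR n).

Let lebesgue_consR0 : lebesgue_consR set0 = 0.
Proof. exact: measure0. Qed.

Let lebesgue_consR_ge0 A : 0 <= lebesgue_consR A.
Proof. exact: measure_ge0. Qed.

Let lebesgue_consR_sigma_additive : semi_sigma_additive lebesgue_consR.
Proof. exact: measure_semi_sigma_additive. Qed.

HB.instance Definition _ := isMeasure.Build _ _ _ lebesgue_consR
  lebesgue_consR0 lebesgue_consR_ge0 lebesgue_consR_sigma_additive.

Let lebesgue_consR_sigma_finite : sigma_finite setT lebesgue_consR.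
Proof.
have /sigma_finiteP[F [FT ndF Foo]] := sigma_finiteT (@lebesgue_measure R).
have /sigma_finiteP[G [GT ndG Goo]] := sigma_finiteT m.
pose u (t : n.+1.-tuple (measurableTypeR R)) :
  measurableTypeR R * n.-tuple (measurableTypeR R) :=
  (thead t, [tuple of behead t]).
have uK z : u (consR z) = z.
  by case: z => x t; congr pair => //; exact/val_inj.
have mu_ : measurable_fun [set: _] u.
  apply: measurable_fun_pair; first exact: measurable_tnth.
  exact: measurable_behead.
exists (fun i => u @^-1` (F i `*` G i)).
  apply/seteqP; split => // t _.
  have : [set: _] (u t).1 by []. rewrite FT => -[i _ Fi].
  have : [set: _] (u t).2 by []. rewrite GT => -[j _ Gj].
  exists (maxn i j) => //; split.
    by move: Fi; exact/subsetPset/ndF/leq_maxl.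
  by move: Gj; exact/subsetPset/ndG/leq_maxr.
move=> i; have [mF Fi] := Foo i; have [mG Gi] := Goo i; split.
  by rewrite -[X in measurable X]setTI; apply: mu_ => //; exact: measurableX.
rewrite /lebesgue_consR /pushforward (_ : _ @^-1` _ = F i `*` G i).
  by rewrite product_measure1E// lte_mul_pinfty// ge0_fin_numE.
by apply/seteqP; split => z; rewrite /preimage /mkset uK.
Qed.

HB.instance Definition _ := Measure_isSigmaFinite.Build _ _ _
  lebesgue_consR lebesgue_consR_sigma_finite.

End step.

Fixpoint lebesgue_tuple (n : nat) :
    {sigma_finite_measure set (n.-tuple (measurableTypeR R)) -> \bar R} :=
  match n with
  | 0 => \d_ [tuple]
  | n'.+1 => lebesgue_consR (lebesgue_tuple n')
  end.

Lemma lebesgue_tuple_box n (A : 'I_n -> set (measurableTypeR R)) :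
  (forall i, measurable (A i)) ->
  lebesgue_tuple n [set t | forall i, A i (tnth t i)] =
  \prod_(i < n) lebesgue_measure (A i).
Proof.
elim: n A => [|n IH] A mA /=.
  by rewrite big_ord0 diracE mem_set//= => -[].
rewrite big_ord_recl -IH//= /lebesgue_consR /pushforward.
rewrite (_ : _ @^-1` _ =
  A ord0 `*` [set t | forall i, A (lift ord0 i) (tnth t i)]).
  rewrite product_measure1E//=.
  rewrite (_ : [set _ | _] = \bigcap_(i in [set: 'I_n])
    ((fun t : n.-tuple (measurableTypeR R) => tnth t i)
       @^-1` A (lift ord0 i))).
    apply: fin_bigcap_measurable => // i _; rewrite -[X in measurable X]setTI.
    exact: measurable_tnth.
  by apply/seteqP; split => t /= h i => [_|]; exact: h.
apply/seteqP; split => -[x t] /=.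
  by move=> h; split => [|i]; [exact: (h ord0)|have := h (lift ord0 i); rewrite tnthS].
move=> [h0 h] i; case: (unliftP ord0 i) => [j|] ->; last exact: h0.
by rewrite tnthS; exact: h.
Qed.

End lebesgue_tuple.

Section wasserstein.
Context {R : realType}.
Local Open Scope ereal_scope.

Definition coupling (mu nu : probR R)
    (pi : probability (measurableTypeR R * measurableTypeR R)%type R) : Prop :=
  (forall A, measurable A -> pi (A `*` setT) = mu A) /\
  (forall A, measurable A -> pi (setT `*` A) = nu A).

Definition wasserstein (p : nat) (mu nu : probR R) : \bar R :=
  ereal_inf [set \int[pi]_z (`|z.1 - z.2| ^+ p)%:E
            | pi in [set pi | coupling mu nu pi]] `^ (p%:R^-1)%R.

(* A measure on [E] is represented by the measure it induces on [R], carried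
   by [E]; couplings of two such measures are automatically carried by
   [E * E]. A [probability] assigns a value to every set, measurable or not;
   [M1p_outer] fixes the irrelevant values on non-measurable sets (by outer
   measure), so that two elements of [M1p] that agree on the Borel sets are
   equal and [wasserstein] separates points. *)
Record M1p (E : set R) (p : nat) := MkM1p {
  M1p_prob :> probR R;
  M1p_carrier : M1p_prob E = 1;
  M1p_moment : \int[M1p_prob]_x (`|x| ^+ p)%:E < +oo;
  M1p_outer : forall A : set R, M1p_prob A =
    ereal_inf [set M1p_prob B
              | B in [set B : set (measurableTypeR R) |
                       measurable B /\ A `<=` B]]
}.

Section topology.
Variables (E : set R) (p : nat).

HB.instance Definition _ := gen_eqMixin (M1p E p).
HB.instance Definition _ := gen_choiceMixin (M1p E p).

(* The metric topology, given by its open sets rather than through a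
   (pseudo)metric structure, which would first require the triangle inequality
   for [wasserstein]. *)
Definition wasserstein_open (G : set (M1p E p)) : Prop :=
  forall mu, G mu -> exists2 e : R, (0 < e)%R &
    forall nu : M1p E p, wasserstein p mu nu < e%:E -> G nu.

Let openT : wasserstein_open setT.
Proof. by move=> mu _; exists 1%R. Qed.

Let openI : setI_closed wasserstein_open.
Proof.
move=> G H oG oH mu [/oG[e e0 Ge] /oH[f f0 Hf]].
exists (Num.min e f); first by rewrite lt_min e0.
by move=> nu; rewrite EFin_min lt_min => /andP[/Ge ? /Hf].
Qed.

Let open_bigU (I : Type) (f : I -> set (M1p E p)) :
  (forall i, wasserstein_open (f i)) -> wasserstein_open (\bigcup_i f i).
Proof.
move=> of_ mu [i _ /of_[e e0 fe]]; exists e => // nu /fe fnu.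
by exists i.
Qed.

HB.instance Definition _ :=
  isOpenTopological.Build (M1p E p) openT openI open_bigU.

End topology.
End wasserstein.

Section weak_ldp.
Context {R : realType} {T : topologicalType}.
Local Open Scope ereal_scope.

Definition rate_function (I : T -> \bar R) : Prop :=
  (forall x, 0 <= I x) /\ lower_semicontinuous I.

Definition weak_ldp (P : nat -> set T -> \bar R) (v : nat -> R)
    (I : T -> \bar R) : Prop :=
  [/\ rate_function I,
      forall G : set T, open G ->
        - ereal_inf (I @` G) <=
        limn_einf (fun n => ((v n)^-1)%:E * lne (P n G)) &
      forall K : set T, compact K ->
        limn_esup (fun n => ((v n)^-1)%:E * lne (P n K)) <=
        - ereal_inf (I @` K)].

End weak_ldp.

Section ensemble.
Context {R : realType}.
Variables (V : R -> R) (beta : R).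
Local Open Scope ereal_scope.

Definition vandermonde N (l : N.-tuple R) : R :=
  (\prod_(i < N) \prod_(j < N | (i < j)%N) (tnth l j - tnth l i))%R.

Definition ensemble_weight N (l : N.-tuple R) : R :=
  (`|vandermonde l| `^ beta *
   expR (- (N%:R * beta / 2) * \sum_(k < N) V (tnth l k)))%R.

Definition partition_function N : \bar R :=
  \int[lebesgue_tuple N]_l (ensemble_weight l)%:E.

Definition ensemble N (A : set (N.-tuple R)) : \bar R :=
  (partition_function N)^-1 *
  \int[lebesgue_tuple N]_(l in A) (ensemble_weight l)%:E.

End ensemble.

Section empirical.
Context {R : realType}.
Local Open Scope ereal_scope.

Section def.
Variables (n : nat) (l : n.+2.-tuple R).

(* [gap k] is [lambda_(N) - lambda_(k+1)] with [N := n.+2]. *)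
Definition gap (k : nat) : R :=
  (nth 0 (sort <=%R l) n.+1 - nth 0 (sort <=%R l) k)%R.

Definition dos_measure : set (measurableTypeR R) -> \bar R :=
  mscale ((n.+1%:R^-1)%:nng : {nonneg R})%R
    (msum (fun k => \d_(gap k : measurableTypeR R)) n.+1).

HB.instance Definition _ := Measure.on dos_measure.

Lemma dos_measureE A : dos_measure A =
  (n.+1%:R^-1)%R%:E * \sum_(k < n.+1) \d_(gap k : measurableTypeR R) A.
Proof. by []. Qed.

Let dos_measure_const (A : set (measurableTypeR R)) :
  (forall k, (k < n.+1)%N -> A (gap k)) -> dos_measure A = 1.
Proof.
move=> h; rewrite dos_measureE (eq_bigr (fun=> 1)); last first.
  by move=> k _; rewrite diracE mem_set//; exact: h.
by rewrite sumEFin sumr_const card_ord -EFinM mulVf.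
Qed.

Let dos_measureT : dos_measure setT = 1.
Proof. exact: dos_measure_const. Qed.

HB.instance Definition _ :=
  Measure_isProbability.Build _ _ _ dos_measure dos_measureT.

Lemma dos_measure_carrier : dos_measure `[0%R, +oo[ = 1.
Proof.
apply: dos_measure_const => k kn; rewrite /= in_itv/= andbT subr_ge0.
by apply: (sorted_leq_nth le_trans le_refl) => //;
  rewrite ?sort_le_sorted// ?inE ?size_sort ?size_tuple// ltnW.
Qed.

Lemma dos_measure_moment p : \int[dos_measure]_x (`|x| ^+ p)%:E < +oo.
Proof.
pose f (x : measurableTypeR R) : \bar R := (`|x : R| ^+ p)%:E.
have mf : measurable_fun [set: _] f.
  by apply/measurable_EFinP; apply: measurable_funX; exact: normr_measurable.
have f0 (x : measurableTypeR R) : [set: _] x -> 0 <= f x.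
  by move=> _; rewrite lee_fin exprn_ge0.
rewrite (ge0_integral_mscale _ measurableT _ mf f0).
rewrite (ge0_integral_measure_sum _ measurableT f0 mf).
under eq_bigr do rewrite integral_dirac// diracT mul1e.
by rewrite sumEFin -EFinM ltry.
Qed.

Lemma dos_measure_outer (A : set R) : dos_measure A =
  ereal_inf [set dos_measure B
            | B in [set B : set (measurableTypeR R) |
                     measurable B /\ A `<=` B]].
Proof.
apply/eqP; rewrite eq_le; apply/andP; split.
  apply: le_ereal_inf_tmp => _ [B [_ AB] <-].
  rewrite !dos_measureE lee_pmul2l//; apply: lee_sum => k _.
  by rewrite /dirac lee_fin !indicE ler_nat; case: (boolP (_ \in A)) => //;
    rewrite inE => /AB h; rewrite mem_set.
pose F := [set gap k | k in [set k | (k < n.+1)%N /\ ~ A (gap k)]].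
apply: ereal_inf_lbound; exists (~` F).
  split.
    apply: measurableC; apply: countable_measurable => //.
    by apply: finite_set_countable; apply: finite_image;
      apply: (sub_finite_set _ (finite_II n.+1)) => k [].
  by move=> x Ax [k [_ +] kx]; rewrite kx.
rewrite !dos_measureE; congr (_ * _); apply: eq_bigr => k _.
rewrite !diracE; congr (_%:R%:E); congr nat_of_bool.
apply/idP/idP; rewrite !inE; last by move=> Ak [j [_ +] jk]; rewrite jk.
by move=> nF; apply: contrapT => nA; apply: nF; exists k.
Qed.

Definition dos p : M1p `[0%R, +oo[ p :=
  MkM1p dos_measure_carrier (dos_measure_moment p) dos_measure_outer.

End def.

(* The sequence indexed by [N >= 2] is reindexed by [n], with [N := n.+2]. *)
Definition dos_law (V : R -> R) (beta : R) (p n : nat)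
    (A : set (M1p (`[0%R, +oo[%classic : set R) p)) : \bar R :=
  ensemble V beta (N := n.+2) [set l | A (dos l p)].

Definition dos_speed (beta : R) (n : nat) : R := (beta * n.+2%:R ^+ 2 / 2)%R.

End empirical.

Section rate.
Context {R : realType}.
Local Open Scope ereal_scope.

(* [lne 0 = -oo]: atoms make the logarithmic energy [-oo]. *)
Definition Sigma (mu : probR R) : \bar R :=
  \int[mu \x mu]_z lne (`|z.1 - z.2|)%:E.

Definition reflect (c x : measurableTypeR R) : measurableTypeR R := (c - x)%R.

Lemma measurable_reflect c : measurable_fun [set: _] (reflect c).
Proof. exact: measurable_funB. Qed.

HB.instance Definition _ c :=
  isMeasurableFun.Build _ _ _ _ (reflect c) (measurable_reflect c).

Definition tau (c : R) (mu : probR R) : probR R :=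
  distribution mu (reflect c).

Lemma tauE (c : R) (mu : probR R) (f : measurableTypeR R -> \bar R) :
  measurable_fun setT f -> (forall x, 0 <= f x) ->
  \int[tau c mu]_x f x = \int[mu]_x f (c - x)%R.
Proof. by move=> mf f0; rewrite ge0_integral_pushforward//. Qed.

Variable V : R -> R.

Definition V_integrable (mu : probR R) : Prop :=
  \int[mu]_x (`|V x|)%:E < +oo.

Definition c_ : \bar R :=
  ereal_inf [set - Sigma nu + \int[nu]_x (V x)%:E
            | nu in [set nu : probR R | V_integrable nu]].

Definition I_ (mu : probR R) : \bar R :=
  if `[< V_integrable mu >]
  then - Sigma mu + \int[mu]_x (V x)%:E - c_ else +oo.

Definition I_tau (c : R) (nu : probR R) : \bar R := I_ (tau c nu).

Definition I_DOS (nu : probR R) : \bar R :=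
  ereal_inf [set I_tau c nu | c in [set: R]].

Definition G_ (nu : probR R) : \bar R :=
  ereal_inf [set \int[nu]_x (V (c - x))%:E | c in [set: R]].

End rate.

(* Main.v *)
Require Import Defs.
From HB Require Import structures.
From mathcomp Require Import all_boot all_order all_algebra.
From mathcomp Require Import all_classical all_reals all_analysis measurable_realfun.
From mathcomp Require Import ring lra zify.

Set Implicit Arguments.
Unset Strict Implicit.
Unset Printing Implicit Defensive.

Import Order.TTheory GRing.Theory Num.Theory.
Import numFieldNormedType.Exports.

Local Open Scope classical_set_scope.
Local Open Scope ring_scope.

(* Write [E_c(nu) = - Sigma nu + \int V(c - x) dnu]. Convexity of the polynomial
   [V] only enters through [V x >= a |x|^p - C] with polynomial growth.
   Upper bound: replacing [ln |x - y|] by [ln (max |x - y| d)] and [V] by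
   [min V n] gives functionals that are Lipschitz for [d_{W_p}], uniformly in
   [c]; the sets where such a truncated energy exceeds [t], for all [c], are
   open, increase with the truncation and cover [{I > t}], so that a compact
   set on which the rate function exceeds [t] lies in a single one, where the
   density is pointwise small. The upper bound on the partition function is
   deterministic: smoothing the empirical measure changes its truncated energy
   by little, and the smoothed measure has energy at least [c_V].
   Lower bound: clip the reflected measure [tau_c nu] and convolve it with a law
   [phi] on [0, eps]; the result [rho] has a bounded density, and [phi] is
   chosen so that convolution hardly raises the logarithmic energy. Cut the
   support of [rho] into cells of equal mass, add one cell [c, c + h] for
   the largest eigenvalue, and let the points be independent, each distributed
   as [rho] conditioned on its cell. Jensen's inequality bounds the weight of
   the box of cells below, the conditioning costing only [O(N ln N)]; on this
   box the gaps and [nu] are coupled explicitly through [rho]. The lower bound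
   on the partition function is the same estimate for an almost minimiser. *)

(** Two obstacles shape the argument. Configurations are atomic, so [Sigma] is -oo on them and the
    energy itself says nothing about them. The logarithm is therefore used in two substitutes:
    [lell d], real-valued and Lipschitz, and the nonnegative kernel [kap D], which may be +oo but to
    which Tonelli's theorem always applies. Secondly, [c] ranges over a non-compact set, so
    truncating the potential must be harmless uniformly in [c]: for large [|c|] this comes from the
    coercivity of [V], for the other [c] from one common dominating function.

    The parameter [c] stands for the position of the largest eigenvalue. If [c] equals it, [tau c]
    turns the measure of the gaps back into the empirical measure of the other eigenvalues. The
    upper bound thus evaluates a level set at this configuration-dependent [c], while the lower
    bound is free to prescribe [c]. The exponent is of order [N ^+ 2]; everything of order [N] or
    [N * ln N] (diagonal terms, cell volumes) is lost in an arbitrarily small multiple of the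
    speed. *)

Section integral_monotone.
Context d (T : measurableType d) (R : realType) (mu : {measure set T -> \bar R}).
Local Open Scope ereal_scope.

(** The integral of a nonnegative function is a supremum over the simple functions below it, so
    monotonicity holds for arbitrary functions and sets. Events such as [[set l | K (dos l p)]],
    whose measurability is never established, are handled through this. *)
Lemma le_integral_fun (D : set T) (f g : T -> \bar R) :
  (forall x, D x -> f x <= g x) ->
  \int[mu]_(x in D) f x <= \int[mu]_(x in D) g x.
Proof.
move=> fg; rewrite (integral_mkcond D f) (integral_mkcond D g).
have {}fg x : (f \_ D) x <= (g \_ D) x.
  by rewrite !patchE; case: ifPn => //; rewrite inE => /fg.
rewrite integralE [leRHS]integralE; apply: leeB.
  rewrite !ge0_integralTE//.
  apply: le_ereal_sup => _ [h hf <-]; exists h => // x.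
  by apply: le_trans (hf x) _; rewrite !funeposE ge_max !le_max fg lexx orbT.
rewrite !ge0_integralTE//.
apply: le_ereal_sup => _ [h hf <-]; exists h => // x.
by apply: le_trans (hf x) _; rewrite !funenegE ge_max !le_max leeN2 fg lexx orbT.
Qed.

Lemma le_integral_set (A B : set T) (f : T -> \bar R) :
  (forall x, 0 <= f x) -> A `<=` B ->
  \int[mu]_(x in A) f x <= \int[mu]_(x in B) f x.
Proof.
move=> f0 AB; rewrite (integral_mkcond A) (integral_mkcond B).
apply: le_integral_fun => x _; rewrite !patchE; case: ifPn; case: ifPn => //.
by rewrite notin_setE inE => nB /AB.
Qed.

End integral_monotone.

Section average.
Context d (T : measurableType d) (R : realType) (P : nat -> probability T R)
  (n : nat).
Local Open Scope ereal_scope.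

(** Serves both for the mixture of uniform laws in the smoothing kernel and for empirical
    measures. *)
Definition average : set T -> \bar R :=
  mscale ((n.+1%:R^-1)%:nng : {nonneg R})%R (msum P n.+1).

HB.instance Definition _ := Measure.on average.

Lemma averageE A : average A = (n.+1%:R^-1)%:E * \sum_(k < n.+1) P k A.
Proof. by []. Qed.

Lemma average1 A : (forall k, (k < n.+1)%N -> P k A = 1) -> average A = 1.
Proof.
move=> h; rewrite averageE (eq_bigr (fun=> 1)) => [|k _]; last exact: h.
by rewrite sumEFin sumr_const card_ord -EFinM mulVf.
Qed.

Let averageT : average setT = 1.
Proof. by apply: average1 => k _; exact: probability_setT. Qed.

HB.instance Definition _ := Measure_isProbability.Build _ _ _ average averageT.

Lemma ge0_integral_average (f : T -> \bar R) :
  measurable_fun setT f -> (forall x, 0 <= f x) ->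
  \int[average]_x f x = (n.+1%:R^-1)%:E * \sum_(k < n.+1) \int[P k]_x f x.
Proof.
move=> mf f0.
rewrite (ge0_integral_mscale _ measurableT _ mf (fun x _ => f0 x)).
by rewrite (ge0_integral_measure_sum _ measurableT (fun x _ => f0 x) mf).
Qed.

End average.

Section real_lemmas.
Context {R : realType}.
Implicit Types x y : R.

Lemma ler_ln_pos x y : 0 < x -> x <= y -> ln x <= ln y.
Proof. by move=> x0 xy; rewrite ler_ln// posrE// (lt_le_trans x0). Qed.

Lemma ln_bound x : 0 < x -> ln x <= x - 1.
Proof.
move=> x0; have := @le_ln1Dx R (x - 1); rewrite subrKC; apply.
by rewrite ltrBrDl subrr.
Qed.

Lemma ln_ge_bound x : 0 < x -> 1 - x^-1 <= ln x.
Proof.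
move=> x0; have := @ln_bound x^-1; rewrite invr_gt0 x0 lnV ?posrE// => /(_ isT).
lra.
Qed.

Lemma ln_lt_self x : 0 < x -> ln x <= x.
Proof. by move=> x0; exact/ltW/ln_sublinear. Qed.

(** The surviving terms form a geometric tail, at most twice its largest term. If the first term
    survives, the induction hypothesis is used with cutoff [h / 2], which bounds the remaining terms
    by [h]. *)
Lemma geometric_sum_cut m (h A : R) : 0 <= h -> 0 <= A ->
  \sum_(k < m | h / 2 ^+ k <= A) h / 2 ^+ k <= 2 * A.
Proof.
elim: m h A => [|m IH] h A h0 A0; first by rewrite big_ord0; nra.
rewrite big_mkcond big_ord_recl/= expr0 divr1.
have E : \sum_(i < m) (if h / 2 ^+ bump 0 i <= A then h / 2 ^+ bump 0 i else 0)
  = \sum_(k < m | h / 2 / 2 ^+ k <= A) h / 2 / 2 ^+ k.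
  by rewrite [RHS]big_mkcond; apply: eq_bigr => i _;
    rewrite /bump/= exprS invfM mulrA.
rewrite E; have h20 : 0 <= h / 2 by rewrite divr_ge0.
have [hA|_] := leP h A; last by rewrite add0r IH.
have S : \sum_(k < m | h / 2 / 2 ^+ k <= A) h / 2 / 2 ^+ k <= h.
  apply: (@le_trans _ _ (\sum_(k < m | h / 2 / 2 ^+ k <= h / 2) h / 2 / 2 ^+ k)).
    rewrite big_mkcond [leRHS]big_mkcond/=; apply: ler_sum => k _.
    have -> : h / 2 / 2 ^+ k <= h / 2.
      rewrite ler_pdivrMr ?exprn_gt0// ler_peMr// exprn_ege1//.
      by rewrite ler1n.
    by case: ifP => // _; rewrite divr_ge0// exprn_ge0.
  by apply: (le_trans (IH _ _ h20 h20)); rewrite mulrC divfK.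
lra.
Qed.

End real_lemmas.

(** * Logarithmic kernel and smoothing *)

Section log_kernel.
Context {R : realType}.
Implicit Types a D : R.

(* [kap D] is [(ln (D / |a|))^+], with [kap D 0 = +oo]; [kapd] truncates it at scale [d]. *)
Definition kap (D a : R) : \bar R := maxe 0%E ((ln D)%:E - lne (`|a|%:E))%E.

Definition kapd (D d a : R) : R := Num.max 0 (ln D - ln (Num.max `|a| d)).

Lemma kap_ge0 D a : (0 <= kap D a)%E.
Proof. by rewrite /kap le_max lexx. Qed.

Lemma kapd_ge0 D d a : 0 <= kapd D d a.
Proof. by rewrite /kapd le_max lexx. Qed.

Lemma kapN D a : kap D (- a) = kap D a.
Proof. by rewrite /kap normrN. Qed.

Lemma kap0 D : kap D 0 = +oo%E.
Proof. by rewrite /kap normr0 /lne/= lexx/= maxey. Qed.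

Lemma kapE D a : a != 0 -> kap D a = (Num.max 0 (ln D - ln `|a|))%:E.
Proof. by move=> a0; rewrite /kap lne_EFin ?normr_gt0// EFin_max. Qed.

Lemma measurable_lne : measurable_fun [set: \bar R] (@lne R).
Proof.
apply: (@measurability _ _ _ _ _ _ _ (ErealGenOInfty.measurableE R)) => //.
move=> /= _ [_ [x ->] <-]; rewrite setTI.
rewrite (_ : _ @^-1` _ = `](expR x)%:E, +oo%E]%classic); last first.
  apply/seteqP; split => -[y| |] //=; rewrite !in_itv/= ?andbT ?leey ?andbT//.
  - case: ifPn => //; rewrite -ltNge !lte_fin => y0 xy.
    by rewrite -ltr_ln ?posrE ?expR_gt0// expRK.
  - by rewrite !ltry.
  - rewrite lte_fin => xy; have y0 := lt_trans (expR_gt0 x) xy.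
    rewrite leNgt y0/= lte_fin.
    by rewrite -ltr_ln ?posrE ?expR_gt0// expRK in xy.
  - by rewrite !ltry.
exact: emeasurable_itv.
Qed.

Lemma measurable_kap D : measurable_fun [set: measurableTypeR R] (kap D).
Proof.
apply: measurable_maxe => //; apply: emeasurable_funB => //.
apply: measurableT_comp; first exact: measurable_lne.
by apply/measurable_EFinP; exact: normr_measurable.
Qed.

Let mu := @lebesgue_measure R.

Definition shell (a h : R) (k : nat) : set R :=
  `[a - h / 2 ^+ k, a + h / 2 ^+ k]%classic.

(** The number of shells around [a] that contain [s] exceeds [ln (h / |a - s|)]: since [ln 2 <= 1],
    every unit of this logarithm allows one more halving of the radius. At [s = a] both sides are
    +oo. *)
Lemma kap_layer_cake (D a h s : R) : 0 < h -> h <= D ->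
  (kap D (a - s) <= (ln D - ln h)%:E +
     \sum_(k <oo) (\1_(shell a h k) s : R)%:E)%E.
Proof.
move=> h0 hD.
have lnDh : 0 <= ln D - ln h by rewrite subr_ge0 ler_ln_pos.
have ind_ge0 k : (0 <= (\1_(shell a h k) s : R)%:E)%E.
  by rewrite lee_fin.
have part n : (forall k, (k < n)%N -> `|a - s| <= h / 2 ^+ k) -> (n%:R%:E <=
    \sum_(k <oo) (\1_(shell a h k) s : R)%:E)%E.
  move=> hn; apply: (le_trans _ (nneseries_lim_ge n _)) => [|k _ _]; last exact: ind_ge0.
  rewrite big_mkord (eq_bigr (fun=> 1%E)) => [|k _].
    by rewrite sumEFin sumr_const card_ord.
  rewrite indicE mem_set//= /shell/= in_itv/=.
  have := hn k (ltn_ord k); rewrite ler_norml => /andP[u v].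
  by apply/andP; split; lra.
have [as0|as0] := eqVneq (a - s) 0.
  have -> : (\sum_(k <oo) (\1_(shell a h k) s : R)%:E
     = +oo)%E.
    apply/eqyP => A A0; apply: le_trans (part (Num.truncn A).+1 _).
      by rewrite lee_fin ltW// truncnS_gt// ltW.
    by move=> k _; rewrite as0 normr0 divr_ge0// ?exprn_ge0// ltW.
  by rewrite addey ?leey.
rewrite kapE//; set y := ln h - ln `|a - s|.
have [y0|y0] := leP y 0.
  apply: (@le_trans _ _ (ln D - ln h)%:E).
    by rewrite lee_fin ge_max lnDh /= /y in y0 *; lra.
  by rewrite leeDl// nneseries_ge0.
apply: (@le_trans _ _ ((ln D - ln h)%:E + (Num.truncn y).+1%:R%:E)%E); last first.
  rewrite leeD2l//; apply: part => k kn.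
  rewrite ler_pdivlMr ?exprn_gt0// mulrC.
  rewrite -ler_ln ?posrE ?mulr_gt0 ?exprn_gt0 ?normr_gt0//.
  rewrite lnM ?posrE ?exprn_gt0 ?normr_gt0// lnXn//.
  have ky : k%:R <= y by rewrite -truncn_ge_nat// ltW.
  have l2 : ln 2 <= 1 :> R by have := @ln_bound R 2 ltac:(by []); lra.
  have : ln 2 *+ k <= k%:R :> R by rewrite -[ln 2 *+ k]mulr_natr ler_piMl.
  by rewrite /y in ky *; lra.
rewrite -EFinD lee_fin ge_max; apply/andP; split.
  by rewrite addr_ge0.
have := truncnS_gt y; rewrite /y; lra.
Qed.

Lemma measurable_kapB D a : measurable_fun [set: measurableTypeR R]
  (fun s => kap D (a - s)).
Proof. by apply: measurableT_comp; [exact: measurable_kap|exact: measurable_funB]. Qed.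

(** The shells have lengths [2 * h / 2 ^+ k], with sum [4 * h] wherever their centre [a] lies; hence
    the uniformity in [a]. *)
Lemma integral_kap_itv (D a h : R) : 0 < h -> h <= D ->
  (\int[mu]_(s in `[0%R, h]) kap D (a - s) <= (h * (ln D - ln h + 4))%:E)%E.
Proof.
move=> h0 hD.
have lnDh : 0 <= ln D - ln h by rewrite subr_ge0 ler_ln_pos.
have mI k : measurable_fun `[0%R, h]%classic
    (fun s : measurableTypeR R => (\1_(shell a h k) s : R)%:E).
  apply/measurable_EFinP; apply: measurable_funTS; apply: measurable_indic.
  exact: measurable_itv.
apply: le_trans.
  by apply: le_integral_fun => s _; exact: (kap_layer_cake a s h0 hD).
rewrite ge0_integralD//=; first last.
- by apply: ge0_emeasurable_sum => [k s _ _|k _]; [rewrite lee_fin|exact: mI].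
- by move=> s _; apply: nneseries_ge0 => k _ _; rewrite lee_fin.
rewrite integral_nneseries//.
rewrite integral_cst//= lebesgue_measure_itv/= lte_fin h0 oppr0 adde0.
have -> : h * (ln D - ln h + 4) = (ln D - ln h) * h + 4 * h by ring.
rewrite [leRHS]EFinD EFinM; apply: leeD => //.
apply: (@le_trans _ _ (\sum_(k <oo) ((4 * h) / (2 ^ k.+1)%:R)%:E)%E); last first.
  by rewrite epsilon_trick0// mulr_ge0// ltW.
apply: lee_nneseries => [k _|k _].
  by move=> _; apply: integral_ge0 => s _; rewrite lee_fin.
rewrite integral_indic//; last exact: measurable_itv.
apply: (@le_trans _ _ (mu (shell a h k))).
  have mS : measurable (shell a h k : set (measurableTypeR R)) by exact: measurable_itv.
  by apply: le_measure; rewrite ?inE//; apply: measurableI => //; exact: measurable_itv.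
rewrite /mu /shell lebesgue_measure_itv/= lte_fin.
have E : (a + h / 2 ^+ k) - (a - h / 2 ^+ k) = 4 * h / (2 ^ k.+1)%:R.
  rewrite natrX exprS; field.
  by rewrite expf_neq0.
case: ifP => _; rewrite -?EFinB ?E// lee_fin divr_ge0// mulr_ge0// ltW//.
Qed.

Lemma integral_kap_uniform (D a h : R) (h0 : 0 < h) : h <= D ->
  (\int[uniform_prob h0]_s kap D (a - s) <= (ln D - ln h + 4)%:E)%E.
Proof.
move=> hD; rewrite integral_uniform; first last.
- by move=> x; exact: kap_ge0.
- exact: measurable_kapB.
rewrite subr0; apply: (@le_trans _ _ (h^-1%:E * (h * (ln D - ln h + 4))%:E)%E).
  by rewrite lee_pmul2l ?lte_fin ?invr_gt0//; exact: integral_kap_itv.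
by rewrite -EFinM mulKf// gt_eqF.
Qed.

(** At distance at least [2 * h] from the singularity, a shift by [s <= h] lowers [ln |a|] by at
    most [2 * h / |a|]: with [r = h / |a| <= 1 / 2], [ln (1 - r) >= 1 - (1 - r)^-1 >= - 2 * r]. *)
Lemma integral_kap_uniform_far (D a h : R) (h0 : 0 < h) : h <= `|a| / 2 ->
  (\int[uniform_prob h0]_s kap D (a - s) <=
    (Num.max 0 (ln D - ln `|a|) + 2 * (h / `|a|))%:E)%E.
Proof.
move=> ha; rewrite integral_uniform; first last.
- by move=> x; exact: kap_ge0.
- exact: measurable_kapB.
set c := (X in (_ <= X%:E)%E).
have a0 : 0 < `|a| by lra.
have c0 : 0 <= c.
  by rewrite addr_ge0// ?le_max ?lexx// mulr_ge0// divr_ge0// ltW.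
apply: (@le_trans _ _ (h^-1%:E * \int[mu]_(s in `[0%R, h]) (cst c%:E s))%E).
  rewrite subr0 lee_pmul2l ?lte_fin ?invr_gt0//.
  apply: le_integral_fun => s /=; rewrite in_itv/= => /andP[s0 sh].
  have as_ : `|a| - h <= `|a - s|.
    have := ler_normD (a - s) s; rewrite subrK (ger0_norm s0); lra.
  have as0 : 0 < `|a - s| by lra.
  rewrite kapE -?normr_gt0// lee_fin /c ge_max; apply/andP; split; first exact: c0.
  have L : ln `|a| - 2 * (h / `|a|) <= ln `|a - s|.
    apply: (le_trans _ (ler_ln_pos _ as_)); last by lra.
    have -> : `|a| - h = `|a| * (1 - h / `|a|).
      by field; rewrite gt_eqF.
    set r := h / `|a|.
    have r12 : r <= 1 / 2 by rewrite /r ler_pdivrMr//; lra.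
    have r0 : 0 <= r by rewrite divr_ge0// ltW.
    rewrite lnM ?posrE//; last by lra.
    have := @ln_ge_bound R (1 - r) ltac:(lra).
    have : (1 - r)^-1 <= 1 + 2 * r.
      rewrite -[_^-1]mul1r ler_pdivrMr; nra.
    lra.
  have : ln D - ln `|a| <= Num.max 0 (ln D - ln `|a|) by rewrite le_max lexx orbT.
  lra.
rewrite integral_cst//= lebesgue_measure_itv/= lte_fin h0 oppr0 adde0.
by rewrite -!EFinM mulrCA mulVf ?mulr1// gt_eqF.
Qed.

Lemma uniform_prob_le_lebesgue (h : R) (h0 : 0 < h) (A : set (measurableTypeR R)) :
  measurable A -> (uniform_prob h0 A <= h^-1%:E * mu A)%E.
Proof.
move=> mA; rewrite /uniform_prob.
rewrite -integral_cst//; apply: le_integral_fun => x _.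
rewrite lee_fin /uniform_pdf subr0; case: ifP => // _.
by rewrite invr_ge0 ltW.
Qed.

Lemma uniform_prob_carrier (h e : R) (h0 : 0 < h) : h <= e ->
  uniform_prob h0 `[0, e]%classic = 1%E.
Proof.
move=> he; rewrite /uniform_prob integral_uniform_pdf1//.
by move=> x /=; rewrite !in_itv/= => /andP[-> /le_trans ->].
Qed.

(* A mixture of uniform laws at the scales [2^-k]: at most a bounded number of
   scales are comparable with [|a|], and only those lose more than [O(2^-k/|a|)],
   so that averaging over many scales makes the loss arbitrarily small. *)
Lemma smoothing_kernel (eps : R) : 0 < eps ->
  exists (phi : probR R) (B d : R),
  [/\ 0 < B, 0 < d <= 1, phi `[0, eps]%classic = 1%E,
      forall A, measurable A -> (phi A <= B%:E * mu A)%E &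
      forall D a, 1 <= D ->
        (\int[phi]_s kap D (a - s) <= (kapd D d a + eps)%:E)%E].
Proof.
move=> eps0; pose c := Num.min eps 1.
have c0 : 0 < c by rewrite lt_min eps0/=.
have h0 k : 0 < c / 2 ^+ k by rewrite divr_gt0// exprn_gt0.
pose P k : probR R := uniform_prob (h0 k).
pose E4 : R := expR 4.
have E40 : 0 < E4 by exact: expR_gt0.
(* For any [a], the losses summed over all scales are at most [20 * E4]: a scale [h <= E4 * |a|]
   loses at most [10 * h / |a|], and these scales sum to at most [2 * E4 * |a|]. Averaging over
   [m.+1] scales brings the loss below [eps]. *)
pose m := Num.truncn (20 * E4 / eps).
(* The density is bounded by that of the finest scale. Dividing this scale by [E4 = expR 4] in the
   third witness absorbs the additive [4] of [integral_kap_uniform], so that nothing is lost when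
   [|a| <= d]. *)
exists (average P m), (2 ^+ m / c), (c / 2 ^+ m / E4).
have hc k : c / 2 ^+ k <= c.
  rewrite ler_pdivrMr ?exprn_gt0// ler_peMr//; first exact: ltW.
  by apply: exprn_ege1; rewrite ler1n.
have c1 : c <= 1 by rewrite ge_min lexx orbT.
have hm k : (k < m.+1)%N -> c / 2 ^+ m <= c / 2 ^+ k.
  move=> km; apply: ler_wpM2l; first exact: ltW.
  rewrite ler_pV2 ?inE ?unitfE ?expf_neq0 ?exprn_gt0//.
  by rewrite ler_eXn2l// ltr1n.
have mN : (m.+1%:R != 0 :> R) by rewrite pnatr_eq0.
split.
- by rewrite divr_gt0// exprn_gt0.
- rewrite divr_gt0//=.
  rewrite ler_pdivrMr// mul1r (le_trans (hc m))// (le_trans c1)//.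
  by rewrite -expR0 ler_expR.
- apply: average1 => k _; apply: uniform_prob_carrier.
  by rewrite (le_trans (hc k))// ge_min lexx.
- move=> A mA.
  apply: (@le_trans _ _ ((m.+1%:R^-1)%:E *
      \sum_(k < m.+1) ((2 ^+ m / c)%:E * mu A))%E).
    rewrite -[leLHS]/(((m.+1%:R^-1)%:E * \sum_(k < m.+1) P k A)%E).
    rewrite lee_pmul2l//; apply: lee_sum => k _.
    apply: (le_trans (uniform_prob_le_lebesgue _ mA)).
    rewrite lee_wpmul2r// lee_fin -[leRHS]invf_div ler_pV2 ?inE ?unitfE ?h0 ?gt_eqF//.
    exact: hm.
  have [mA1|] := boolP (mu A \is a fin_num).
    rewrite -(fineK mA1) -!EFinM sumEFin sumr_const card_ord -EFinM lee_fin.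
    by rewrite -[X in _ * X <= _]mulr_natl mulKf.
  rewrite ge0_fin_numE// -leNgt leye_eq => /eqP ->.
  by rewrite gt0_muley ?lte_fin ?divr_gt0 ?exprn_gt0// leey.
move=> D a D1; rewrite ge0_integral_average; first last.
- by move=> x; exact: kap_ge0.
- exact: measurable_kapB.
have hD k : c / 2 ^+ k <= D by rewrite (le_trans (hc k))// (le_trans c1).
have near_ k : (\int[P k]_s kap D (a - s) <= (ln D - ln (c / 2 ^+ k) + 4)%:E)%E.
  exact: integral_kap_uniform.
rewrite /kapd; set d := c / 2 ^+ m / E4.
have d0 : 0 < d by rewrite /d !divr_gt0// exprn_gt0.
have lnd : ln d = ln (c / 2 ^+ m) - 4.
  by rewrite /d ln_div ?posrE// expRK.
have avg (T : R) (u : nat -> R) :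
    (forall k, (\int[P k]_s kap D (a - s) <= (T + u k)%:E)%E) \/
    (forall k, (k < m.+1)%N -> (\int[P k]_s kap D (a - s) <= (T + u k)%:E)%E) ->
    \sum_(k < m.+1) u k <= 20 * E4 ->
    ((m.+1%:R^-1)%:E * \sum_(k < m.+1) \int[P k]_s kap D (a - s) <=
     (T + eps)%:E)%E.
  move=> H su; apply: (@le_trans _ _ ((m.+1%:R^-1)%:E *
      \sum_(k < m.+1) (T + u k)%:E)%E).
    rewrite lee_pmul2l//; apply: lee_sum => k _.
    by case: H => [|H]; [exact|exact: H].
  rewrite sumEFin -EFinM lee_fin big_split/= sumr_const card_ord mulrDr.
  rewrite -[T *+ _]mulr_natl mulKf// lerD2l.
  rewrite ler_pdivrMl ?ltr0n// (le_trans su)//.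
  by rewrite -ler_pdivrMr// ltW// truncnS_gt.
have [ad|da] := leP `|a| d.
  apply: (avg _ (fun=> 0)); last by rewrite sumr_const mul0rn mulr_ge0// ltW.
  right=> k km; rewrite addr0; apply: (le_trans (near_ k)); rewrite lee_fin.
  rewrite le_max; apply/orP; right; rewrite lnd.
  have := ler_ln_pos (h0 m) (hm k km); lra.
have a0 : 0 < `|a| by exact: lt_trans da.
apply: (avg _ (fun k => if c / 2 ^+ k <= E4 * `|a|
    then 10 * (c / 2 ^+ k / `|a|) else 0)); last first.
  rewrite -big_mkcond/= -mulr_sumr -mulr_suml.
  have := @geometric_sum_cut R m.+1 c (E4 * `|a|) (ltW c0) (mulr_ge0 (ltW E40) (ltW a0)).
  set S := (X in X <= _ -> _) => HS.
  by rewrite -/S mulrA ler_pdivrMr//; lra.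
left => k; have r0 : 0 < c / 2 ^+ k / `|a| by rewrite divr_gt0.
have [hfar|hnear] := leP (c / 2 ^+ k) (`|a| / 2).
  apply: (le_trans (integral_kap_uniform_far D (h0 k) hfar)).
  rewrite lee_fin; case: ifPn => [_|].
    by lra.
  rewrite -ltNge => H; exfalso.
  have E41 : 1 <= E4 by rewrite /E4 -expR0 ler_expR.
  have : `|a| <= E4 * `|a| by rewrite ler_peMl// ltW.
  lra.
(* A scale between [|a| / 2] and [E4 * |a|] loses at most [4 + ln 2 <= 5], and there
   [10 * h / |a| >= 5]. A scale above [E4 * |a|] loses nothing, its [4] being offset by [ln E4]. *)
apply: (le_trans (near_ k)); rewrite lee_fin.
have Dm : ln D - ln `|a| <= Num.max 0 (ln D - ln `|a|) by rewrite le_max lexx orbT.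
case: ifPn => [_|].
  have : ln `|a| - ln 2 <= ln (c / 2 ^+ k).
    by rewrite -ln_div ?posrE//; apply: ler_ln_pos; [rewrite divr_gt0|exact: ltW].
  have := @ln_bound R 2 ltac:(by []).
  have : 1 / 2 <= c / 2 ^+ k / `|a| by rewrite ler_pdivlMr// mulrC; lra.
  lra.
rewrite -ltNge => /ltW/(ler_ln_pos (mulr_gt0 E40 a0)).
by rewrite lnM ?posrE// expRK; lra.
Qed.

End log_kernel.

Section probability_integral.
Context d (T : measurableType d) (R : realType) (P : probability T R).
Local Open Scope ereal_scope.

Lemma integral_cst_prob (r : \bar R) : \int[P]_x r = r.
Proof. by rewrite integral_cst// [X in _ * X]probability_setT mule1. Qed.

Lemma integrable_cst_prob (r : R) : P.-integrable setT (fun=> r%:E).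
Proof. exact: finite_measure_integrable_cst. Qed.

End probability_integral.

Section law.
Context d d' (T : measurableType d) (T' : measurableType d') (R : realType)
  (P : probability T R) (f : T -> T').
Local Open Scope ereal_scope.

(** Keeps the measurability proof as an argument, so that a structure of measurable function can be
    attached to an arbitrary map. *)
Definition mfun_of (mf : measurable_fun setT f) : T -> T' := f.

HB.instance Definition _ (mf : measurable_fun setT f) :=
  isMeasurableFun.Build _ _ _ _ (mfun_of mf) mf.

Definition law (mf : measurable_fun setT f) : probability T' R :=
  distribution P (mfun_of mf).

Variable mf : measurable_fun setT f.

Lemma lawE A : law mf A = P (f @^-1` A).
Proof. by []. Qed.

Lemma ge0_integral_law (g : T' -> \bar R) :
  measurable_fun setT g -> (forall y, 0 <= g y) ->
  \int[law mf]_y g y = \int[P]_x g (f x).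
Proof. by move=> mg g0; rewrite ge0_integral_pushforward. Qed.

End law.

Section smear.
Context {R : realType}.
Local Open Scope ereal_scope.
Variables (T : R -> R) (mT : measurable_fun [set: measurableTypeR R] T)
  (rho phi : probR R).
Let mu := @lebesgue_measure R.

Lemma measurable_smear_map :
  measurable_fun [set: measurableTypeR R * measurableTypeR R]
    (fun z => (T z.1 - z.2)%R : measurableTypeR R).
Proof.
apply: measurable_funB; last exact: measurable_snd.
by apply: measurableT_comp; [exact: mT|exact: measurable_fst].
Qed.

(** The law of [T X - S] for independent [X] of law [rho] and [S] of law [phi]. The map [T] is the
    identity for configurations and a clipped reflection in the lower bound. *)
Definition smear : probR R := law (rho \x phi) measurable_smear_map.

Lemma ge0_integral_smear (g : measurableTypeR R -> \bar R) :
  measurable_fun setT g -> (forall y, 0 <= g y) ->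
  \int[smear]_y g y = \int[rho]_x \int[phi]_s g (T x - s)%R.
Proof.
move=> mg g0; rewrite ge0_integral_law// fubini_tonelli1//.
by apply: measurableT_comp => //; exact: measurable_smear_map.
Qed.

Lemma lebesgue_measure_reflect (c : R) (A : set (measurableTypeR R)) :
  measurable A -> mu ((fun s : measurableTypeR R => (c - s)%R) @^-1` A) = mu A.
Proof.
move=> mA; pose nu := pushforward mu (@Defs.reflect R c).
have -> : mu ((fun s : measurableTypeR R => (c - s)%R) @^-1` A) = nu A by [].
apply/esym/lebesgue_measure_unique => //= _ [[a b]] _ <-.
rewrite /nu /pushforward.
rewrite (_ : _ @^-1` _ = `[c - b, c - a[%classic)%R; last first.
  by apply/seteqP; split => x /=; rewrite !in_itv/= /Defs.reflect => /andP[? ?];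
    apply/andP; split; lra.
rewrite /mu !lebesgue_measure_itv/= !lte_fin.
by rewrite ltrD2l ltrN2; case: ifPn => // _; rewrite -!EFinB; congr EFin; ring.
Qed.

(** For fixed [x], the law of [T x - S] inherits the density bound of [phi], as reflections preserve
    Lebesgue measure; mixing over [x] keeps it. *)
Lemma smear_le_lebesgue (B : R) : (0 <= B)%R ->
  (forall A, measurable A -> phi A <= B%:E * mu A) ->
  forall A, measurable A -> smear A <= B%:E * mu A.
Proof.
move=> B0 phiB A mA.
have mA' x : measurable ((fun s : measurableTypeR R => (T x - s)%R) @^-1` A).
  by rewrite -[X in measurable X]setTI; exact: (measurable_reflect (T x)).
have -> : smear A = \int[smear]_y (\1_A y)%:E by rewrite integral_indic// setIT.
rewrite ge0_integral_smear => [|//|y]; first last.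
- by rewrite lee_fin.
- exact/measurable_EFinP/measurable_indic.
apply: (@le_trans _ _ (\int[rho]_x cst (B%:E * mu A) x)); last first.
  by rewrite integral_cst_prob.
apply: le_integral_fun => x _ /=; rewrite -(lebesgue_measure_reflect (T x) mA).
apply: (le_trans _ (phiB _ (mA' x))).
have -> : (fun s => (\1_A (T x - s))%:E : \bar R) =
  (fun s => (\1_((fun s : measurableTypeR R => (T x - s)%R) @^-1` A) s)%:E).
  by apply/funext => s; rewrite !indicE; congr (_%:R%:E); congr nat_of_bool;
    apply/idP/idP; rewrite !inE.
by rewrite integral_indic// setIT.
Qed.

Lemma smear_carrier (A B C : set (measurableTypeR R)) :
  measurable A -> measurable B -> measurable C ->
  rho A = 1 -> phi B = 1 ->
  (forall x s, A x -> B s -> C (T x - s)%R) -> smear C = 1.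
Proof.
move=> mA mB mC rA pB ABC; apply/eqP; rewrite eq_le probability_le1//=.
have {1}<- : (rho \x phi) (A `*` B) = 1.
  by rewrite product_measure1E// -[RHS]mule1; congr (_ * _).
apply: le_measure; rewrite ?inE//.
- exact: measurableX.
- by rewrite -[X in measurable X]setTI; exact: measurable_smear_map.
- by move=> [x s] /= [? ?]; exact: ABC.
Qed.

End smear.

Section energy.
Context {R : realType}.
Local Open Scope ereal_scope.
Implicit Types (rho phi : probR R) (D d a : R).

Lemma measurable_kapd D d : measurable_fun [set: measurableTypeR R] (kapd D d).
Proof.
apply: measurable_maxr => //; apply: measurable_funB => //.
apply: measurableT_comp; first exact: measurable_ln.
by apply: measurable_maxr => //; exact: normr_measurable.
Qed.

Lemma kapdN D d a : kapd D d (- a) = kapd D d a.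
Proof. by rewrite /kapd normrN. Qed.

Lemma kapd_le_kap D d a : (0 < d)%R -> (kapd D d a)%:E <= kap D a.
Proof.
move=> d0; have [->|a0] := eqVneq a 0%R; first by rewrite kap0 leey.
rewrite kapE// lee_fin /kapd ge_max le_max lexx/= le_max; apply/orP; right.
rewrite lerD2l lerN2 ler_ln_pos ?normr_gt0//.
by rewrite le_max lexx.
Qed.

(** For a measure carried by a set of diameter at most [D] this is [ln D - Sigma rho], with a
    nonnegative integrand. *)
Definition kap_energy D rho := \int[rho]_x \int[rho]_y kap D (x - y)%R.

Lemma measurable_kap2 D : measurable_fun
  [set: measurableTypeR R * measurableTypeR R] (fun z => kap D (z.1 - z.2)%R).
Proof.
apply: measurableT_comp; first exact: measurable_kap.
by apply: measurable_funB; [exact: measurable_fst|exact: measurable_snd].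
Qed.

Lemma kap_energyE D rho :
  kap_energy D rho = \int[rho \x rho]_z kap D (z.1 - z.2)%R.
Proof.
by rewrite fubini_tonelli1//; [exact: measurable_kap2|move=> z; exact: kap_ge0].
Qed.

(** The two independent copies of the noise are integrated out one at a time, each at the cost
    [eps]. The first integration turns [kap] into [kapd], which is at most [kap], so that the
    hypothesis on [phi] applies a second time. *)
Lemma kap_energy_smear D d eps (T : R -> R)
    (mT : measurable_fun [set: measurableTypeR R] T) rho phi :
  (1 <= D)%R -> (0 < d)%R -> (0 <= eps)%R ->
  (forall a, \int[phi]_s kap D (a - s)%R <= (kapd D d a + eps)%:E) ->
  kap_energy D (smear mT rho phi) <=
  \int[rho]_x \int[rho]_y (kapd D d (T x - T y) + 2 * eps)%:E.
Proof.
move=> D1 d0 eps0 Hphi; rewrite /kap_energy.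
have mk1 : measurable_fun [set: measurableTypeR R * measurableTypeR R]
    (fun z => kap D (z.1 - z.2)%R) := measurable_kap2 D.
have mF : measurable_fun [set: measurableTypeR R] (fun x : measurableTypeR R =>
    \int[smear mT rho phi]_y kap D (x - y)%R).
  exact: (measurable_fun_fubini_tonelli_F _ mk1 (fun _ => kap_ge0 _ _)).
rewrite ge0_integral_smear//; last first.
  by move=> x; apply: integral_ge0 => y _; exact: kap_ge0.
apply: le_integral_fun => x _.
pose g (z : measurableTypeR R * measurableTypeR R) : \bar R :=
  (kapd D d (T x - z.1 - T z.2) + eps)%:E.
have g0 z : 0 <= g z by rewrite lee_fin addr_ge0// kapd_ge0.
have mg : measurable_fun [set: measurableTypeR R * measurableTypeR R] g.
  apply/measurable_EFinP; apply: measurable_funD => //.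
  apply: measurableT_comp; first exact: measurable_kapd.
  apply: measurable_funB.
    by apply: measurable_funB => //; exact: measurable_fst.
  by apply: measurableT_comp; [exact: mT|exact: measurable_snd].
apply: (@le_trans _ _ (\int[phi]_s \int[rho]_y g (s, y))).
  apply: le_integral_fun => s _.
  rewrite ge0_integral_smear; first last.
  - by move=> y; exact: kap_ge0.
  - exact: measurable_kapB.
  apply: le_integral_fun => y _; rewrite /g/= -kapdN.
  apply: le_trans (Hphi _); apply: le_integral_fun => t _.
  rewrite -kapN; have -> //: (- (T x - s - (T y - t)) =
    - (T x - s - T y) - t)%R by ring.
rewrite (fubini_tonelli _ mg g0).
apply: le_integral_fun => y _.
apply: (@le_trans _ _ (\int[phi]_s (kap D (T x - T y - s)%R + eps%:E))).
  apply: le_integral_fun => s _; rewrite /g/= EFinD leeD2r//.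
  have -> : (T x - s - T y = T x - T y - s)%R by ring.
  exact: kapd_le_kap.
rewrite ge0_integralD//; first last.
- exact: measurable_kapB.
- by move=> s _; exact: kap_ge0.
rewrite integral_cst_prob mulr2n mulrDl mul1r addrA.
by rewrite [leRHS]EFinD leeD2r.
Qed.

(** Pointwise [ln D - kap D] is at most the logarithm; finiteness allows this difference to be
    integrated term by term. *)
Lemma Sigma_ge_kap D rho : kap_energy D rho < +oo ->
  (ln D)%:E - kap_energy D rho <= Sigma rho.
Proof.
move=> fin; have fin2 : (rho \x rho).-integrable setT (fun z => kap D (z.1 - z.2)%R).
  apply/integrableP; split; first exact: measurable_kap2.
  under eq_integral do rewrite gee0_abs ?kap_ge0//.
  by rewrite -kap_energyE.
have -> : (ln D)%:E - kap_energy D rho =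
    \int[rho \x rho]_z ((ln D)%:E - kap D (z.1 - z.2)%R).
  rewrite integralB//; last exact: (integrable_cst_prob (rho \x rho)).
  by rewrite (integral_cst_prob (rho \x rho)) kap_energyE.
apply: le_integral_fun => z _.
have [->|z0] := eqVneq (z.1 - z.2)%R 0%R; first by rewrite kap0 leNye.
rewrite kapE// lne_EFin ?normr_gt0// -EFinB lee_fin lerBlDr addrC -lerBlDr.
by rewrite le_max lexx orbT.
Qed.

End energy.

(** * Truncated energies and Wasserstein distance *)

Section lipschitz.
Context {R : realType}.
Implicit Types (k c d : R) (f g : R -> R) (rho nu : probR R).

Definition lip k f := forall x y, `|f x - f y| <= k * `|x - y|.

Definition has_mean rho := rho.-integrable setT (fun x : measurableTypeR R => (x : R)%:E).

Lemma lip_continuous k f : lip k f -> continuous f.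
Proof.
move=> lf x; apply/cvgrPdist_le => e e0.
have K0 : 0 < `|k| + 1 by rewrite ltr_wpDl.
near=> y; apply: (le_trans (lf x y)).
apply: (@le_trans _ _ ((`|k| + 1) * `|x - y|)).
  by apply: ler_wpM2r => //; have := ler_norm k; lra.
rewrite mulrC -ler_pdivlMr//; near: y.
by apply: (@cvgr_dist_le _ _ _ _ _ id x) => //; rewrite divr_gt0.
Unshelve. all: by end_near. Qed.

Lemma lip_measurable k f : lip k f ->
  measurable_fun [set: measurableTypeR R] (f : measurableTypeR R -> R).
Proof. by move=> /lip_continuous; exact: continuous_measurable_fun. Qed.

Lemma lip_integrable k f rho : has_mean rho -> lip k f ->
  rho.-integrable setT (fun x : measurableTypeR R => (f x)%:E).
Proof.
move=> hm lf.
have k0 : 0 <= k.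
  by have := lf 1 0; rewrite subr0 normr1 mulr1; apply: le_trans.
apply: (@le_integrable _ _ _ _ _ _ _
    (fun x : measurableTypeR R => (`|f 0| + k * `|x : R|)%:E)) => //.
- by apply/measurable_EFinP; exact: lip_measurable lf.
- move=> x _ /=; rewrite lee_fin [leRHS]ger0_norm; last first.
    by rewrite addr_ge0// mulr_ge0.
  have := lf x 0; rewrite subr0; have := ler_normD (f x - f 0) (f 0).
  by rewrite subrK; lra.
- under eq_fun do rewrite EFinD EFinM.
  apply: integrableD => //; first exact: integrable_cst_prob.
  by apply: integrableZl => //; exact: integrable_abse hm.
Qed.

Lemma le_expectation k k' f g rho : has_mean rho -> lip k f -> lip k' g ->
  (forall x, f x <= g x) -> \int[rho]_x f x <= \int[rho]_x g x.
Proof.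
by move=> hm lf lg fg; apply: le_Rintegral => //; exact: lip_integrable.
Qed.

Lemma mean_cst rho c : \int[rho]_x c = c :> R.
Proof. by rewrite /Rintegral integral_cst_prob. Qed.

Lemma expectation_fin k f rho : has_mean rho -> lip k f ->
  (\int[rho]_x (f x)%:E = (\int[rho]_x f x)%R%:E)%E.
Proof.
by move=> hm lf; rewrite fineK//; exact/integrable_fin_num/(lip_integrable hm lf).
Qed.

(** The easy half of Kantorovich duality: both expectations become integrals against the
    coupling. *)
Lemma coupling_lip k f mu nu (pi : probability (measurableTypeR R * measurableTypeR R)%type R) e :
  has_mean mu -> has_mean nu -> lip k f -> 0 <= k -> coupling mu nu pi ->
  (\int[pi]_z (`|z.1 - z.2|)%:E <= e%:E)%E ->
  \int[mu]_x f x <= \int[nu]_x f x + k * e.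
Proof.
move=> hmu hnu lf k0 [pmu pnu] pie.
have mf := lip_measurable lf.
have mEf : measurable_fun [set: measurableTypeR R] (EFin \o f) by exact/measurable_EFinP.
have mfst : measurable_fun [set: measurableTypeR R * measurableTypeR R]
   (fst : _ -> measurableTypeR R) by exact: measurable_fst.
have msnd : measurable_fun [set: measurableTypeR R * measurableTypeR R]
   (snd : _ -> measurableTypeR R) by exact: measurable_snd.
have e1 A : measurable A -> mu A = pushforward pi fst A.
  by move=> mA; rewrite -pmu//; congr (pi _); apply/seteqP; split => -[x y] //= [].
have e2 A : measurable A -> nu A = pushforward pi snd A.
  by move=> mA; rewrite -pnu//; congr (pi _); apply/seteqP; split => -[x y] //= [].
have i1 : pi.-integrable setT (EFin \o (fun z => f z.1)).
  apply/integrableP; split; first by exact: (measurableT_comp mEf mfst).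
  have /integrableP[_] := lip_integrable hmu lf.
  rewrite (eq_measure_integral (pushforward pi fst)) => [|A mA _]; last exact: e1.
  by rewrite ge0_integral_pushforward//; exact: measurableT_comp.
have i2 : pi.-integrable setT (EFin \o (fun z => f z.2)).
  apply/integrableP; split; first by exact: (measurableT_comp mEf msnd).
  have /integrableP[_] := lip_integrable hnu lf.
  rewrite (eq_measure_integral (pushforward pi snd)) => [|A mA _]; last exact: e2.
  by rewrite ge0_integral_pushforward//; exact: measurableT_comp.
rewrite -lee_fin EFinD -(expectation_fin hmu lf) -(expectation_fin hnu lf).
rewrite (eq_measure_integral (pushforward pi fst)) => [|A mA _]; last exact: e1.
rewrite [X in (_ <= X + _)%E](eq_measure_integral (pushforward pi snd)) => [|A mA _]; last exact: e2.
rewrite !integral_pushforward//.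
have md : measurable_fun [set: measurableTypeR R * measurableTypeR R]
    (fun z => (`|z.1 - z.2|)%:E).
  by apply/measurable_EFinP; apply: measurableT_comp => //; exact: measurable_funB.
have id_ : pi.-integrable setT (fun z => (`|z.1 - z.2|)%:E).
  apply/integrableP; split => //; under eq_integral do rewrite /= normr_id.
  exact: le_lt_trans pie (ltry _).
apply: (@le_trans _ _ (\int[pi]_z ((f z.2)%:E + k%:E * (`|z.1 - z.2|)%:E))%E).
  apply: le_integral_fun => z _; rewrite -EFinM -EFinD lee_fin /=.
  by have := lf z.1 z.2; have := ler_norm (f z.1 - f z.2); lra.
rewrite integralD//; last exact: integrableZl.
by rewrite leeD2l// integralZl// EFinM lee_wpmul2l.
Qed.

Lemma mean_of_moment p rho : (0 < p)%N ->
  (\int[rho]_x (`|x| ^+ p)%:E < +oo)%E -> has_mean rho.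
Proof.
move=> p0 mom; have mX : measurable_fun [set: measurableTypeR R]
    (fun x : measurableTypeR R => (`|x : R| ^+ p)%:E).
  by apply/measurable_EFinP; apply: measurable_funX; exact: normr_measurable.
have iX : rho.-integrable setT (fun x : measurableTypeR R => (`|x : R| ^+ p)%:E).
  apply/integrableP; split => //; under eq_integral do rewrite /= ger0_norm ?exprn_ge0//.
  exact: mom.
apply: (@le_integrable _ _ _ _ _ _ _
    (fun x : measurableTypeR R => (1 + `|x : R| ^+ p)%:E)) => //.
- by apply/measurable_EFinP.
- move=> x _; rewrite lee_fin /= [leRHS]ger0_norm ?addr_ge0 ?exprn_ge0//.
  have [x1|x1] := leP `|x : R| 1; first by rewrite (le_trans x1)// lerDl exprn_ge0.
  rewrite (@le_trans _ _ (`|x : R| ^+ p))// ?lerDr// -[leLHS]expr1.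
  by apply: ler_weXn2l => //; exact: ltW.
- under eq_fun do rewrite EFinD.
  by apply: integrableD => //; exact: integrable_cst_prob.
Qed.

Lemma wasserstein_lt_coupling p mu nu e : (0 < p)%N -> 0 < e ->
  (wasserstein p mu nu < e%:E)%E ->
  exists2 pi, coupling mu nu pi &
    (\int[pi]_z (`|z.1 - z.2| ^+ p)%:E < (e ^+ p)%:E)%E.
Proof.
move=> p0 e0 We.
set S := [set \int[pi]_z (`|z.1 - z.2| ^+ p)%:E | pi in [set pi | coupling mu nu pi]]%E
  in We.
have S0 : (0 <= ereal_inf S)%E.
  apply: le_ereal_inf_tmp => _ [pi _ <-]; apply: integral_ge0 => z _.
  by rewrite lee_fin exprn_ge0.
have : (ereal_inf S < (e ^+ p)%:E)%E.
  rewrite ltNge; apply/negP => H.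
  move: We; rewrite ltNge => /negP; apply.
  have -> : e%:E = ((e ^+ p)%:E `^ (p%:R^-1))%E.
    rewrite poweR_EFin -powR_mulrn ?ltW// -powRrM divff ?powRr1 ?ltW//.
    by rewrite pnatr_eq0 -lt0n.
  apply: gt0_ler_poweR => //; rewrite ?invr_ge0// in_itv/= ?leey ?andbT//.
  by rewrite lee_fin exprn_ge0// ltW.
by move=> /ereal_inf_lt[_ [pi ? <-] ?]; exists pi.
Qed.

Lemma wasserstein_lip p mu nu k f e : (0 < p)%N -> 0 < e -> 0 <= k ->
  has_mean mu -> has_mean nu -> lip k f ->
  (wasserstein p mu nu < e%:E)%E ->
  `|\int[mu]_x f x - \int[nu]_x f x| <= k * (2 * e).
Proof.
move=> p0 e0 k0 hmu hnu lf /(wasserstein_lt_coupling p0 e0)[pi cpi pie].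
have {}pie : (\int[pi]_z (`|z.1 - z.2|)%:E <= (2 * e)%:E)%E.
  (* The inequality [t <= e + t ^+ p / e ^+ p.-1] stands in for Hölder's inequality and is the
     origin of the factor 2. *)
  apply: (@le_trans _ _ (\int[pi]_z (e%:E + (e ^- p.-1)%:E * (`|z.1 - z.2| ^+ p)%:E))%E).
    apply: le_integral_fun => z _; rewrite -EFinM -EFinD lee_fin.
    set t := `|_|; have t0 : 0 <= t := normr_ge0 _.
    have [te|te] := leP t e.
      rewrite (le_trans te)// lerDl mulr_ge0 ?exprn_ge0// invr_ge0 exprn_ge0//.
      exact: ltW.
    apply: (@le_trans _ _ (e ^- p.-1 * t ^+ p)); last by rewrite lerDr ltW.
    rewrite mulrC ler_pdivlMr ?exprn_gt0//.
    have -> : t ^+ p = t * t ^+ p.-1 by rewrite -exprS prednK.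
    by apply: ler_wpM2l => //; apply: lerXn2r; rewrite ?nnegrE// ltW.
  have mp : measurable_fun [set: measurableTypeR R * measurableTypeR R]
      (fun z => (`|z.1 - z.2| ^+ p)%:E).
    apply/measurable_EFinP; apply: measurable_funX.
    by apply: measurableT_comp => //; exact: measurable_funB.
  rewrite ge0_integralD//; first last.
  - by apply: measurable_funeM.
  - by move=> z _; rewrite -EFinM lee_fin mulr_ge0 ?exprn_ge0// invr_ge0 exprn_ge0// ltW.
  - by move=> z _; rewrite lee_fin ltW.
  rewrite integral_cst_prob ge0_integralZl//; last first.
    by rewrite lee_fin invr_ge0 exprn_ge0// ltW.
  rewrite mulr2n mulrDl mul1r EFinD leeD2l//.
  have e' : (0 <= (e ^- p.-1)%:E)%E by rewrite lee_fin invr_ge0 exprn_ge0// ltW.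
  apply: (le_trans (lee_wpmul2l e' (ltW pie))).
  rewrite -EFinM lee_fin -{2}(prednK p0) exprSr mulrA mulVf ?mul1r//.
  by rewrite expf_neq0// gt_eqF.
have cpi' : coupling nu mu (law pi (measurable_fun_pair (@measurable_snd _ _
    (measurableTypeR R) (measurableTypeR R)) measurable_fst)).
  case: cpi => c1 c2; split => A mA; rewrite lawE.
    by rewrite -c2//; congr (pi _); apply/seteqP; split => -[x y] /= [].
  by rewrite -c1//; congr (pi _); apply/seteqP; split => -[x y] /= [].
rewrite ler_distl; apply/andP; split.
  rewrite lerBlDr; apply: (coupling_lip hnu hmu lf k0 cpi').
  rewrite ge0_integral_law//; last first.
    apply/measurable_EFinP; apply: measurableT_comp => //.
    by apply: measurable_funB; [exact: measurable_fst|exact: measurable_snd].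
  apply: le_trans pie; apply: le_integral_fun => z _ /=.
  by rewrite distrC.
exact: (coupling_lip hmu hnu lf k0 cpi).
Qed.

Definition lell d (a : R) : R := ln (Num.max `|a| d).

Lemma lell_lip d : 0 < d -> lip d^-1 (lell d).
Proof.
move=> d0; suff H a b : lell d a - lell d b <= d^-1 * `|a - b|.
  by move=> a b; rewrite ler_norml; have := H b a; have := H a b;
    rewrite (distrC b a); set u := _ * _ => ? ?; apply/andP; split; lra.
rewrite /lell; set u := Num.max `|a| d; set v := Num.max `|b| d.
have du : d <= u by rewrite le_max lexx orbT.
have dv : d <= v by rewrite le_max lexx orbT.
have u0 : 0 < u by lra.
have v0 : 0 < v by lra.
have uv : u - v <= `|a - b|.
  rewrite lerBlDr /u ge_max; apply/andP; split.
    have := ler_normD (a - b) b; rewrite subrK => /le_trans; apply.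
    by rewrite lerD2l le_max lexx.
  by rewrite (le_trans dv)// lerDr.
have [uv0|uv0] := leP u v.
  apply: (@le_trans _ _ 0); last by rewrite mulr_ge0// invr_ge0 ltW.
  by rewrite subr_le0 ler_ln_pos.
rewrite -ln_div ?posrE//; apply: le_trans (ln_bound _) _; first exact: divr_gt0.
have -> : u / v - 1 = v^-1 * (u - v) by field; rewrite gt_eqF.
by apply: ler_pM => //; rewrite ?invr_ge0 ?subr_ge0 ?ler_pV2 ?inE ?unitfE ?gt_eqF//;
  exact: ltW.
Qed.

Lemma lip_reflect k f c : lip k f -> lip k (fun x => f (c - x)).
Proof.
move=> lf x y; apply: (le_trans (lf _ _)).
have -> : c - x - (c - y) = - (x - y) by ring.
by rewrite normrN.
Qed.

Lemma lipB k f c : lip k f -> lip k (fun x => f (x - c)).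
Proof.
by move=> lf x y; apply: (le_trans (lf _ _)); rewrite opprB addrA subrK.
Qed.

Lemma lip_expectation k (h : R -> R -> R) rho : has_mean rho -> 0 <= k ->
  (forall y, lip k (h^~ y)) -> (forall x, exists k', lip k' (h x)) ->
  lip k (fun x => \int[rho]_y h x y).
Proof.
move=> hm k0 lh1 lh2; suff H x x' :
    \int[rho]_y h x y <= \int[rho]_y h x' y + k * `|x - x'|.
  move=> x x'; rewrite ler_norml; have := H x x'; have := H x' x.
  by rewrite (distrC x'); set u := k * _ => ? ?; apply/andP; split; lra.
have [k1 l1] := lh2 x; have [k2 l2] := lh2 x'.
rewrite -(mean_cst rho (k * `|x - x'|)) -RintegralD//.
- apply: (@le_expectation k1 k2) => //.
    by move=> y y'; rewrite opprD addrACA subrr addr0.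
  by move=> y; have := lh1 y x x'; have := ler_norm (h x y - h x' y); lra.
- exact: lip_integrable l2.
- exact: integrable_cst_prob.
Qed.

(** The truncated counterpart of [Sigma], not of [- Sigma]: it is an upper bound for [Sigma] that
    decreases with [d]. *)
Definition log_energy d rho : R := \int[rho]_x \int[rho]_y lell d (x - y).

Lemma lip_lell1 d y : 0 < d -> lip d^-1 (fun x => lell d (x - y)).
Proof. by move=> d0; apply: lipB; exact: lell_lip. Qed.

Lemma lip_lell2 d x : 0 < d -> lip d^-1 (fun y => lell d (x - y)).
Proof. by move=> d0; apply: lip_reflect; exact: lell_lip. Qed.

Lemma lip_lell_mean d rho : 0 < d -> has_mean rho ->
  lip d^-1 (fun x => \int[rho]_y lell d (x - y)).
Proof.
move=> d0 hm; apply: lip_expectation => // [|y|x]; first by rewrite invr_ge0 ltW.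
- exact: lip_lell1.
- by exists d^-1; exact: lip_lell2.
Qed.

(** The measure is exchanged in one variable at a time; each exchange integrates a function with
    Lipschitz constant [d^-1]. *)
Lemma log_energy_wasserstein p mu nu d e : (0 < p)%N -> 0 < e -> 0 < d ->
  has_mean mu -> has_mean nu -> (wasserstein p mu nu < e%:E)%E ->
  `|log_energy d mu - log_energy d nu| <= d^-1 * (4 * e).
Proof.
move=> p0 e0 d0 hmu hnu We; have d0' : 0 <= d^-1 by rewrite invr_ge0 ltW.
have H1 : `|log_energy d mu - \int[nu]_x \int[mu]_y lell d (x - y)|
    <= d^-1 * (2 * e).
  exact: (wasserstein_lip p0 e0 d0' hmu hnu (lip_lell_mean d0 hmu) We).
have H2 : `|\int[nu]_x \int[mu]_y lell d (x - y) - log_energy d nu|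
    <= d^-1 * (2 * e).
  rewrite /log_energy -RintegralB//; first last.
  - exact: lip_integrable (lip_lell_mean d0 hnu).
  - exact: lip_integrable (lip_lell_mean d0 hmu).
  apply: (le_trans (le_normr_Rintegral _ _)) => //.
    exact: integrableB (lip_integrable hnu (lip_lell_mean d0 hmu))
      (lip_integrable hnu (lip_lell_mean d0 hnu)).
  rewrite -[leRHS](mean_cst nu); apply: le_Rintegral => //.
  - apply: integrable_norm.
    exact: integrableB (lip_integrable hnu (lip_lell_mean d0 hmu))
      (lip_integrable hnu (lip_lell_mean d0 hnu)).
  - exact: integrable_cst_prob.
  - by move=> x _; apply: (wasserstein_lip p0 e0 d0' hmu hnu (lip_lell2 x d0) We).
rewrite -[_ - _](subrKA (\int[nu]_x \int[mu]_y lell d (x - y))).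
by apply: (le_trans (ler_normD _ _)); lra.
Qed.

End lipschitz.

(** * Growth of convex polynomials *)

Section growth.
Context {R : realType}.
Implicit Types (x s a C : R).

(** The three inequalities give coercivity, integrability against measures with a [p]-th moment, and
    the cost of smoothing by a law carried by [[0, 1]]. *)
Definition growth (V : R -> R) (p : nat) a C : Prop :=
  [/\ 0 < a, 0 < C, forall x, a * `|x| ^+ p - C <= V x,
      forall x, `|V x| <= C * (1 + `|x| ^+ p) &
      forall x s, `|s| <= 1 -> `|V (x - s) - V x| <= `|s| * (C * (1 + `|x| ^+ p))].

Lemma exprn_le_1D x i p : (i <= p)%N -> 0 <= x -> x ^+ i <= 1 + x ^+ p.
Proof.
move=> ip x0; have [x1|x1] := leP x 1.
  by rewrite (@le_trans _ _ 1)// ?exprn_ile1// lerDl exprn_ge0.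
by rewrite (@le_trans _ _ (x ^+ p))// ?lerDr// ler_weXn2l// ltW.
Qed.

Lemma expr1D_le x p : 0 <= x -> (1 + x) ^+ p <= 2 ^+ p * (1 + x ^+ p).
Proof.
move=> x0; have [x1|x1] := leP x 1.
  apply: (@le_trans _ _ (2 ^+ p)).
    by apply: lerXn2r; rewrite ?nnegrE ?addr_ge0//; lra.
  by rewrite ler_peMr ?exprn_ge0// lerDl exprn_ge0.
apply: (@le_trans _ _ ((2 * x) ^+ p)).
  by apply: lerXn2r; rewrite ?nnegrE ?addr_ge0 ?mulr_ge0//; lra.
by rewrite exprMn ler_wpM2l ?exprn_ge0// lerDr.
Qed.

Lemma expr_increment_le x s i p : (i <= p)%N -> `|s| <= 1 ->
  `|(x - s) ^+ i - x ^+ i| <= `|s| * (p%:R * 2 ^+ p * (1 + `|x| ^+ p)).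
Proof.
move=> ip s1; rewrite subrXX.
have -> : x - s - x = - s by ring.
rewrite normrM normrN ler_wpM2l//; apply: (le_trans (ler_norm_sum _ _ _)).
apply: (@le_trans _ _ (\sum_(j < i) (2 ^+ p * (1 + `|x| ^+ p)))).
  apply: ler_sum => j _; rewrite normrM !normrX.
  apply: (le_trans _ (expr1D_le _ _)) => //.
  have le1 : 1 <= 1 + `|x| by rewrite lerDl.
  apply: (@le_trans _ _ ((1 + `|x|) ^+ (i.-1 - j) * (1 + `|x|) ^+ j)).
    apply: ler_pM; rewrite ?exprn_ge0//; apply: lerXn2r; rewrite ?nnegrE ?addr_ge0//.
      by apply: (le_trans (ler_normB _ _)); rewrite addrC lerD2r.
    by rewrite lerDr.
  rewrite -exprD; apply: ler_weXn2l => //; have := ltn_ord j; lia.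
rewrite sumr_const card_ord -[leLHS]mulr_natl -mulrA ler_wpM2r ?ler_nat//.
Qed.

Variables (V : {poly R}) (p : nat).
Hypotheses (p2 : (2 <= p)%N) (pe : ~~ odd p) (dV : size V = p.+1).

Let S : R := \sum_(i < p.+1) `|V`_i|.

Let S0 : 0 <= S.
Proof. by apply: sumr_ge0. Qed.

Lemma poly_upper x : `|V.[x]| <= S * (1 + `|x| ^+ p).
Proof.
rewrite horner_coef dV; apply: (le_trans (ler_norm_sum _ _ _)).
rewrite mulr_suml; apply: ler_sum => i _; rewrite normrM normrX ler_wpM2l//.
by apply: exprn_le_1D => //; have := ltn_ord i; lia.
Qed.

Lemma poly_increment x s : `|s| <= 1 ->
  `|V.[x - s] - V.[x]| <= `|s| * (S * (p%:R * 2 ^+ p) * (1 + `|x| ^+ p)).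
Proof.
move=> s1; rewrite !horner_coef dV -sumrB.
apply: (le_trans (ler_norm_sum _ _ _)).
rewrite -mulrA mulrCA mulr_suml; apply: ler_sum => i _.
rewrite -mulrBr normrM; apply: ler_wpM2l => //.
by apply: expr_increment_le => //; have := ltn_ord i; lia.
Qed.

Lemma poly_lead_close x : 1 <= `|x| ->
  `|V.[x] - lead_coef V * `|x| ^+ p| <= S * `|x| ^+ p.-1.
Proof.
move=> x1; rewrite horner_coef dV big_ord_recr/= lead_coefE dV/=.
have -> : x ^+ p = `|x| ^+ p by
  rewrite -[p]odd_double_half (negbTE pe) add0n -mul2n !exprM real_normK ?num_real.
rewrite addrK; apply: (le_trans (ler_norm_sum _ _ _)).
rewrite /S big_ord_recr/= mulrDl mulr_suml ler_wpDr ?mulr_ge0 ?exprn_ge0//.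
apply: ler_sum => i _; rewrite normrM normrX ler_wpM2l//.
by apply: ler_weXn2l => //; have := ltn_ord i; lia.
Qed.

Lemma convex_midpoint x (V_convex : convex_function (setT : set R^o) (fun x => V.[x])) :
  2 * V.[0] <= V.[x] + V.[- x].
Proof.
have h0 : (0 : R) <= 2^-1 by rewrite invr_ge0.
have h1 : (2^-1 : R) <= 1 by rewrite invf_le1// ler1n.
have := V_convex (Itv01 h0 h1) x (- x); rewrite !inE => /(_ Logic.I Logic.I).
rewrite !convRE/= /unstable.onem.
have -> : conv (Itv01 h0 h1) (x : convex_lmodType R^o) (- x) = 0 :> R.
  by transitivity (2^-1 * x + (1 - 2^-1) * - x : R); [|field].
lra.
Qed.

(** As [p] is even, a negative leading coefficient would send [V.[x]] and [V.[- x]] both to -oo,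
    against the midpoint inequality at 0. *)
Lemma poly_lead_gt0 (V_convex : convex_function (setT : set R^o) (fun x => V.[x])) :
  0 < lead_coef V.
Proof.
rewrite lt_neqAle eq_sym lead_coef_eq0 -size_poly_eq0 dV/= leNgt; apply/negP => l0.
pose l : R := - lead_coef V; have {}l0 : 0 < l by rewrite oppr_gt0.
(* Chosen so that [S - l * x] is below [- |V.[0]| - 1]; then [V.[x] + V.[- x]] falls below [2 *
   V.[0]]. *)
pose x : R := (S + `|V.[0]| + 1) / l + 1.
have x1 : 1 <= x.
  by rewrite lerDr divr_ge0 ?addr_ge0// ltW.
have nx : `|x| = x by rewrite ger0_norm//; lra.
have h1 := @poly_lead_close x; have h2 := @poly_lead_close (- x).
rewrite normrN nx in h1 h2.
have := h1 x1; have := h2 x1; rewrite !ler_norml => /andP[_ a1] /andP[_ a2].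
have m := convex_midpoint x V_convex.
have xp : x ^+ p = x ^+ p.-1 * x by rewrite -exprSr prednK//; lia.
have X1 : 1 <= x ^+ p.-1 by exact: exprn_ege1.
have lx : l * x = S + `|V.[0]| + 1 + l.
  by rewrite /x; field; rewrite gt_eqF.
have : V.[x] + V.[- x] <= 2 * (x ^+ p.-1 * (S - l * x)).
  by rewrite xp in a1 a2; rewrite /l; lra.
rewrite lx => u.
have : x ^+ p.-1 * (S - (S + `|V.[0]| + 1 + l)) <= 1 * (S - (S + `|V.[0]| + 1 + l)).
  by rewrite ler_wnM2r// ; have := normr_ge0 V.[0]; lra.
have := ler_norm (- V.[0]); rewrite normrN; lra.
Qed.

Lemma poly_growth (V_convex : convex_function (setT : set R^o) (fun x => V.[x])) :
  exists a C, growth (horner V) p a C.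
Proof.
have l0 := poly_lead_gt0 V_convex; set l : R := lead_coef V in l0.
have S0' : 0 <= S by exact: S0.
(* Beyond [T] half of the leading term dominates the lower ones; up to [T] they are bounded by
   [S * T ^+ p], which goes into the constant [C]. *)
pose T : R := 1 + 2 * S / l.
have T1 : 1 <= T by rewrite lerDl divr_ge0 ?mulr_ge0// ltW.
have [u uE] : exists u, u = S * T ^+ p by eexists.
have [v vE] : exists v, v = S * (p%:R * 2 ^+ p) by eexists.
have u0 : 0 <= u by rewrite uE mulr_ge0// exprn_ge0//; lra.
have v0 : 0 <= v by rewrite vE !mulr_ge0// exprn_ge0.
pose C : R := 1 + l + 2 * S + u + v.
exists (l / 2), C; split => [|||x|x s s1].
- by rewrite divr_gt0.
- rewrite /C; lra.
- move=> x; have [x1|x1] := leP 1 `|x|; last first.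
    have : `|x| ^+ p <= 1 by apply: exprn_ile1 => //; exact: ltW.
    have xp : 0 <= `|x| ^+ p by exact: exprn_ge0.
    have := poly_upper x; rewrite ler_norml => /andP[+ _]; rewrite /C; nra.
  have := poly_lead_close x1; rewrite ler_norml => /andP[+ _]; rewrite -/l.
  have xp : `|x| ^+ p = `|x| ^+ p.-1 * `|x| by rewrite -exprSr prednK//; lia.
  have X0 : 0 <= `|x| ^+ p.-1 by exact: exprn_ge0.
  have [xT|xT] := leP `|x| T.
    have : S * `|x| ^+ p.-1 <= u.
      rewrite uE ler_wpM2l// (@le_trans _ _ (T ^+ p.-1))//.
        by apply: lerXn2r; rewrite ?nnegrE//; lra.
      by apply: ler_weXn2l => //; lia.
    have : 0 <= `|x| ^+ p by exact: exprn_ge0.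
    rewrite /C; nra.
  have : S <= l / 2 * `|x|.
    rewrite -ler_pdivrMl ?divr_gt0// invf_div; rewrite /T in xT.
    have -> : 2 / l * S = 2 * S / l by ring.
    lra.
  move=> /(ler_wpM2l X0); rewrite xp /C; lra.
- apply: (le_trans (poly_upper x)); rewrite ler_wpM2r ?addr_ge0 ?exprn_ge0//.
  by rewrite /C; lra.
- apply: (le_trans (poly_increment x s1)); rewrite -vE ler_wpM2l// ler_wpM2r//.
  by rewrite /C; lra.
Qed.

End growth.

Section growth_theory.
Context {R : realType}.
Variables (V : R -> R) (p : nat) (a C : R).
Hypothesis (gV : growth V p a C).

Let a0 : 0 < a. Proof. by case: gV. Qed.
Let C0 : 0 < C. Proof. by case: gV. Qed.

Lemma growth_ge x : - C <= V x.
Proof.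
case: gV => _ _ /(_ x) + _ _; apply: le_trans.
by rewrite lerDr mulr_ge0 ?exprn_ge0// ltW.
Qed.

Lemma growth_continuous : continuous V.
Proof.
move=> x; apply/cvgrPdist_le => e e0.
case: gV => _ _ _ _ /(_ x) Vi.
have K0 : 0 < C * (1 + `|x| ^+ p) by rewrite mulr_gt0// ltr_wpDr ?exprn_ge0.
near=> y.
have xy1 : `|x - y| <= 1.
  by near: y; apply: (@cvgr_dist_le _ _ _ _ _ id x).
have := Vi (x - y) xy1; rewrite subKr distrC => /le_trans; apply.
rewrite -ler_pdivlMr//; near: y.
by apply: (@cvgr_dist_le _ _ _ _ _ id x) => //; rewrite divr_gt0.
Unshelve. all: by end_near. Qed.

Lemma growth_measurable :
  measurable_fun [set: measurableTypeR R] (V : measurableTypeR R -> R).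
Proof. exact: continuous_measurable_fun growth_continuous. Qed.

(** Where [V x < M], coercivity bounds [|x| ^+ p] by [(|M| + C) / a], so the increment clause of
    [growth] has a uniform constant for steps of length at most 1. For longer steps the oscillation,
    at most [M + C], is enough. *)
Lemma truncated_lip M : exists2 K, 0 <= K & lip K (fun x => Num.min (V x) M).
Proof.
have [a1 C1 _ _ _] := gV.
pose K : R := C * (1 + (`|M| + C) / a) + `|M| + C.
have KC : 0 <= C * (1 + (`|M| + C) / a).
  by rewrite mulr_ge0 ?addr_ge0 ?divr_ge0 ?addr_ge0// ltW.
have M0 := normr_ge0 M; have Mn := ler_norm M.
have K0 : 0 <= K by rewrite /K; lra.
exists K => //.
suff H x y : Num.min (V y) M - Num.min (V x) M <= K * `|x - y|.
  by move=> x y; rewrite ler_norml; have := H x y; have := H y x;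
    rewrite (distrC y); set u := _ * _ => ? ?; apply/andP; split; lra.
have xy0 := normr_ge0 (x - y).
have yM : Num.min (V y) M <= M by rewrite ge_min lexx orbT.
have yV : Num.min (V y) M <= V y by rewrite ge_min lexx.
have [Mx|xM] := leP M (V x); first by have := mulr_ge0 K0 xy0; lra.
have [xy1|xy1] := leP `|x - y| 1; last first.
  have : K * 1 <= K * `|x - y| by rewrite ler_wpM2l// ltW.
  have := growth_ge x; rewrite /K in K0 *; lra.
case: gV => _ _ /(_ x) Vlo _ /(_ x _ xy1).
rewrite subKr ler_norml => /andP[_].
have xp : `|x| ^+ p <= (`|M| + C) / a by rewrite ler_pdivlMr// mulrC; lra.
have : `|x - y| * (C * (1 + `|x| ^+ p)) <= `|x - y| * K.
  rewrite ler_wpM2l// /K.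
  have : C * (1 + `|x| ^+ p) <= C * (1 + (`|M| + C) / a).
    by rewrite ler_wpM2l ?lerD2l// ltW.
  lra.
rewrite (mulrC _ K); lra.
Qed.

End growth_theory.

(** * Logarithmic energy and its truncations *)

Section log_energy_theory.
Context {R : realType}.
Implicit Types (rho nu : probR R) (c d a : R).
Local Open Scope ereal_scope.

Lemma integral_prod_tau c nu (g : measurableTypeR R * measurableTypeR R -> \bar R) :
  measurable_fun setT g -> (forall z, 0 <= g z) ->
  \int[tau c nu \x tau c nu]_z g z =
  \int[nu \x nu]_z g ((c - z.1)%R, (c - z.2)%R).
Proof.
move=> mg g0; rewrite fubini_tonelli1// tauE; first last.
- by move=> x; apply: integral_ge0.
- exact: measurable_fun_fubini_tonelli_F.
rewrite fubini_tonelli1//; last first.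
  apply: measurableT_comp => //; apply: measurable_fun_pair.
    by apply: measurable_funB => //; exact: measurable_fst.
  by apply: measurable_funB => //; exact: measurable_snd.
apply: eq_integral => x _; rewrite /fubini_F tauE//=.
by apply: measurableT_comp => //; exact: measurable_pair1.
Qed.

Lemma measurable_log_dist :
  measurable_fun [set: measurableTypeR R * measurableTypeR R]
    (fun z => lne (`|z.1 - z.2|)%:E).
Proof.
apply: measurableT_comp; first exact: measurable_lne.
by apply/measurable_EFinP; apply: measurableT_comp => //; exact: measurable_funB.
Qed.

Lemma Sigma_tau c nu : Sigma (tau c nu) = Sigma nu.
Proof.
rewrite /Sigma integralE [RHS]integralE.
have E (z : measurableTypeR R * measurableTypeR R) :
  (c - z.1 - (c - z.2) = - (z.1 - z.2) :> R)%R by ring.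
by congr (_ - _); rewrite integral_prod_tau//;
  [apply: eq_integral => z _; rewrite !funeposE/= E normrN
  |apply: measurable_funepos; exact: measurable_log_dist
  |apply: eq_integral => z _; rewrite !funenegE/= E normrN
  |apply: measurable_funeneg; exact: measurable_log_dist].
Qed.

Lemma log_energy_prod d rho : (0 < d)%R -> has_mean rho ->
  (rho \x rho).-integrable setT (fun z => (lell d (z.1 - z.2))%:E) /\
  \int[rho \x rho]_z (lell d (z.1 - z.2))%:E = (log_energy d rho)%:E.
Proof.
move=> d0 hm.
have mh : measurable_fun [set: measurableTypeR R * measurableTypeR R]
    (fun z => (lell d (z.1 - z.2))%:E).
  apply: (@measurableT_comp _ _ _ _ _ _ (fun a : measurableTypeR R => (lell d a)%:E)).
    by apply/measurable_EFinP; exact: lip_measurable (lell_lip d0).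
  by apply: measurable_funB; [exact: measurable_fst|exact: measurable_snd].
have int : (rho \x rho).-integrable setT (fun z => (lell d (z.1 - z.2))%:E).
  apply/integrable12ltyP => //.
  have lh : lip d^-1 (fun a : R => `|lell d a|)%R.
    by move=> x y; apply: (le_trans (ler_dist_dist _ _)); exact: lell_lip.
  rewrite (eq_integral (fun x : measurableTypeR R =>
      (\int[rho]_y `|lell d ((x : R) - y)|)%R%:E)) => [|x _].
    rewrite (@expectation_fin _ d^-1) ?ltry//.
    apply: lip_expectation => //; first by rewrite invr_ge0 ltW.
      by move=> y; exact: (lipB _ lh).
    by move=> x; exists (d^-1)%R; exact: (lip_reflect _ lh).
  by rewrite -(@expectation_fin _ d^-1)//; exact: (lip_reflect _ lh).
split => //; rewrite -integral12_prod_meas1// /fubini_F.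
rewrite (eq_integral (fun x : measurableTypeR R =>
    (\int[rho]_y lell d ((x : R) - y))%R%:E)) => [|x _].
  by rewrite (@expectation_fin _ d^-1)//; exact: lip_lell_mean.
by rewrite (@expectation_fin _ d^-1)//; exact: lip_lell2.
Qed.

Lemma log_energy_le d d' rho : (0 < d)%R -> (d <= d')%R -> has_mean rho ->
  (log_energy d rho <= log_energy d' rho)%R.
Proof.
move=> d0 dd' hm; have d0' : (0 < d')%R by exact: lt_le_trans dd'.
apply: (le_expectation hm (lip_lell_mean d0 hm) (lip_lell_mean d0' hm)) => x.
apply: (le_expectation hm (lip_lell2 x d0) (lip_lell2 x d0')) => y.
apply: ler_ln_pos; first by rewrite lt_max d0 orbT.
by rewrite ge_max !le_max lexx dd' orbT.
Qed.

Lemma lne_le_lell d a : (0 < d)%R -> lne (`|a|%:E) <= (lell d a)%:E.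
Proof.
move=> d0; have [->|a0] := eqVneq a 0%R.
  by rewrite normr0 /lne/= lexx leNye.
rewrite lne_EFin ?normr_gt0// lee_fin ler_ln_pos ?normr_gt0//.
by rewrite le_max lexx.
Qed.

Lemma Sigma_le_log_energy d rho : (0 < d)%R -> has_mean rho ->
  Sigma rho <= (log_energy d rho)%:E.
Proof.
move=> d0 hm; rewrite -(log_energy_prod d0 hm).2.
by apply: le_integral_fun => z _; exact: lne_le_lell.
Qed.

Lemma lell_kapd d a : (0 < d <= 1)%R -> lell d a = (lell 1 a - kapd 1 d a)%R.
Proof.
move=> /andP[d0 d1]; rewrite /lell /kapd ln1 sub0r.
have [a1|a1] := leP `|a|%R 1%R.
  rewrite ln1 sub0r; set m := Num.max _ _.
  have m1 : (m <= 1)%R by rewrite ge_max a1.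
  by rewrite (max_idPr _) ?opprK// oppr_ge0 ln_le0.
rewrite (max_idPl (_ : d <= `|a|)%R); last by rewrite (le_trans d1)// ltW.
by rewrite (max_idPl _) ?subr0// oppr_le0 ln_ge0// ltW.
Qed.

Lemma integral_kapd d rho : (0 < d <= 1)%R -> has_mean rho ->
  \int[rho \x rho]_z (kapd 1 d (z.1 - z.2))%:E =
  (log_energy 1 rho - log_energy d rho)%:E.
Proof.
move=> d01 hm; have /andP[d0 _] := d01.
have [i1 e1] := log_energy_prod ltr01 hm.
have [i2 e2] := log_energy_prod d0 hm.
transitivity (\int[rho \x rho]_z
    ((lell 1 (z.1 - z.2))%:E - (lell d (z.1 - z.2))%:E)).
  apply: eq_integral => z _; rewrite -EFinB (lell_kapd _ d01); congr EFin.
  by rewrite subKr.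
by rewrite (integralB measurableT i1 i2) e1 e2.
Qed.

(** The positive part of the logarithm is [lell 1] and the negative part [kap 1]. A mean makes the
    first one integrable, so the identity also holds when [Sigma rho] is -oo. *)
Lemma Sigma_kap rho : has_mean rho ->
  Sigma rho = (log_energy 1 rho)%:E - \int[rho \x rho]_z kap 1 (z.1 - z.2)%R.
Proof.
move=> hm; rewrite -(log_energy_prod ltr01 hm).2 /Sigma integralE; congr (_ - _).
  apply: eq_integral => z _; rewrite funeposE.
  have [->|z0] := eqVneq (z.1 - z.2)%R 0%R.
    by rewrite /lell normr0 /lne/= lexx maxNye (max_idPr _)// ln1.
  rewrite lne_EFin ?normr_gt0// -EFin_max /lell; congr EFin.
  have [a1|a1] := leP `|z.1 - z.2|%R 1%R.
    by rewrite ln1 (max_idPr _)// ln_le0.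
  by rewrite (max_idPl _)// ln_ge0// ltW.
apply: eq_integral => z _; rewrite funenegE /kap ln1 sub0e maxC.
by [].
Qed.

Lemma nondecreasing_kapd n m a : (n <= m)%N ->
  (kapd 1 n.+1%:R^-1 a <= kapd 1 m.+1%:R^-1 a)%R.
Proof.
move=> nm; rewrite /kapd ge_max le_max lexx/= le_max; apply/orP; right.
rewrite lerD2l lerN2 ler_ln_pos//.
rewrite ge_max le_max lexx/= le_max; apply/orP; right.
by rewrite lef_pV2 ?posrE ?ltr0n// ler_nat.
Qed.

Lemma kapd_lim a : (kapd 1 n.+1%:R^-1 a)%:E @[n --> \oo] --> kap 1 a.
Proof.
have [->|a0] := eqVneq a 0%R.
  rewrite kap0; apply/cvgeyPge => A; exists (Num.truncn (expR A)) => // n /= An.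
  rewrite lee_fin /kapd le_max; apply/orP; right; rewrite ln1 sub0r normr0.
  rewrite (max_idPr _) ?invr_ge0// lnV ?posrE ?ltr0n// opprK -ler_expR.
  rewrite lnK ?posrE ?ltr0n//; apply: ltW.
  by apply: (lt_le_trans (truncnS_gt _)); rewrite ler_nat.
apply: cvg_near_cst.
exists (Num.truncn (`|a|^-1)) => // n /= an; rewrite kapE// /kapd.
have a0' : (0 < `|a|)%R by rewrite normr_gt0.
have na : (n.+1%:R^-1 <= `|a|)%R.
  rewrite -[leRHS]invrK lef_pV2 ?posrE ?invr_gt0 ?ltr0n//; apply: ltW.
  by apply: (lt_le_trans (truncnS_gt _)); rewrite ler_nat.
by rewrite (max_idPl na).
Qed.

(** Monotone convergence of [kapd 1 n.+1%:R^-1] to [kap 1]. When [Sigma rho] is -oo, [r] is an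
    arbitrary real. *)
Lemma log_energy_approx rho (r : R) : has_mean rho -> r%:E < - Sigma rho ->
  exists N, forall n, (N <= n)%N -> (r < - log_energy n.+1%:R^-1 rho)%R.
Proof.
move=> hm; rewrite Sigma_kap//; set I := \int[_]_z _ => rS.
have I0 : 0 <= I by apply: integral_ge0 => z _; exact: kap_ge0.
have {}rS : (r + log_energy 1 rho)%:E < I.
  move: rS I0; generalize I => -[s| |] //; rewrite ?ltry// -EFinB -EFinN.
  by rewrite !lte_fin; lra.
have dn n : (0 < (n.+1%:R^-1 : R) <= 1)%R.
  by rewrite invr_gt0 ltr0n/= invf_le1 ?ltr0n// ler1n.
have mk n : measurable_fun [set: measurableTypeR R * measurableTypeR R]
    (fun z => (kapd 1 n.+1%:R^-1 (z.1 - z.2))%:E).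
  apply/measurable_EFinP.
  apply: (@measurableT_comp _ _ _ _ _ _ (kapd 1 n.+1%:R^-1 : measurableTypeR R -> R)).
    exact: measurable_kapd.
  by apply: measurable_funB; [exact: measurable_fst|exact: measurable_snd].
have Ik n : \int[rho \x rho]_z (kapd 1 n.+1%:R^-1 (z.1 - z.2))%:E =
    (log_energy 1 rho - log_energy n.+1%:R^-1 rho)%:E.
  by exact: integral_kapd.
have Icvg : (log_energy 1 rho - log_energy n.+1%:R^-1 rho)%:E @[n --> \oo] --> I.
  have -> : I = \int[rho \x rho]_z
      limn (fun n => (kapd 1 n.+1%:R^-1 (z.1 - z.2))%:E : \bar R).
    apply: eq_integral => z _; apply/esym/cvg_lim => //; exact: kapd_lim.
  under eq_fun do rewrite -Ik.
  apply: cvg_monotone_convergence => //.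
    by move=> n z _; rewrite lee_fin kapd_ge0.
  by move=> z _ n m nm; rewrite lee_fin; exact: nondecreasing_kapd.
have [N HN] : exists N, (r < - log_energy N.+1%:R^-1 rho)%R.
  apply: contrapT => H; move: rS; rewrite ltNge => /negP; apply.
  rewrite -(cvg_lim _ Icvg)//; apply: lime_le; first by apply/cvg_ex; exists I.
  apply: nearW => n; rewrite lee_fin.
  have : (- log_energy n.+1%:R^-1 rho <= r)%R.
    by rewrite leNgt; apply/negP => rn; apply: H; exists n.
  by move: (log_energy _ _) (log_energy 1 _) => u v; lra.
exists N => n Nn; apply: (lt_le_trans HN); rewrite lerN2.
apply: log_energy_le => //.
by rewrite lef_pV2 ?posrE ?ltr0n// ler_nat.
Qed.

End log_energy_theory.

Section integral_tools.
Context d (T : measurableType d) (R : realType).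
Local Open Scope ereal_scope.

Lemma monotone_integral_gt (mu : {measure set T -> \bar R}) (g : nat -> T -> \bar R) (f : T -> \bar R)
    (x : \bar R) :
  (forall n, measurable_fun setT (g n)) -> (forall n t, 0 <= g n t) ->
  (forall t n m, (n <= m)%N -> g n t <= g m t) ->
  (forall t, g n t @[n --> \oo] --> f t) -> x < \int[mu]_t f t ->
  exists N, forall n, (N <= n)%N -> x < \int[mu]_t g n t.
Proof.
move=> mg g0 gnd gf xf.
have gcvg : \int[mu]_t g n t @[n --> \oo] --> \int[mu]_t f t.
  have -> : \int[mu]_t f t = \int[mu]_t limn (g ^~ t).
    by apply: eq_integral => t _; apply/esym/cvg_lim => //; exact: gf.
  by apply: cvg_monotone_convergence => // t _ n m nm; exact: gnd.
have [N HN] : exists N, x < \int[mu]_t g N t.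
  apply: contrapT => H; move: xf; rewrite ltNge => /negP; apply.
  rewrite -(cvg_lim _ gcvg)//; apply: lime_le; first by apply/cvg_ex; eexists; exact: gcvg.
  by apply: nearW => n; rewrite leNgt; apply/negP => rn; apply: H; exists n.
exists N => n Nn; apply: (lt_le_trans HN); apply: le_integral_fun => t _.
exact: gnd.
Qed.

Lemma ae_carrier (P : probability T R) (A : set T) : measurable A -> P A = 1 ->
  {ae P, forall x, A x}.
Proof.
move=> mA PA; exists (~` A); split => //; first exact: measurableC.
by rewrite probability_setC// PA subee.
Qed.

Lemma le_integral_carrier (P : probability T R) (A : set T) (f g : T -> \bar R) :
  measurable A -> P A = 1 -> measurable_fun setT f -> measurable_fun setT g ->
  (forall x, 0 <= f x) -> (forall x, 0 <= g x) ->
  (forall x, A x -> f x <= g x) -> \int[P]_x f x <= \int[P]_x g x.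
Proof.
move=> mA PA mf mg f0 g0 fg; apply: ae_ge0_le_integral => //.
by apply: filterS (ae_carrier mA PA) => x Ax _; exact: fg.
Qed.

End integral_tools.

(** * The potential term and finiteness of the minimal energy *)

Section potential.
Context {R : realType}.
Implicit Types (nu : probR R) (c : R).
Variables (V : R -> R) (p : nat) (a C : R).
Hypotheses (p2 : (2 <= p)%N) (gV : growth V p a C).

Definition moment nu := (\int[nu]_x (`|x| ^+ p)%:E < +oo)%E.

Lemma moment_mean nu : moment nu -> has_mean nu.
Proof. by apply: mean_of_moment; exact: ltnW. Qed.

Lemma exprD_le (x y : R) : 0 <= x -> 0 <= y ->
  (x + y) ^+ p <= 2 ^+ p * (x ^+ p + y ^+ p).
Proof.
wlog xy : x y / x <= y => [H x0 y0|x0 y0].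
  have [/H|/ltW/H] := leP x y; first exact.
  by rewrite addrC (addrC (y ^+ p)); exact.
apply: (@le_trans _ _ ((2 * y) ^+ p)).
  by apply: lerXn2r; rewrite ?nnegrE ?addr_ge0 ?mulr_ge0//; lra.
by rewrite exprMn ler_wpM2l ?exprn_ge0// lerDr exprn_ge0.
Qed.

(** An integrable bound on [V (c - x)] that is nondecreasing in [|c|], hence common to all [c] of a
    bounded interval. *)
Definition dominator (c x : R) : R := C * (1 + 2 ^+ p * (`|c| ^+ p + `|x| ^+ p)).

Lemma le_dominator c x : `|V (c - x)| <= dominator c x.
Proof.
case: gV => _ C0 _ /(_ (c - x)) Vhi _; apply: (le_trans Vhi).
apply: ler_wpM2l; first exact: ltW.
rewrite lerD2l.
apply: (le_trans _ (exprD_le (normr_ge0 _) (normr_ge0 _))).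
by apply: lerXn2r; rewrite ?nnegrE ?addr_ge0//; exact: ler_normB.
Qed.

Lemma dominator_ge0 c x : 0 <= dominator c x.
Proof. by apply: le_trans (le_dominator c x). Qed.

Lemma measurable_absX :
  measurable_fun [set: measurableTypeR R] (fun x : measurableTypeR R => `|x : R| ^+ p).
Proof. by apply: measurable_funX; exact: normr_measurable. Qed.

Lemma moment_integrable nu : moment nu ->
  nu.-integrable setT (fun x : measurableTypeR R => (`|x : R| ^+ p)%:E).
Proof.
move=> mom; apply/integrableP; split; first by apply/measurable_EFinP; exact: measurable_absX.
by under eq_integral do rewrite /= ger0_norm ?exprn_ge0//.
Qed.

Lemma integrable_dominator c nu : moment nu ->
  nu.-integrable setT (fun x : measurableTypeR R => (dominator c x)%:E).
Proof.
move=> mom.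
have -> : (fun x : measurableTypeR R => (dominator c x)%:E) =
   (fun x => ((C * (1 + 2 ^+ p * `|c| ^+ p))%:E + (C * 2 ^+ p)%:E * (`|x : R| ^+ p)%:E)%E).
  by apply/funext => x; rewrite -EFinM -EFinD /dominator; congr EFin; ring.
apply: integrableD => //; first exact: integrable_cst_prob.
by apply: integrableZl => //; exact: moment_integrable.
Qed.

Lemma measurable_V_reflect c :
  measurable_fun [set: measurableTypeR R] (fun x : measurableTypeR R => V (c - x)).
Proof.
apply: (@measurableT_comp _ _ _ _ _ _ (V : measurableTypeR R -> R)).
  exact: growth_measurable gV.
exact: measurable_funB.
Qed.

Lemma integrable_V_reflect c nu : moment nu ->
  nu.-integrable setT (fun x : measurableTypeR R => (V (c - x))%:E).
Proof.
move=> mom; apply: le_integrable (integrable_dominator c mom) => //.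
  by apply/measurable_EFinP; exact: measurable_V_reflect.
move=> x _ /=; rewrite lee_fin (ger0_norm (dominator_ge0 _ _)).
exact: le_dominator.
Qed.

Lemma integrable_V nu : moment nu ->
  nu.-integrable setT (fun x : measurableTypeR R => (V x)%:E).
Proof.
move=> mom; case: (gV) => _ C0 _ Vhi _.
apply: (le_integrable _ _ _ (integrable_dominator 0 mom)) => //.
  by apply/measurable_EFinP; exact: growth_measurable gV.
move=> x _ /=; rewrite lee_fin (ger0_norm (dominator_ge0 _ _)).
apply: (le_trans (Vhi _)); rewrite ler_wpM2l//; first exact: ltW.
rewrite lerD2l// (@le_trans _ _ (2 ^+ p * `|x : R| ^+ p))//.
  by rewrite ler_peMl ?exprn_ge0// exprn_ege1// ler1n.
by rewrite ler_wpM2l ?exprn_ge0// lerDr exprn_ge0.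
Qed.

(** By coercivity, the infimum defining [c_V] only sees measures with a [p]-th moment, to which the
    other estimates apply. *)
Lemma V_integrable_moment nu : V_integrable V nu -> moment nu.
Proof.
case: (gV) => a0 C0 Vlo _ _ iV.
have mV := growth_measurable gV.
apply: (@le_lt_trans _ _ (\int[nu]_x ((a^-1)%:E * ((`|V x|)%:E + C%:E)))%E).
  apply: le_integral_fun => x _; rewrite -EFinD -EFinM lee_fin.
  rewrite ler_pdivlMl//; have := Vlo x; have := ler_norm (V x); lra.
have mn : measurable_fun [set: measurableTypeR R]
    (fun x : measurableTypeR R => (`|V x|)%:E).
  by apply/measurable_EFinP; exact: measurableT_comp.
rewrite ge0_integralZl//; first last.
- by rewrite lee_fin invr_ge0 ltW.
- by move=> x _; rewrite adde_ge0// lee_fin ltW.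
- exact: emeasurable_funD.
rewrite ge0_integralD//; last by move=> x _; rewrite lee_fin ltW.
rewrite integral_cst_prob.
move: iV; rewrite /V_integrable; set I := (\int[nu]_x _)%E => iV.
have I0 : (0 <= I)%E by apply: integral_ge0 => x _; rewrite lee_fin.
by case: I iV I0 => // r _ _; rewrite ltry.
Qed.

Lemma moment_V_integrable nu : moment nu -> V_integrable V nu.
Proof. by move=> /integrable_V/integrableP[_]. Qed.

Lemma expectation_V_reflect c nu : moment nu ->
  (\int[nu]_x (V (c - x))%:E = (\int[nu]_x V (c - x))%R%:E)%E.
Proof.
by move=> mom; rewrite fineK//; exact/integrable_fin_num/integrable_V_reflect.
Qed.

Lemma truncated_reflect_lip c M : exists k, lip k (fun x => Num.min (V (c - x)) M).
Proof.
have [k _ lk] := truncated_lip gV M; exists k; exact: lip_reflect lk.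
Qed.

Lemma lip_norm : lip 1 (fun x : R => `|x|).
Proof. by move=> x y; rewrite mul1r; exact: ler_dist_dist. Qed.

(** From [|c - x| ^+ p >= |c| - |x| - 1]: moving [c] far away raises even the truncated potential,
    up to what the first moment of [nu] can compensate. This controls the unbounded range of [c]. *)
Lemma truncated_coercive c M nu : has_mean nu ->
  Num.min (a * `|c| - a - C) M - a * \int[nu]_x `|x| <=
  \int[nu]_x Num.min (V (c - x)) M.
Proof.
case: (gV) => a0 _ Vlo _ _ hm.
rewrite -RintegralZl//; last exact: lip_integrable lip_norm.
rewrite -(mean_cst nu (Num.min _ _)).
have la : lip a (fun x : R => a * `|x|).
  move=> x y; rewrite -mulrBr normrM (gtr0_norm a0).
  by apply: ler_wpM2l; [exact: ltW|exact: ler_dist_dist].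
rewrite -RintegralB//; first last.
- exact: lip_integrable la.
- exact: integrable_cst_prob.
have [k lk] := truncated_reflect_lip c M.
apply: (@le_expectation _ a k) => //.
  move=> x y; move: (Num.min _ _) => u.
  have -> : u - a * `|x| - (u - a * `|y|) = a * `|y| - a * `|x| by ring.
  by rewrite distrC; exact: la.
move=> x; rewrite le_min; apply/andP; split; last first.
  rewrite lerBlDr (@le_trans _ _ M)//; first by rewrite ge_min lexx orbT.
  by rewrite lerDl mulr_ge0// ltW.
have h1 : Num.min (a * `|c| - a - C) M <= a * `|c| - a - C by rewrite ge_min lexx.
have h2 := Vlo (c - x).
have h3 : `|c| - `|x| <= `|c - x| := lerB_dist c x.
have h4 : `|c - x| - 1 <= `|c - x| ^+ p.
  have := @exprn_le_1D R `|c - x| 1 p (ltnW p2) (normr_ge0 _).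
  by rewrite expr1; lra.
have : a * (`|c| - `|x| - 1) <= a * `|c - x| ^+ p by rewrite ler_pM2l//; lra.
lra.
Qed.

(** For [|c| >= c0] coercivity alone gives the bound. For the other [c], truncation lowers
    [V (c - x)] by no more than it lowers [dominator c0 x], and the latter loss tends to zero
    independently of [c]. *)
Lemma truncated_potential nu (g eta : R) : moment nu -> 0 < eta ->
  (forall c, g <= \int[nu]_x V (c - x)) ->
  exists N, forall n, (N <= n)%N -> forall c,
    g - eta <= \int[nu]_x Num.min (V (c - x)) n%:R.
Proof.
move=> mom eta0 Hg; case: (gV) => a0 C0 Vlo Vhi _.
have hm := moment_mean mom.
set m1 : R := \int[nu]_x `|x|.
pose c0 : R := `|(g + a * m1 + a + C) / a|.
have [N1 HN1] : exists N, forall n, (N <= n)%N ->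
    (((\int[nu]_x dominator c0 x)%R - eta)%:E <
     \int[nu]_x (Num.min (dominator c0 x) n%:R)%:E)%E.
  apply: (@monotone_integral_gt _ _ _ nu
    (fun n x => (Num.min (dominator c0 x) n%:R)%:E) (fun x => (dominator c0 x)%:E)).
  - move=> n; apply/measurable_EFinP; apply: measurable_minr => //.
    by have /integrableP[/measurable_EFinP] := integrable_dominator c0 mom.
  - by move=> n t; rewrite lee_fin le_min dominator_ge0/=.
  - move=> t n m nm; rewrite lee_fin le_min !ge_min lexx/=.
    by rewrite ler_nat nm orbT.
  - move=> t; apply: cvg_near_cst.
    exists (Num.truncn (dominator c0 t)).+1 => // n /= tn.
    rewrite (min_idPl _)//; apply: ltW; apply: (lt_le_trans (truncnS_gt _)).
    by rewrite ler_nat.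
  - rewrite -[ltRHS]fineK; last exact/integrable_fin_num/integrable_dominator.
    by rewrite lte_fin ltrBlDr ltrDl.
exists (maxn N1 (Num.truncn (g + a * m1)).+1) => n.
rewrite geq_max => /andP[nN1 nN2] c.
have nM : g + a * m1 <= n%:R.
  by apply: ltW; apply: (lt_le_trans (truncnS_gt _)); rewrite ler_nat.
have [cc|cc] := leP c0 `|c|.
  apply: (le_trans _ (truncated_coercive c n%:R hm)); rewrite -/m1.
  have : g + a * m1 <= Num.min (a * `|c| - a - C) n%:R.
    rewrite le_min nM andbT; have := le_trans (ler_norm _) cc.
    by rewrite ler_pdivrMr//; lra.
  by move: (Num.min _ _) => u; lra.
have iD := integrable_dominator c0 mom.
have iVc := integrable_V_reflect c mom.
have [k lk] := truncated_reflect_lip c n%:R.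
have iM : nu.-integrable setT (fun x : measurableTypeR R =>
    (Num.min (dominator c0 x) n%:R)%:E).
  apply: le_integrable iD => //.
    apply/measurable_EFinP; apply: measurable_minr => //.
    by have /integrableP[/measurable_EFinP] := integrable_dominator c0 mom.
  move=> x _ /=; rewrite lee_fin !ger0_norm ?le_min ?dominator_ge0/= ?ler0n//.
  by rewrite ge_min lexx.
have : (\int[nu]_x V (c - x) - \int[nu]_x dominator c0 x +
    \int[nu]_x Num.min (dominator c0 x) n%:R <= \int[nu]_x Num.min (V (c - x)) n%:R).
  have iB : nu.-integrable setT (fun x : measurableTypeR R =>
      (V (c - x) - dominator c0 x)%:E).
    by under eq_fun do rewrite EFinB; exact: integrableB.
  rewrite -RintegralB// -RintegralD//.
  apply: le_Rintegral => //.
  - exact: (integrableD measurableT iB iM).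
  - exact: lip_integrable lk.
  - move=> x _ /=.
    have VD : V (c - x) <= dominator c0 x.
      apply: (le_trans (ler_norm _)); apply: (le_trans (le_dominator _ _)).
      rewrite /dominator ler_pM2l// lerD2l// ler_pM2l ?exprn_gt0// lerD2r.
      by apply: lerXn2r; rewrite ?nnegrE// (ger0_norm (normr_ge0 _)) ltW.
    rewrite minEle minEle; case: ifPn => h1; case: ifPn => h2 //; lra.
have := HN1 n nN1; rewrite -[ltRHS]fineK; last exact: integrable_fin_num iM.
rewrite lte_fin -/(Rintegral _ _ _).
have := Hg c; move: (Rintegral _ _ _) (Rintegral _ _ _) (Rintegral _ _ _) (Rintegral _ _ _) => x y z t.
lra.
Qed.

Lemma Rint_le_dominator nu c : moment nu -> - C <= \int[nu]_x V (c - x).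
Proof.
move=> mom; rewrite -(mean_cst nu (- C)); apply: le_Rintegral => //.
- exact: integrable_cst_prob.
- exact: integrable_V_reflect.
- by move=> x _; exact: growth_ge gV _.
Qed.

Lemma log_energy1_le nu : has_mean nu -> log_energy 1 nu <= 2 * \int[nu]_x `|x|.
Proof.
move=> hm; set m : R := \int[nu]_x `|x|.
have l1 c : lip 1 (fun x : R => `|x| + c).
  by move=> x y; rewrite opprD addrACA subrr addr0; exact: lip_norm.
apply: (@le_trans _ _ (\int[nu]_x (`|x| + m))).
  apply: (le_expectation hm (lip_lell_mean ltr01 hm) (l1 m)) => x.
  rewrite /m -(mean_cst nu `|x|) -RintegralD//; first last.
  - exact: lip_integrable lip_norm.
  - exact: integrable_cst_prob.
  apply: (le_expectation hm (lip_lell2 x ltr01) (_ : lip 1 (fun y : R => `|x| + `|y|))).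
    by move=> y z; rewrite opprD addrACA subrr add0r; exact: lip_norm.
  move=> y; rewrite /lell; have h := ler_normB x y.
  have [u|u] := leP `|x - y| 1; first by rewrite ln1 addr_ge0.
  by apply: le_trans h; apply: ln_lt_self; lra.
rewrite RintegralD//; first last.
- exact: integrable_cst_prob.
- exact: lip_integrable lip_norm.
by rewrite mean_cst -/m; lra.
Qed.

(** The slope 2 is that of [log_energy1_le], so that the potential outweighs the logarithmic energy.
    It comes from expanding [a * (|x| - a^-1) ^+ 2 >= 0]. *)
Lemma potential_ge_mean nu : moment nu ->
  2 * \int[nu]_x `|x| - (a^-1 + a + C) <= \int[nu]_x V x.
Proof.
move=> mom; have hm := moment_mean mom; case: (gV) => a0 C0 Vlo _ _.
rewrite -RintegralZl//; last exact: lip_integrable lip_norm.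
rewrite -[X in _ - X](mean_cst nu) -RintegralB//; first last.
- exact: integrable_cst_prob.
- apply: (@lip_integrable _ 2) => //.
  by move=> x y; rewrite -mulrBr normrM (gtr0_norm (ltr0n _ 2)) ler_wpM2l// ler_dist_dist.
apply: le_Rintegral => //; last first.
- move=> x _; apply: le_trans (Vlo x).
  have h := exprn_le_1D p2 (normr_ge0 (x : R)).
  have : a * `|x| ^+ 2 <= a * (1 + `|x| ^+ p) by rewrite ler_pM2l.
  have : 0 <= a * (`|x| - a^-1) ^+ 2 by rewrite mulr_ge0 ?sqr_ge0// ltW.
  have -> : a * (`|x| - a^-1) ^+ 2 = a * `|x| ^+ 2 - 2 * `|x| + a^-1.
    by field; rewrite gt_eqF.
  lra.
- exact: integrable_V.
- apply: (@lip_integrable _ 2) => // x y; move: (a^-1 + a + C) => K.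
  have -> : 2 * `|x| - K - (2 * `|y| - K) = 2 * (`|x| - `|y|) by ring.
  by rewrite normrM (gtr0_norm (ltr0n _ 2)) ler_wpM2l// ler_dist_dist.
Qed.

Lemma expectation_V nu : moment nu ->
  (\int[nu]_x (V x)%:E = (\int[nu]_x V x)%R%:E)%E.
Proof. by move=> mom; rewrite fineK//; exact/integrable_fin_num/integrable_V. Qed.

Lemma energy_bounded_below nu : V_integrable V nu ->
  ((- (a^-1 + a + C))%:E <= - Sigma nu + \int[nu]_x (V x)%:E)%E.
Proof.
move=> /V_integrable_moment mom; have hm := moment_mean mom.
rewrite expectation_V//.
have := Sigma_le_log_energy ltr01 hm; case: (Sigma nu) => [s| |] //=.
  rewrite -EFinD !lee_fin.
  have := log_energy1_le hm; have := potential_ge_mean mom.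
  move: (log_energy 1 nu) (Rintegral _ _ _) (Rintegral _ _ _) => u v w; lra.
by rewrite leey.
Qed.

Lemma moment_carrier nu b : nu `[0, b]%classic = 1%E -> moment nu.
Proof.
move=> nub; apply: (@le_lt_trans _ _ (\int[nu]_x (`|b| ^+ p)%:E)%E); last first.
  by rewrite integral_cst_prob ltry.
apply: (@le_integral_carrier _ _ _ nu (`[0, b]%classic : set (measurableTypeR R))) => //.
- by apply/measurable_EFinP; exact: measurable_absX.
- move=> x /=; rewrite in_itv/= => /andP[x0 xb]; rewrite lee_fin.
  by apply: lerXn2r; rewrite ?nnegrE// !ger0_norm// (le_trans x0).
Qed.

Lemma c_fin_num : c_ V \is a fin_num.
Proof.
apply/fin_numPlt; apply/andP; split.
  apply: (@lt_le_trans _ _ (- (a^-1 + a + C))%:E); first by rewrite ltNyr.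
  by apply: le_ereal_inf_tmp => _ [nu Vnu <-]; exact: energy_bounded_below.
(* A smoothing kernel is itself a compactly supported law of finite logarithmic energy, hence a
   competitor in the infimum. *)
have [phi [B [d [B0 /andP[d0 d1] phi1 _ Hphi]]]] := @smoothing_kernel R 1 ltr01.
have mom := moment_carrier phi1.
have fin : (kap_energy 1 phi < +oo)%E.
  apply: (@le_lt_trans _ _ (\int[phi]_x (- ln d + 1)%:E)%E); last first.
    by rewrite integral_cst_prob ltry.
  apply: le_integral_fun => x _; apply: (le_trans (Hphi 1 x (lexx 1))).
  rewrite lee_fin lerD2r /kapd ln1 sub0r ge_max lerN2 oppr_ge0 ln_le0//=.
  by apply: ler_ln_pos => //; rewrite le_max lexx orbT.
apply: (@le_lt_trans _ _ (- Sigma phi + \int[phi]_x (V x)%:E)%E).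
  by apply: ereal_inf_lbound; exists phi => //; exact: moment_V_integrable.
rewrite expectation_V//; have := Sigma_ge_kap fin; rewrite ln1 sub0e.
have fk : kap_energy 1 phi \is a fin_num.
  rewrite ge0_fin_numE//; apply: integral_ge0 => x _; apply: integral_ge0 => y _.
  exact: kap_ge0.
rewrite -(fineK fk) -EFinN; case: (Sigma phi) => [s| |] //= _.
by rewrite -EFinD ltry.
Qed.

End potential.

(** * Rate function *)

Section rate_function.
Context {R : realType}.
Variables (V : R -> R) (p : nat) (a C : R).
Hypotheses (p2 : (2 <= p)%N) (gV : growth V p a C).
Implicit Types (nu : probR R) (c : R).

Lemma tau_V_integrable c nu : moment p nu -> V_integrable V (tau c nu).
Proof.
move=> mom; rewrite /V_integrable tauE//; last first.
  apply/measurable_EFinP; apply: measurableT_comp => //.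
  exact: growth_measurable gV.
by have /integrableP[_] := integrable_V_reflect gV c mom.
Qed.

Lemma I_tauE c nu : moment p nu ->
  (I_tau V c nu = - Sigma nu + (\int[nu]_x V (c - x))%R%:E - c_ V)%E.
Proof.
move=> mom; rewrite /I_tau /I_ asboolT; last exact: tau_V_integrable.
rewrite Sigma_tau -(expectation_V_reflect gV)//; congr (_ + _ - _)%E.
rewrite /tau integral_distribution//.
  by apply/measurable_EFinP; exact: growth_measurable gV.
exact (integrable_V_reflect gV c mom).
Qed.

Lemma Sigma_lty nu : moment p nu -> (Sigma nu < +oo)%E.
Proof.
move=> mom; apply: le_lt_trans (ltry (log_energy 1 nu)).
by apply: Sigma_le_log_energy => //; exact: (moment_mean p2).
Qed.

Lemma I_DOSE nu : moment p nu ->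
  (I_DOS V nu = - Sigma nu + G_ V nu - c_ V)%E.
Proof.
move=> mom; have cfin := c_fin_num p2 gV.
have Gge : ((- C)%:E <= G_ V nu)%E.
  apply: le_ereal_inf_tmp => _ [c _ <-].
  by rewrite (expectation_V_reflect gV)// lee_fin; exact: (Rint_le_dominator gV).
have Gfin : G_ V nu \is a fin_num.
  apply/fin_numPlt; rewrite (lt_le_trans _ Gge) ?ltNyr//=.
  apply: (@le_lt_trans _ _ (\int[nu]_x (V (0 - x))%:E)%E).
    by apply: ereal_inf_lbound; exists 0.
  by rewrite (expectation_V_reflect gV)// ltry.
have := Sigma_lty mom; case E : (Sigma nu) => [s| |] // _.
  apply/eqP; rewrite eq_le; apply/andP; split; last first.
    apply: le_ereal_inf_tmp => _ [c _ <-]; rewrite I_tauE// E.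
    rewrite leeD2r// leeD2l// -(expectation_V_reflect gV)//.
    by apply: ereal_inf_lbound; exists c.
  rewrite leeBrDr// -leeBlDl//; apply: le_ereal_inf_tmp => _ [c _ <-].
  rewrite leeBlDl// -leeBrDr// (expectation_V_reflect gV)//.
  apply: (@le_trans _ _ (I_tau V c nu)); first by apply: ereal_inf_lbound; exists c.
  by rewrite I_tauE// E.
(* Here [Sigma nu] is -oo and both sides are +oo. *)
rewrite /= addye; last by rewrite -(fineK Gfin).
rewrite addye; last by rewrite -(fineK cfin).
apply/eqP; rewrite -leye_eq; apply: le_ereal_inf_tmp => _ [c _ <-].
by rewrite I_tauE// E -(fineK cfin).
Qed.

Lemma I_DOS_ge0 nu : moment p nu -> (0 <= I_DOS V nu)%E.
Proof.
move=> mom; have cfin := c_fin_num p2 gV.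
apply: le_ereal_inf_tmp => _ [c _ <-]; rewrite /I_tau /I_.
case: ifPn => // /asboolP iV; rewrite leeBrDr// add0e.
by apply: ereal_inf_lbound; exists (tau c nu).
Qed.

Variable E : set R.

(* The uniform margin [t'] makes the condition, which ranges over all [c], open. *)
Definition level_set (t : R) (n : nat) : set (M1p E p) :=
  [set nu : M1p E p | exists2 t', t < t' & forall c,
    t' <= \int[nu]_x Num.min (V (c - x)) n%:R - log_energy n.+1%:R^-1 nu].

Lemma level_set_open t n : open (level_set t n).
Proof.
move=> nu [t' tt' Ht']; have [K K0 lK] := truncated_lip gV n%:R.
have d0 : 0 < n.+1%:R^-1 :> R by rewrite invr_gt0 ltr0n.
have d0' : 0 <= (n.+1%:R^-1)^-1 :> R by rewrite invr_ge0 ltW.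
(* Within distance [e] the two terms move by at most [2 * K * e] and [4 * n.+1%:R * e], whatever [c]
   is, and [Q * e] is half of the margin [t' - t]. *)
pose Q : R := 2 * K + 4 * (n.+1%:R^-1)^-1 + 1.
have Q0 : 0 < Q by rewrite /Q; lra.
have p0 : (0 < p)%N by exact: ltnW.
pose e : R := (t' - t) / 2 / Q.
have e0 : 0 < e by rewrite !divr_gt0// subr_gt0.
exists e => // mu We.
have hnu := moment_mean p2 (M1p_moment nu).
have hmu := moment_mean p2 (M1p_moment mu).
exists ((t + t') / 2) => [|c]; first by lra.
have := Ht' c.
have := wasserstein_lip p0 e0 K0 hnu hmu (lip_reflect c lK) We.
have := log_energy_wasserstein p0 e0 d0 hnu hmu We.
rewrite !ler_norml => /andP[+ _] /andP[_].
move: (log_energy _ nu) (log_energy _ mu) (Rintegral nu _ _) (Rintegral mu _ _) => x y z w.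
have : Q * e = (t' - t) / 2 by rewrite /e mulrC divfK// gt_eqF.
rewrite /Q !mulrDl; move: ((n.+1%:R^-1)^-1) => D; lra.
Qed.

Lemma level_set_le t n (nu : M1p E p) : level_set t n nu ->
  exists2 t', t < t' & forall c,
    (t'%:E <= - Sigma nu + (\int[nu]_x V (c - x))%R%:E)%E.
Proof.
move=> [t' tt' Ht']; exists t' => // c.
have mom := M1p_moment nu; have hm := moment_mean p2 mom.
have d0 : 0 < n.+1%:R^-1 :> R by rewrite invr_gt0 ltr0n.
have [k lk] := truncated_reflect_lip gV c n%:R.
have VM : \int[nu]_x Num.min (V (c - x)) n%:R <= \int[nu]_x V (c - x).
  apply: le_Rintegral => //.
  - exact: lip_integrable lk.
  - exact (integrable_V_reflect gV c mom).
  - by move=> x _; rewrite ge_min lexx.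
have := Sigma_le_log_energy d0 hm; have := Ht' c.
case: (Sigma nu) => [s| |] //=; last by rewrite leey.
rewrite -EFinD !lee_fin; move: VM.
by move: (log_energy _ nu) (Rintegral nu _ _) (Rintegral nu _ _) => x y z; lra.
Qed.

Lemma level_set_cover t t' (nu : M1p E p) : t < t' ->
  (forall c, (t'%:E <= - Sigma nu + (\int[nu]_x V (c - x))%R%:E)%E) ->
  exists N, forall n, (N <= n)%N -> level_set t n nu.
Proof.
move=> tt' H; have mom := M1p_moment nu; have hm := moment_mean p2 mom.
pose eta := (t' - t) / 4; have eta0 : 0 < eta by rewrite divr_gt0// subr_gt0.
(* The target is shared between a logarithmic part [r] and a potential part [g]. If [Sigma nu] is
   -oo, [r] can be as large as desired and the crude [g = - C] suffices. *)
have [r [g [rS gV' rg]]] : exists r g, [/\ (r%:E < - Sigma nu)%E,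
    (forall c, g <= \int[nu]_x V (c - x)) & t + 3 * eta <= r + g].
  have := Sigma_lty mom; case E0 : (Sigma nu) H => [s| |] // H _.
    exists (- s - eta), (t' + s); split.
    - by rewrite -EFinN lte_fin ltrBlDr ltrDl.
    - by move=> c; have := H c; rewrite -EFinN -EFinD lee_fin; lra.
    - by rewrite /eta; lra.
  exists (t + 3 * eta + C), (- C); split => //; first by rewrite ltry.
    by move=> c; exact: (Rint_le_dominator gV).
  by rewrite addrK.
have [N1 HN1] := log_energy_approx hm rS.
have [N2 HN2] := truncated_potential p2 gV mom eta0 gV'.
exists (maxn N1 N2) => n; rewrite geq_max => /andP[/HN1 + /HN2 h2].
move=> h1; exists (t + 2 * eta) => [|c].
  by rewrite ltrDl mulr_gt0.
have := h2 c; move: h1 rg.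
by move: (log_energy _ nu) (Rintegral nu _ _) => x y; lra.
Qed.

Lemma level_set_I_DOS t (nu : M1p E p) :
  (t%:E < I_DOS V nu)%E -> exists N, forall n, (N <= n)%N ->
    level_set (t + fine (c_ V)) n nu.
Proof.
have cfin := c_fin_num p2 gV; have mom := M1p_moment nu.
move=> tI; have [t' tt' t'I] : exists2 t', t < t' & (t'%:E <= I_DOS V nu)%E.
  case: (I_DOS V nu) tI => [s| |] // ts; last by exists (t + 1); rewrite ?ltrDl ?leey.
  by exists s.
apply: (@level_set_cover _ (t' + fine (c_ V))); first by rewrite ltrD2r.
move=> c; rewrite EFinD fineK// -leeBrDr//.
by rewrite -I_tauE//; apply: (le_trans t'I); apply: ereal_inf_lbound; exists c.
Qed.

(** A level set of the truncated energy is an open neighbourhood of [nu] on which the rate function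
    stays above [t], because truncation only lowers the energy. *)
Lemma I_DOS_lsc : rate_function (fun nu : M1p E p => I_DOS V nu).
Proof.
split=> [nu|nu t tI]; first exact: I_DOS_ge0 (M1p_moment nu).
have cfin := c_fin_num p2 gV.
have [N /(_ _ (leqnn N)) HN] := level_set_I_DOS tI.
exists (level_set (t + fine (c_ V)) N).
  by apply: open_nbhs_nbhs; split => //; exact: level_set_open.
move=> mu /level_set_le[t' tt' Ht'].
apply: (@lt_le_trans _ _ (t' - fine (c_ V))%:E); first by rewrite lte_fin; lra.
apply: le_ereal_inf_tmp => _ [c _ <-]; rewrite I_tauE; last exact: M1p_moment.
by rewrite EFinB fineK// leeD2r//; exact: Ht'.
Qed.

End rate_function.

(** * Upper bounds *)

Section tuple_integral.
Context {R : realType}.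
Local Open Scope ereal_scope.

Lemma ge0_integral_lebesgue_cons n (f : n.+1.-tuple (measurableTypeR R) -> \bar R) :
  measurable_fun setT f -> (forall t, 0 <= f t) ->
  \int[lebesgue_tuple n.+1]_t f t =
  \int[@lebesgue_measure R]_x \int[lebesgue_tuple n]_t f [tuple of x :: t].
Proof.
move=> mf f0; rewrite ge0_integral_pushforward//.
rewrite fubini_tonelli1//; last by move=> z; exact: f0.
by apply: measurableT_comp => //; exact: measurable_consR.
Qed.

Lemma measurable_tuple_prod n (w : R -> R) :
  measurable_fun [set: measurableTypeR R] (w : measurableTypeR R -> R) ->
  measurable_fun [set: n.-tuple (measurableTypeR R)]
    (fun t => \prod_(i < n) w (tnth t i))%R.
Proof.
move=> mw; apply: measurable_prod => i _.
by apply: (@measurableT_comp _ _ _ _ _ _ (w : measurableTypeR R -> R)) => //;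
  exact: measurable_tnth.
Qed.

Lemma integral_tuple_prod (w : R -> R) (W : R) n :
  measurable_fun [set: measurableTypeR R] (w : measurableTypeR R -> R) ->
  (forall x, 0 <= w x)%R -> \int[@lebesgue_measure R]_x (w x)%:E = W%:E ->
  \int[lebesgue_tuple n]_t (\prod_(i < n) w (tnth t i))%R%:E = (W ^+ n)%:E.
Proof.
move=> mw w0 wW; elim: n => [|n IH].
  rewrite integral_dirac// ?diracT ?mul1e ?big_ord0 ?expr0//.
  by apply/measurable_EFinP; exact: (@measurable_tuple_prod 0).
have pw m (t : m.-tuple R) : (0 <= \prod_(i < m) w (tnth t i))%R.
  by apply: prodr_ge0.
rewrite ge0_integral_lebesgue_cons => [|//|t]; last by rewrite lee_fin.
  transitivity (\int[@lebesgue_measure R]_x ((w x)%:E * (W ^+ n)%:E)).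
    apply: eq_integral => x _; rewrite -IH -ge0_integralZl//.
    - apply: eq_integral => t _; rewrite -EFinM big_ord_recl; congr EFin.
      by rewrite tnth0; congr (_ * _)%R; apply: eq_bigr => i _; rewrite tnthS.
    - by apply/measurable_EFinP; exact: measurable_tuple_prod.
    - by move=> t _; rewrite lee_fin.
    - by rewrite lee_fin.
  rewrite ge0_integralZr//.
  - by rewrite wW -EFinM exprS.
  - by apply/measurable_EFinP.
  - by move=> x _; rewrite lee_fin.
  - rewrite -IH; apply: integral_ge0 => t _; by rewrite lee_fin.
by apply/measurable_EFinP; exact: measurable_tuple_prod.
Qed.

End tuple_integral.

Section weight_bound.
Context {R : realType}.
Variables (V : R -> R) (beta : R).
Hypothesis beta0 : 0 < beta.
Implicit Types (d : R).

Lemma lellN d a : lell d (- a) = lell d a.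
Proof. by rewrite /lell normrN. Qed.

Lemma lell00 d : 0 < d -> lell d 0 = ln d.
Proof. by move=> d0; rewrite /lell normr0 (max_idPr _)// ltW. Qed.

Lemma sum_symmetric n (f : 'I_n -> 'I_n -> R) : (forall i j, f i j = f j i) ->
  \sum_(i < n) \sum_(j < n) f i j =
  2 * (\sum_(i < n) \sum_(j < n | (i < j)%N) f i j) + \sum_(i < n) f i i.
Proof.
move=> fs.
have E : \sum_(i < n) \sum_(j < n) f i j =
    \sum_(i < n) \sum_(j < n | (i < j)%N) f i j +
    \sum_(i < n) \sum_(j < n | (j < i)%N) f i j + \sum_(i < n) f i i.
  rewrite -!big_split/=; apply: eq_bigr => i _.
  rewrite (bigID (fun j : 'I_n => (i < j)%N))/= -addrA; congr (_ + _).
  rewrite (bigD1 i)/= ?ltnn// addrC; congr (_ + _).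
  by apply: eq_bigl => j; rewrite -leqNgt ltn_neqAle andbC.
rewrite E mulr2n mulrDl mul1r; congr (_ + _ + _).
rewrite (exchange_big_dep xpredT)//=; apply: eq_bigr => i _; apply: eq_bigr => j _.
exact: fs.
Qed.

(** Each factor of the Vandermonde product is at most [Num.max |x - y| d]. Completing the sum over
    pairs to a full double sum adds [N] diagonal terms [ln d]. *)
Lemma weight_le N (l : N.-tuple R) d : 0 < d ->
  ensemble_weight V beta l <=
  expR (- (beta / 2) * (N%:R * ln d - \sum_(x <- l) \sum_(y <- l) lell d (x - y) +
    N%:R * \sum_(x <- l) V x)).
Proof.
move=> d0; rewrite /ensemble_weight.
have [->|D0] := eqVneq (vandermonde l) 0.
  by rewrite normr0 powR0 ?gt_eqF// mul0r expR_ge0.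
have -> : `|vandermonde l| `^ beta = expR (beta * ln `|vandermonde l|).
  by rewrite /powR normr_eq0 (negbTE D0).
rewrite -expRD ler_expR.
have lnD : ln `|vandermonde l| <=
    \sum_(i < N) \sum_(j < N | (i < j)%N) lell d (tnth l i - tnth l j).
  rewrite -ler_expR lnK ?posrE ?normr_gt0// expR_sum /vandermonde normr_prod.
  apply: ler_prod => i _; rewrite normr_ge0/= expR_sum normr_prod.
  apply: ler_prod => j _; rewrite normr_ge0/= /lell lnK.
    by rewrite distrC le_max lexx.
  by rewrite posrE lt_max d0 orbT.
have := @sum_symmetric N (fun i j => lell d (tnth l i - tnth l j)).
rewrite (eq_bigr (fun=> ln d) (F1 := fun i => lell d (tnth l i - tnth l i))); last first.
  by move=> i _; rewrite subrr lell00.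
rewrite sumr_const card_ord -[ln d *+ N]mulr_natl.
have -> : \sum_(x <- l) \sum_(y <- l) lell d (x - y) =
    \sum_(i < N) \sum_(j < N) lell d (tnth l i - tnth l j).
  by rewrite big_tuple; apply: eq_bigr => i _; rewrite big_tuple.
rewrite big_tuple => ->; last by move=> i j; rewrite -lellN opprB.
move: lnD; set S := \sum_(i < N) \sum_(_ < N | _) _.
set Q := \sum_(i < N) V _.
have -> : - (beta / 2) * (N%:R * ln d - (2 * S + N%:R * ln d) + N%:R * Q) =
   beta * S + - (N%:R * beta / 2) * Q by field.
by move=> h; rewrite lerD2r ler_pM2l.
Qed.

Lemma dos_speed_gt0 n : 0 < dos_speed beta n.
Proof. by rewrite /dos_speed divr_gt0// mulr_gt0// exprn_gt0// ltr0n. Qed.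

(** The factor [w] keeps the integral over an unbounded space finite and contributes [W ^+ n.+2].
    This factor, the term [C2 * n.+2%:R] and the change from [n.+1%:R ^+ 2] to [n.+2%:R ^+ 2] are
    all linear in [n] in the exponent; [C3] collects them and [eta] absorbs them. *)
Lemma integral_weight_upper (A : forall n, set (n.+2.-tuple R)) (t C2 W : R) (w : R -> R) :
  measurable_fun [set: measurableTypeR R] (w : measurableTypeR R -> R) ->
  (forall x, 0 <= w x) -> (\int[@lebesgue_measure R]_x (w x)%:E = W%:E)%E ->
  (forall n (l : n.+2.-tuple R), A n l -> ensemble_weight V beta l <=
    expR (- (beta / 2) * (n.+1%:R ^+ 2 * t - C2 * n.+2%:R)) *
    \prod_(i < n.+2) w (tnth l i)) ->
  forall eta, 0 < eta -> exists N0, forall n, (N0 <= n)%N ->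
    (\int[lebesgue_tuple n.+2]_(l in A n) (ensemble_weight V beta l)%:E <=
     (expR (- dos_speed beta n * (t - eta)))%:E)%E.
Proof.
move=> mw w0 wW H eta eta0.
have W0 : 0 <= W by rewrite -lee_fin -wW; apply: integral_ge0 => x _; rewrite lee_fin.
pose C3 : R := beta / 2 * (3 * `|t| + `|C2|) + W.
exists (Num.truncn (C3 / (beta / 2 * eta))).+1 => n nN.
set e := expR (- (beta / 2) * (n.+1%:R ^+ 2 * t - C2 * n.+2%:R)).
have p0 (l : n.+2.-tuple R) : 0 <= \prod_(i < n.+2) w (tnth l i) by apply: prodr_ge0.
apply: (@le_trans _ _ (\int[lebesgue_tuple n.+2]_(l in A n)
    (e * \prod_(i < n.+2) w (tnth l i))%:E)%E).
  by apply: le_integral_fun => l Al; rewrite lee_fin; exact: H.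
apply: (@le_trans _ _ (\int[lebesgue_tuple n.+2]_l
    (e * \prod_(i < n.+2) w (tnth l i))%:E)%E).
  by apply: le_integral_set => // l; rewrite lee_fin mulr_ge0// expR_ge0.
under eq_integral do rewrite EFinM.
rewrite ge0_integralZl//; first last.
- by rewrite lee_fin expR_ge0.
- by move=> l _; rewrite lee_fin.
- by apply/measurable_EFinP; exact: measurable_tuple_prod.
rewrite (integral_tuple_prod _ mw w0 wW) -EFinM lee_fin.
apply: (@le_trans _ _ (e * expR (W * n.+2%:R))).
  rewrite ler_wpM2l ?expR_ge0// expRM_natr; apply: lerXn2r; rewrite ?nnegrE ?expR_ge0//.
  by have := expR_ge1Dx W; lra.
rewrite /e -expRD ler_expR /dos_speed.
have -> : n.+1%:R = n.+2%:R - 1 :> R by rewrite -[in RHS]natr1 addrK.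
set N : R := n.+2%:R.
have N1 : 1 <= N by rewrite ler1n.
have big : C3 <= N * (beta / 2 * eta).
  rewrite -ler_pdivrMr ?mulr_gt0 ?divr_gt0//; apply: ltW.
  apply: (lt_le_trans (truncnS_gt _)); rewrite ler_nat.
  by apply: (leq_trans nN); lia.
have t1 := ler_norm t; have t2 := ler_norm C2; have t3 := normr_ge0 t.
have tt : - `|t| <= t by have := ler_norm (- t); rewrite normrN; lra.
have b2 : 0 < beta / 2 by rewrite divr_gt0.
have k1 : (2 * N - 1) * t + C2 * N <= N * (3 * `|t| + `|C2|).
  have : (2 * N - 1) * t <= (2 * N - 1) * `|t| by rewrite ler_wpM2l//; lra.
  have : C2 * N <= `|C2| * N by rewrite ler_wpM2r//; lra.
  have : 0 <= `|t| * (N + 1) by rewrite mulr_ge0//; lra.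
  nra.
have k2 : beta / 2 * ((2 * N - 1) * t + C2 * N) + W * N <= N * C3.
  have := ler_wpM2l (ltW b2) k1; rewrite /C3; nra.
have k3 : N * C3 <= N * (N * (beta / 2 * eta)) by rewrite ler_wpM2l//; lra.
have -> : - (beta / 2) * ((N - 1) ^+ 2 * t - C2 * N) + W * N =
  - (beta / 2) * N ^+ 2 * t + (beta / 2 * ((2 * N - 1) * t + C2 * N) + W * N) by ring.
have -> : - (beta * N ^+ 2 / 2) * (t - eta) =
  - (beta / 2) * N ^+ 2 * t + N * (N * (beta / 2 * eta)) by field.
by rewrite lerD2l (le_trans k2).
Qed.

End weight_bound.

Section configuration_energy.
Context {R : realType}.
Variables (V : R -> R) (p : nat) (a C : R).
Hypotheses (p2 : (2 <= p)%N) (gV : growth V p a C).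
Implicit Types (x : nat -> R) (d : R).

Lemma sum_const_ord m (c : R) : \sum_(i < m) c = m%:R * c.
Proof. by rewrite sumr_const card_ord mulr_natl. Qed.

Definition config_log d x m : R :=
  (m.+1%:R ^- 2) * \sum_(i < m.+1) \sum_(j < m.+1) lell d (x i - x j).

Definition config_pot x m : R := m.+1%:R^-1 * \sum_(i < m.+1) V (x i).

(** With slope 4, half of the potential compensates the logarithmic energy, which is at most twice
    the mean of [|x i|]. *)
Lemma V_ge_linear (y : R) : 4 * `|y| - (4 / a + a + C) <= V y.
Proof.
case: (gV) => a0 C0 Vlo _ _; apply: le_trans (Vlo y).
have h := exprn_le_1D p2 (normr_ge0 y).
have : a * `|y| ^+ 2 <= a * (1 + `|y| ^+ p) by rewrite ler_pM2l.
have : 0 <= a * (`|y| - 2 / a) ^+ 2 by rewrite mulr_ge0 ?sqr_ge0// ltW.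
have -> : a * (`|y| - 2 / a) ^+ 2 = a * `|y| ^+ 2 - 4 * `|y| + 4 / a.
  by field; rewrite gt_eqF.
lra.
Qed.

Lemma lell_le_norm d y z : d <= 1 -> 0 < d -> lell d (y - z) <= `|y| + `|z|.
Proof.
move=> d1 d0; rewrite /lell; have h := ler_normB y z.
have [u|u] := leP `|y - z| d.
  by rewrite (@le_trans _ _ 0) ?ln_le0// addr_ge0.
by apply: le_trans h; apply: ln_lt_self; lra.
Qed.

(** Half of the potential suffices for a lower bound. The other half is what keeps the weight
    integrable, and what absorbs a small multiple of the potential in [config_energy_ge]. *)
Lemma config_coercive d x m : 0 < d <= 1 ->
  - ((4 / a + a + C) / 2) <= - config_log d x m + config_pot x m / 2.
Proof.
move=> /andP[d0 d1]; rewrite /config_log /config_pot.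
set n : R := m.+1%:R; have n0 : 0 < n by rewrite ltr0n.
set K := 4 / a + a + C.
have H1 : \sum_(i < m.+1) \sum_(j < m.+1) lell d (x i - x j) <=
    2 * n * \sum_(i < m.+1) `|x i|.
  apply: (@le_trans _ _ (\sum_(i < m.+1) \sum_(j < m.+1) (`|x i| + `|x j|))).
    by apply: ler_sum => i _; apply: ler_sum => j _; exact: lell_le_norm.
  under eq_bigr do rewrite big_split/= sumr_const card_ord.
  rewrite big_split/= sumr_const card_ord sumrMnl -mulr_natl -/n.
  by rewrite -[_ *+ m.+1]mulr_natl -/n; lra.
have H2 : 4 * \sum_(i < m.+1) `|x i| - n * K <= \sum_(i < m.+1) V (x i).
  have -> : n * K = \sum_(i < m.+1) K by rewrite sumr_const card_ord /n mulr_natl.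
  by rewrite mulr_sumr -sumrB; apply: ler_sum => i _; exact: V_ge_linear.
have n2 : 0 < n ^- 2 by rewrite invr_gt0 exprn_gt0.
have := ler_wpM2l (ltW n2) H1.
have -> : n ^- 2 * (2 * n * \sum_(i < m.+1) `|x i|) = n^-1 * (2 * \sum_(i < m.+1) `|x i|).
  by field; rewrite gt_eqF.
have ni : 0 <= n^-1 by rewrite invr_ge0 ltW.
have := ler_wpM2l ni H2; rewrite mulrBr mulrA mulrA mulVf ?gt_eqF// mul1r.
set S : R := \sum_(i < _) `|_|; set Q : R := \sum_(i < _) V _; set U : R := \sum_(i < _) _.
clear; move: (n^-1) (n ^- 2) K S Q U => u v k S Q U; lra.
Qed.

Variables (eps d B : R) (phi : probR R).
Hypotheses (eps0 : 0 < eps) (eps1 : eps <= 1) (d0 : 0 < d) (d1 : d <= 1).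
Hypothesis phi_carrier : phi `[0, eps]%classic = 1%E.
Hypothesis phi_kap : forall D y, 1 <= D ->
  (\int[phi]_s kap D (y - s) <= (kapd D d y + eps)%:E)%E.

Let L x m : probR R := average (fun i => \d_(x i : measurableTypeR R)) m.

Lemma ge0_integral_empirical x m (f : measurableTypeR R -> \bar R) :
  measurable_fun setT f -> (forall y, 0 <= f y)%E ->
  (\int[L x m]_y f y = (m.+1%:R^-1)%:E * \sum_(i < m.+1) f (x i))%E.
Proof.
move=> mf f0; rewrite ge0_integral_average//; congr (_ * _)%E.
by apply: eq_bigr => i _; rewrite integral_dirac// diracT mul1e.
Qed.

Let nu x m : probR R := smear (@measurable_id _ _ setT) (L x m) phi.

Lemma integral_smeared_config_le x m (g : measurableTypeR R -> \bar R) (b : nat -> R) :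
  measurable_fun setT g -> (forall y, 0 <= g y)%E ->
  (forall i, (\int[phi]_s g (x i - s)%R <= (b i)%:E)%E) ->
  (\int[nu x m]_y g y <= (m.+1%:R^-1 * \sum_(i < m.+1) b i)%:E)%E.
Proof.
move=> mg g0 gb; rewrite ge0_integral_smear// ge0_integral_empirical; first last.
- by move=> y; apply: integral_ge0.
- apply: (measurable_fun_fubini_tonelli_F (m2 := phi)
    (fun z : measurableTypeR R * measurableTypeR R => g (z.1 - z.2)%R)) => //.
  apply: measurableT_comp => //.
  by apply: measurable_funB; [exact: measurable_fst|exact: measurable_snd].
rewrite EFinM lee_pmul2l// -sumEFin; apply: lee_sum => i _.
exact: gb.
Qed.

(** Smoothing changes the potential at [x i] by at most [eps * C * (1 + |x i| ^+ p)]; coercivity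
    bounds [|x i| ^+ p] by [(V (x i) + C) / a], so the error is a small multiple of the potential
    itself. *)
Lemma smeared_config_energy x m :
  fine (c_ V) <= - config_log d x m + 2 * eps +
    config_pot x m + eps * C / a * (config_pot x m + C) + eps * C.
Proof.
case: (gV) => a0 C0 Vlo Vhi Vinc.
have cfin := c_fin_num p2 gV.
set n : R := m.+1%:R; have n0 : 0 < n by rewrite ltr0n.
have mV : measurable_fun [set: measurableTypeR R] (V : measurableTypeR R -> R).
  exact: growth_measurable gV.
have mompi := moment_carrier p phi_carrier.
have mom : moment p (nu x m).
  have iphi := moment_integrable mompi.
  pose mp : R := \int[phi]_s (`|s| ^+ p).
  apply: (le_lt_trans _ (ltry (n^-1 * \sum_(i < m.+1) (2 ^+ p * (`|x i| ^+ p + mp))))).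
  apply: (@integral_smeared_config_le x m (fun y : measurableTypeR R =>
    (`|y : R| ^+ p)%:E) (fun i => 2 ^+ p * (`|x i| ^+ p + mp))) => //.
  - by apply/measurable_EFinP; exact: measurable_absX.
  - move=> i; apply: (@le_trans _ _ (\int[phi]_s
        ((2 ^+ p * `|x i| ^+ p)%:E + (2 ^+ p)%:E * (`|s| ^+ p)%:E))%E).
      apply: le_integral_fun => s _; rewrite -EFinM -EFinD lee_fin -mulrDr.
      apply: (le_trans _ (exprD_le _ (normr_ge0 _) (normr_ge0 _))).
      by apply: lerXn2r; rewrite ?nnegrE ?addr_ge0//; exact: ler_normB.
    rewrite integralD//; first last.
    - exact: integrableZl.
    - exact: integrable_cst_prob.
    rewrite integral_cst_prob integralZl// -[X in (_ + _ * X)%E]fineK; last first.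
      exact: integrable_fin_num.
    by rewrite -EFinM -EFinD mulrDr.
(* [D] exceeds all distances within the configuration, where [kapd D d] is therefore exactly
   [ln D - lell d]; [ln D] cancels in the end. *)
pose D : R := 1 + \sum_(i < m.+1) \sum_(j < m.+1) `|x i - x j|.
have Dx i j : (i < m.+1)%N -> (j < m.+1)%N -> `|x i - x j| <= D.
  move=> im jm; rewrite /D (bigD1 (Ordinal im))//= (bigD1 (Ordinal jm))//=.
  set s1 := \sum_(_ < _ | _) _; set s2 := \sum_(_ < _ | _) _.
  have : 0 <= s1 by apply: sumr_ge0.
  have : 0 <= s2 by apply: sumr_ge0 => k _; apply: sumr_ge0.
  by lra.
have D1 : 1 <= D by rewrite lerDl; apply: sumr_ge0 => k _; apply: sumr_ge0.
have kE : (kap_energy D (nu x m) <= (ln D - config_log d x m + 2 * eps)%:E)%E.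
  have := @kap_energy_smear R D d eps _ (@measurable_id _ _ setT) (L x m) phi D1 d0
    (ltW eps0) (fun y => phi_kap y D1).
  move/le_trans; apply.
  have mF (y : R) : measurable_fun [set: measurableTypeR R] (fun z : measurableTypeR R =>
      (kapd D d (y - z) + 2 * eps)%:E).
    apply/measurable_EFinP; apply: measurable_funD => //.
    apply: (@measurableT_comp _ _ _ _ _ _ (kapd D d : measurableTypeR R -> R)).
      exact: measurable_kapd.
    exact: measurable_funB.
  have F0 (y z : R) : (0 <= (kapd D d (y - z) + 2 * eps)%:E)%E.
    by rewrite lee_fin addr_ge0 ?kapd_ge0// mulr_ge0// ltW.
  under eq_integral => y _ do rewrite (ge0_integral_empirical x m (mF y) (F0 y)).
  rewrite ge0_integral_empirical; first last.
  - by move=> y; rewrite mule_ge0// sume_ge0.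
  - apply: measurable_funeM; apply: emeasurable_sum => i.
    apply/measurable_EFinP; apply: measurable_funD => //.
    apply: (@measurableT_comp _ _ _ _ _ _ (kapd D d : measurableTypeR R -> R)).
      exact: measurable_kapd.
    exact: measurable_funB.
  rewrite (eq_bigr (fun i : 'I_m.+1 => (n^-1 *
      \sum_(j < m.+1) (ln D + 2 * eps - lell d (x i - x j)))%:E)) => [|i _].
    rewrite sumEFin -EFinM lee_fin -mulr_sumr.
    under eq_bigr do rewrite sumrB sum_const_ord -/n.
    rewrite sumrB sum_const_ord -/n /config_log -/n.
    set S := \sum_(i < _) _.
    have -> // : n^-1 * (n^-1 * (n * (n * (ln D + 2 * eps)) - S)) =
      ln D - n ^- 2 * S + 2 * eps by field; rewrite gt_eqF.
  rewrite sumEFin -EFinM; congr EFin; congr (_ * _); apply: eq_bigr => j _.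
  rewrite /kapd (max_idPr _) /lell; first by ring.
  rewrite subr_ge0 ler_ln_pos// ?lt_max ?d0 ?orbT//.
  by rewrite ge_max; apply/andP; split; [exact: Dx|exact: le_trans d1 D1].
have kfin : kap_energy D (nu x m) \is a fin_num.
  rewrite ge0_fin_numE; first exact: (le_lt_trans kE (ltry _)).
  by apply: integral_ge0 => y _; apply: integral_ge0 => z _; exact: kap_ge0.
have SE : (- Sigma (nu x m) <= (- config_log d x m + 2 * eps)%:E)%E.
  rewrite leeNl; apply: le_trans (Sigma_ge_kap (le_lt_trans kE (ltry _))).
  rewrite -(fineK kfin) in kE *; rewrite lee_fin in kE.
  by rewrite -EFinB -EFinN lee_fin; lra.
have VE : \int[nu x m]_y V y <= config_pot x m + eps * C / a * (config_pot x m + C) + eps * C.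
  have VC0 y : (0 <= (V y + C)%:E)%E by rewrite lee_fin; have := growth_ge gV y; lra.
  have mVC : measurable_fun [set: measurableTypeR R] (fun y : measurableTypeR R => (V y + C)%:E).
    by apply/measurable_EFinP; exact: measurable_funD.
  have := @integral_smeared_config_le x m (fun y => (V y + C)%:E)
    (fun i => V (x i) + C + eps * C / a * (V (x i) + C) + eps * C) mVC VC0.
  have -> : (\int[nu x m]_y (V y + C)%:E = (\int[nu x m]_y V y + C)%:E)%E.
    under eq_integral do rewrite EFinD.
    rewrite integralD//; first last.
    - exact: integrable_cst_prob.
    - exact: integrable_V gV _ mom.
    by rewrite integral_cst_prob (expectation_V gV mom).
  move=> H; have {H} := H _; rewrite lee_fin => H.
  apply: (@le_trans _ _ (n^-1 * (\sum_(i < m.+1) (V (x i) + C +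
    eps * C / a * (V (x i) + C) + eps * C)) - C)).
    rewrite lerBrDr; apply: H => i.
    apply: (@le_trans _ _ (\int[phi]_s (V (x i) + C +
        eps * C / a * (V (x i) + C) + eps * C)%:E)%E); last first.
      by rewrite integral_cst_prob.
    have VC := growth_ge gV (x i).
    have b0 : 0 <= eps * C / a * (V (x i) + C) + eps * C.
      have VC1 : 0 <= V (x i) + C by lra.
      by apply: addr_ge0; [apply: mulr_ge0 => //; rewrite divr_ge0 ?mulr_ge0 ?ltW|rewrite mulr_ge0 ?ltW].
    apply: (@le_integral_carrier _ _ _ phi (`[0, eps]%classic : set (measurableTypeR R))) => //.
    - apply/measurable_EFinP; apply: measurable_funD => //.
      apply: (@measurableT_comp _ _ _ _ _ _ (V : measurableTypeR R -> R)) => //.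
      exact: measurable_funB.
    - by move=> _; rewrite lee_fin; lra.
    - move=> s /=; rewrite in_itv/= => /andP[s0 s1]; rewrite lee_fin.
      have ns : `|s| = s by rewrite ger0_norm.
      have := Vinc (x i) s; rewrite ns => /(_ (le_trans s1 eps1)).
      rewrite ler_norml => /andP[_].
      have xp : `|x i| ^+ p <= (V (x i) + C) / a.
        by rewrite ler_pdivlMr// mulrC; have := Vlo (x i); lra.
      have xp0 : 0 <= `|x i| ^+ p by rewrite exprn_ge0.
      have : s * (C * (1 + `|x i| ^+ p)) <= eps * (C * (1 + (V (x i) + C) / a)).
        apply: ler_pM => //; first by rewrite mulr_ge0 ?addr_ge0// ltW.
        by rewrite ler_pM2l// lerD2l.
      have -> : eps * (C * (1 + (V (x i) + C) / a)) =
         eps * C / a * (V (x i) + C) + eps * C by field; rewrite gt_eqF.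
      by lra.
  rewrite big_split/= big_split/= big_split/= -mulr_sumr big_split/=.
  rewrite !sum_const_ord -/n /config_pot -/n.
  set S := \sum_(i < _) _.
  have -> // : n^-1 * (S + n * C + eps * C / a * (S + n * C) + n * (eps * C)) - C =
    n^-1 * S + eps * C / a * (n^-1 * S + C) + eps * C.
  by field; rewrite !gt_eqF.
have : ((fine (c_ V))%:E <= - Sigma (nu x m) + \int[nu x m]_y (V y)%:E)%E.
  rewrite fineK//; apply: ereal_inf_lbound; exists (nu x m) => //.
  exact: moment_V_integrable gV _ mom.
rewrite (expectation_V gV mom) => h.
rewrite -lee_fin; apply: (le_trans h).
apply: (le_trans (leeD2r _ SE)); rewrite -EFinD lee_fin.
by move: VE; move: (Rintegral _ _ _) => u; lra.
Qed.

End configuration_energy.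

Section upper_bounds.
Context {R : realType}.
Variables (V : R -> R) (p : nat) (a C beta : R).
Hypotheses (p2 : (2 <= p)%N) (gV : growth V p a C) (beta0 : 0 < beta).
Implicit Types (x : nat -> R) (d : R).

(* The bound with [(1 + kappa) * config_pot] is turned into one with
   [config_pot] by averaging it with the coercivity bound. *)
Lemma config_energy_ge (eta : R) : 0 < eta -> exists2 d, 0 < d <= 1 &
  forall x m, fine (c_ V) - eta <= - config_log d x m + config_pot V x m.
Proof.
move=> eta0; case: (gV) => a0 C0 _ _ _.
pose K2 : R := (4 / a + a + C) / 2.
have K20 : 0 <= K2 by rewrite /K2 !(addr_ge0, divr_ge0)// ltW.
set cV : R := fine (c_ V).
have c0 := normr_ge0 cV; have c1 := ler_norm cV.
pose r : R := C / a; have r0 : 0 < r by rewrite divr_gt0.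
pose Q : R := 2 + r * C + C + 2 * r * (`|cV| + K2).
have Q0 : 0 < Q.
  have : 0 <= r * C by rewrite mulr_ge0// ltW.
  have : 0 <= 2 * r * (`|cV| + K2).
    by apply: mulr_ge0; [apply: mulr_ge0 => //; exact: ltW|exact: addr_ge0].
  by rewrite /Q; lra.
pose eps : R := Num.min 1 (eta / Q).
have eps0 : 0 < eps by rewrite lt_min ltr01 divr_gt0.
have eps1 : eps <= 1 by rewrite ge_min lexx.
have epsQ : eps * Q <= eta by rewrite -ler_pdivlMr// ge_min lexx orbT.
have [phi [B [d [_ /andP[d0 d1] phi1 _ Hphi]]]] := smoothing_kernel eps0.
exists d => [|x m]; first by rewrite d0.
have H1 := smeared_config_energy p2 gV eps0 eps1 d0 d1 phi1 Hphi x m.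
have H2 := @config_coercive _ V p a C p2 gV d x m (introT andP (conj d0 d1)).
rewrite -/cV -/K2 in H1 H2.
have E : eps * C / a = eps * r by rewrite /r mulrA.
rewrite E in H1; set k : R := eps * r in H1.
have k0 : 0 < k by rewrite mulr_gt0.
move: H1 H2; set A : R := - config_log d x m; set v : R := config_pot V x m.
move=> H1 H2.
(* The solution of [(1 - th) * (1 + k) + th / 2 = 1], which restores the coefficient 1 in front of
   [v]. As [th <= 2 * k], the averaging costs only a multiple of [eps]. *)
pose th : R := k / (1 / 2 + k).
have th0 : 0 <= th by rewrite divr_ge0//; lra.
have th1 : th <= 1 by rewrite ler_pdivrMr; lra.
have th2 : th <= 2 * k by rewrite ler_pdivrMr; nra.
have thk : th * (1 / 2 + k) = k by rewrite divfK// gt_eqF//; lra.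
have X1 : (1 - th) * (cV - 2 * eps - k * C - eps * C) <= (1 - th) * (A + (1 + k) * v).
  by apply: ler_wpM2l; lra.
have X2 : th * - K2 <= th * (A + v / 2) by rewrite ler_wpM2l.
have X3 : th * (cV - 2 * eps - k * C - eps * C + K2) <= 2 * k * (`|cV| + K2).
  apply: (@le_trans _ _ (th * (`|cV| + K2))).
    rewrite ler_wpM2l// lerD2r.
    have : 0 <= k * C by rewrite mulr_ge0// ltW.
    have : 0 <= eps * C by rewrite mulr_ge0// ltW.
    by lra.
  by rewrite ler_wpM2r// addr_ge0.
have X4 : eps * Q = 2 * eps + k * C + eps * C + 2 * k * (`|cV| + K2).
  by rewrite /Q /k; ring.
have X5 : (1 - th) * (A + (1 + k) * v) + th * (A + v / 2) = A + v.
  have -> : (1 - th) * (A + (1 + k) * v) + th * (A + v / 2) =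
     A + v + (k - th * (1 / 2 + k)) * v by field.
  by rewrite thk subrr mul0r addr0.
lra.
Qed.

Lemma sum_nth n (l : n.-tuple R) (f : R -> R) :
  \sum_(x <- l) f x = \sum_(i < n) f (nth 0 l i).
Proof. by rewrite (big_nth 0) big_mkord size_tuple. Qed.

(** Comparison with a Gaussian density of variance [(c * a)^-1]: as [p >= 2], [V] dominates
    [a * |x| ^+ 2], half of which pays for [b * |x|]. *)
Lemma integrable_exp_V c b : 0 < c -> exists W : R,
  (\int[@lebesgue_measure R]_x (expR (- c * (V x - b * `|x|)))%:E = W%:E)%E.
Proof.
move=> c0; case: (gV) => a0 C0 Vlo _ _.
pose s : R := (Num.sqrt (c * a))^-1.
have ca0 : 0 < c * a by rewrite mulr_gt0.
have s0 : s != 0 by rewrite invr_eq0 gt_eqF// sqrtr_gt0.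
have s2 : s ^+ 2 = (c * a)^-1 by rewrite exprVn sqr_sqrtr// ltW.
pose K : R := expR (c * (a + C + b ^+ 2 / (2 * a))) / normal_peak s.
have pk0 : 0 < normal_peak s by exact: normal_peak_gt0.
pose I := (\int[@lebesgue_measure R]_x (expR (- c * (V x - b * `|x|)))%:E)%E.
have I0 : (0 <= I)%E by apply: integral_ge0 => y _; rewrite lee_fin expR_ge0.
have IK : (I <= K%:E)%E.
  apply: (@le_trans _ _ (\int[@lebesgue_measure R]_x (K%:E * (normal_pdf 0 s x)%:E))%E).
    apply: le_integral_fun => y _; rewrite -EFinM lee_fin normal_pdfE//.
    rewrite /K mulrA divfK ?gt_eqF// /normal_fun -expRD ler_expR.
    rewrite subr0 s2.
    have -> : - y ^+ 2 / ((c * a)^-1 *+ 2) = - (c * a) * y ^+ 2 / 2.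
      by rewrite -mulr_natr; field; rewrite !gt_eqF.
    have h := exprn_le_1D p2 (normr_ge0 y).
    have h1 : a * `|y| ^+ 2 <= a * (1 + `|y| ^+ p) by rewrite ler_pM2l.
    have h2 : 0 <= a / 2 * (`|y| - b / a) ^+ 2.
      by rewrite mulr_ge0 ?sqr_ge0// divr_ge0// ltW.
    have h3 : a / 2 * (`|y| - b / a) ^+ 2 =
      a * `|y| ^+ 2 / 2 - b * `|y| + b ^+ 2 / (2 * a) by field; rewrite gt_eqF.
    have h4 := Vlo y.
    have : c * (a * y ^+ 2 / 2 - a - C - b ^+ 2 / (2 * a)) <= c * (V y - b * `|y|).
      by rewrite ler_pM2l// -(real_normK (num_real y)); lra.
    by lra.
  rewrite ge0_integralZl//; first last.
  - by rewrite lee_fin divr_ge0// ?expR_ge0// ltW.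
  - by move=> y _; rewrite lee_fin normal_pdf_ge0.
  - by apply/measurable_EFinP; exact: measurable_normal_pdf.
  by rewrite integral_normal_pdf mule1.
exists (fine I); rewrite fineK// ge0_fin_numE//.
exact: (le_lt_trans IK (ltry _)).
Qed.

Lemma partition_function_upper (eta : R) : 0 < eta ->
  exists N0, forall n, (N0 <= n)%N ->
    (partition_function V beta n.+2 <=
     (expR (- dos_speed beta n * (fine (c_ V) - eta)))%:E)%E.
Proof.
move=> eta0; have eta2 : 0 < eta / 2 by rewrite divr_gt0.
have [d d01 Hd] := config_energy_ge eta2.
have /andP[d0 d1] := d01.
have [W HW] := @integrable_exp_V (beta / 4) 0 ltac:(by rewrite divr_gt0).
pose w (y : R) : R := expR (- (beta / 4) * (V y - 0 * `|y|)).
have mw : measurable_fun [set: measurableTypeR R] (w : measurableTypeR R -> R).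
  apply: measurableT_comp => //; apply: measurable_funM => //.
  apply: measurable_funB; first exact: growth_measurable gV.
  by apply: measurable_funM => //; exact: normr_measurable.
set t : R := fine (c_ V) - eta / 2.
pose K2 : R := (4 / a + a + C) / 2.
have [|N0 HN0] := @integral_weight_upper R V beta beta0 (fun n => setT) t
  (`|t| + K2 - ln d) W w mw (fun y : R => expR_ge0 _) HW _ _ eta2; last first.
  exists N0 => n /HN0; rewrite /partition_function.
  by have -> : t - eta / 2 = fine (c_ V) - eta by rewrite /t; lra.
move=> n l _; apply: (le_trans (weight_le V beta0 l d0)).
rewrite /w -expR_sum -expRD ler_expR -mulr_sumr.
rewrite (eq_bigr (fun i : 'I_n.+2 => V (nth 0 l i))) => [|i _]; last first.
  by rewrite mul0r subr0 (tnth_nth 0).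
rewrite (sum_nth l (fun y => \sum_(z <- l) lell d (y - z))) (sum_nth l V).
rewrite (eq_bigr (fun i : 'I_n.+2 => \sum_(j < n.+2) lell d (nth 0 l i - nth 0 l j))) => [|i _]; last first.
  exact: (sum_nth l (fun z => lell d (nth 0 l i - z))).
have H1 := Hd (nth 0 l) n.+1; have H2 := config_coercive p2 gV (nth 0 l) n.+1 d01.
move: H1 H2; rewrite /config_log /config_pot -/K2 -/t.
have -> : n.+1%:R = n.+2%:R - 1 :> R by rewrite -[in RHS]natr1 addrK.
set N : R := n.+2%:R.
set U : R := \sum_(i < n.+2) \sum_(j < n.+2) _.
set Q : R := \sum_(i < n.+2) _.
have N1 : 1 < N by rewrite ltr1n.
have Nn0 : N != 0 by rewrite gt_eqF//; lra.
have b2 : 0 < beta / 2 by rewrite divr_gt0.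
move=> H1 H2.
(* The energy bound is used with multiplicity [N ^+ 2 - N] and the coercivity bound with
   multiplicity [N]. Together they consume [N * Q - Q / 2] of the potential and leave the factor
   [expR (- (beta / 4) * V)] at each site. *)
have T1 : (N ^+ 2 - N) * t <= (N ^+ 2 - N) * (- (N ^- 2 * U) + N^-1 * Q).
  by rewrite ler_wpM2l//; nra.
have T2 : N * - K2 <= N * (- (N ^- 2 * U) + N^-1 * Q / 2).
  by rewrite ler_wpM2l//; lra.
have T3 : (N ^+ 2 - N) * (- (N ^- 2 * U) + N^-1 * Q) +
    N * (- (N ^- 2 * U) + N^-1 * Q / 2) = - U + N * Q - Q / 2 by field.
have T4 : (N - 1) * - `|t| <= (N - 1) * t.
  by apply: ler_wpM2l; [lra|have := ler_norm (- t); rewrite normrN; lra].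
have T5 : (N - 1) ^+ 2 * t - (`|t| + K2 - ln d) * N <= N * ln d - U + N * Q - Q / 2.
  have : 0 <= `|t| by [].
  have := lerD T1 T2; rewrite T3; lra.
have := ler_wpM2l (ltW b2) T5.
lra.
Qed.

End upper_bounds.

Section level_set_upper.
Context {R : realType}.
Implicit Types (d : R).

Lemma ge0_integral_dos n (l : n.+2.-tuple R) (f : measurableTypeR R -> \bar R) :
  measurable_fun setT f -> (forall y, 0 <= f y)%E ->
  (\int[dos_measure l]_y f y = (n.+1%:R^-1)%:E * \sum_(i < n.+1) f (gap l i))%E.
Proof.
move=> mf f0.
rewrite (ge0_integral_mscale _ measurableT _ mf (fun y _ => f0 y)).
rewrite (ge0_integral_measure_sum _ measurableT (fun y _ => f0 y) mf).
by congr (_ * _)%E; apply: eq_bigr => i _; rewrite integral_dirac// diracT mul1e.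
Qed.

Lemma Rintegral_dos n (l : n.+2.-tuple R) (f : measurableTypeR R -> R) :
  measurable_fun setT f ->
  \int[dos_measure l]_y f y = n.+1%:R^-1 * \sum_(i < n.+1) f (gap l i).
Proof.
move=> mf; rewrite /Rintegral integralE.
have mE : measurable_fun [set: measurableTypeR R] (EFin \o f) by exact/measurable_EFinP.
rewrite !ge0_integral_dos//; first last.
- exact: measurable_funepos.
- exact: measurable_funeneg.
rewrite (eq_bigr (fun i : 'I_n.+1 => (Num.max (f (gap l i)) 0)%:E)) => [|i _]; last first.
  by rewrite funeposE -EFin_max.
rewrite [X in (_ - _ * X)%E](eq_bigr (fun i : 'I_n.+1 => (Num.max (- f (gap l i)) 0)%:E)); last first.
  by move=> i _; rewrite funenegE -EFinN -EFin_max.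
rewrite !sumEFin -!EFinM -EFinB/= -mulrBr -sumrB; congr (_ * _); apply: eq_bigr => i _.
by case: (leP 0 (f (gap l i))); case: (leP 0 (- f (gap l i))); lra.
Qed.

Lemma perm_sum2 n (l : n.-tuple R) (f : R -> R -> R) :
  \sum_(x <- l) \sum_(y <- l) f x y =
  \sum_(i < n) \sum_(j < n) f (nth 0 (sort <=%R l) i) (nth 0 (sort <=%R l) j).
Proof.
have pl : perm_eq l (sort <=%R l) by rewrite perm_sym perm_sort.
rewrite (perm_big _ pl)/= (big_nth 0) big_mkord size_sort size_tuple.
apply: eq_bigr => i _.
by rewrite (perm_big _ pl)/= (big_nth 0) big_mkord size_sort size_tuple.
Qed.

Lemma perm_sum1 n (l : n.-tuple R) (f : R -> R) :
  \sum_(x <- l) f x = \sum_(i < n) f (nth 0 (sort <=%R l) i).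
Proof.
have pl : perm_eq l (sort <=%R l) by rewrite perm_sym perm_sort.
by rewrite (perm_big _ pl)/= (big_nth 0) big_mkord size_sort size_tuple.
Qed.

Variables (V : R -> R) (p : nat) (a C beta : R).
Hypotheses (p2 : (2 <= p)%N) (gV : growth V p a C) (beta0 : 0 < beta).

(** The level set condition is used at the single [c] equal to the largest eigenvalue, where it
    bounds the energy of the other [n.+1] eigenvalues. Of the [n.+2] copies of the potential at the
    top, [n.+1] pay for its interactions as far as these grow with the top; one copy at every site
    is left for integrability, reduced by the slope 2 for the rest of the interactions. *)
Lemma level_set_weight t k n (l : n.+2.-tuple R) :
  level_set (p := p) V t k (dos l p) ->
  ensemble_weight V beta l <=
    expR (- (beta / 2) * (n.+1%:R ^+ 2 * t -
      (4 / a + a + C - ln k.+1%:R^-1) * n.+2%:R)) *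
    \prod_(i < n.+2) expR (- (beta / 2) * (V (tnth l i) - 2 * `|tnth l i|)).
Proof.
case: (gV) => a0 C0 _ _ _ [t' tt' /(_ (nth 0 (sort <=%R l) n.+1))].
set s := sort _ _; set top := nth _ _ n.+1.
set d : R := k.+1%:R^-1 => Ht.
have d0 : 0 < d by rewrite invr_gt0.
have d1 : d <= 1 by rewrite invf_le1// ler1n.
apply: (le_trans (weight_le V beta0 l d0)).
rewrite -expR_sum -expRD ler_expR -mulr_sumr -mulrDr.
rewrite ler_wnM2l//; first by rewrite lerNl oppr0 divr_ge0// ltW.
rewrite -(big_tuple _ _ l xpredT (fun x => V x - 2 * `|x|)) perm_sum2 !perm_sum1.
have recr (F : 'I_n.+2 -> R) :
    \sum_(i < n.+2) F i = \sum_(i < n.+1) F (widen_ord (leqnSn n.+1) i) + F ord_max.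
  exact: big_ord_recr.
rewrite !recr/= -/s -/top.
have -> : \sum_(i < n.+1) \sum_(j < n.+2) lell d (nth 0 s i - nth 0 s j) =
    \sum_(i < n.+1) (\sum_(j < n.+1) lell d (nth 0 s i - nth 0 s j) +
      lell d (nth 0 s i - top)).
  by apply: eq_bigr => i _; rewrite recr.
rewrite big_split/= subrr lell00//.
have -> : \sum_(i < n.+1) lell d (top - nth 0 s i) = \sum_(i < n.+1) lell d (nth 0 s i - top).
  by apply: eq_bigr => i _; rewrite -lellN opprB.
have mV : measurable_fun [set: measurableTypeR R] (V : measurableTypeR R -> R).
  exact: growth_measurable gV.
have E1 : \int[dos_measure l]_x Num.min (V (top - x)) k%:R =
    n.+1%:R^-1 * \sum_(i < n.+1) Num.min (V (nth 0 s i)) k%:R.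
  rewrite Rintegral_dos.
    by congr (_ * _); apply: eq_bigr => i _; rewrite /gap -/s -/top opprB addrC subrK.
  apply: measurable_minr => //.
  apply: (@measurableT_comp _ _ _ _ _ _ (V : measurableTypeR R -> R)) => //.
  exact: measurable_funB.
have E2 : log_energy d (dos_measure l) = n.+1%:R^-1 * (n.+1%:R^-1 *
    \sum_(i < n.+1) \sum_(j < n.+1) lell d (nth 0 s i - nth 0 s j)).
  have H y : \int[dos_measure l]_x lell d (y - x) =
      n.+1%:R^-1 * \sum_(j < n.+1) lell d (y - gap l j).
    rewrite Rintegral_dos//.
    exact: lip_measurable (lip_lell2 y d0).
  rewrite /log_energy; under eq_Rintegral do rewrite H.
  rewrite Rintegral_dos.
    rewrite -mulr_sumr; congr (_ * (_ * _)); apply: eq_bigr => i _; apply: eq_bigr => j _.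
    by rewrite /gap -/s -/top -lellN; congr (lell d _); lra.
  apply: measurable_funM => //; apply: measurable_sum => j.
  exact: lip_measurable (lip_lell1 _ d0).
move: Ht; rewrite E1 E2.
have : \sum_(i < n.+1) Num.min (V (nth 0 s i)) k%:R <= \sum_(i < n.+1) V (nth 0 s i).
  by apply: ler_sum => i _; rewrite ge_min lexx.
have : \sum_(i < n.+1) lell d (nth 0 s i - top) <= \sum_(i < n.+1) `|nth 0 s i| + n.+1%:R * `|top|.
  rewrite -(sum_const_ord _ `|top|) -big_split/=; apply: ler_sum => i _.
  exact: lell_le_norm.
have VT : 2 * `|top| - (4 / a + a + C) <= V top.
  by have := V_ge_linear p2 gV top; have := normr_ge0 top; lra.
rewrite sumrN -mulr_sumr big_split/=.
have -> : n.+2%:R = n.+1%:R + 1 :> R by rewrite natr1.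
have N1 : 1 <= n.+1%:R :> R by rewrite ler1n.
have K0 : 0 < 4 / a + a + C by rewrite !addr_gt0 ?divr_gt0.
have L0 : ln d <= 0 by rewrite ln_le0.
move: N1 K0 L0 VT.
move: (4 / a + a + C) (ln d) (n.+1%:R) => K L N N1 K0 L0 VT.
move: (\sum_(i < _) Num.min _ _) (\sum_(i < _) \sum_(j < _) _) => M U.
move: (\sum_(i < _) lell _ _) (\sum_(i < _) `|_|) (\sum_(i < _) V _) => S A Q H1 H2 H3.
move: (V top) (`|top|) VT H1 (normr_ge0 top) => v w VT H1 w0.
have N0 : 0 < N by lra.
have T1 : N ^+ 2 * t <= N ^+ 2 * (N^-1 * M - N^-1 * (N^-1 * U)).
  by rewrite ler_wpM2l ?exprn_ge0//; lra.
have T2 : N ^+ 2 * (N^-1 * M - N^-1 * (N^-1 * U)) = N * M - U.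
  by field; rewrite gt_eqF.
have T3 : N * M <= N * Q by rewrite ler_wpM2l// ltW.
have T4 : N * (2 * w - K) <= N * v by rewrite ler_wpM2l// ltW.
rewrite T2 in T1; lra.
Qed.

Lemma level_set_upper t k (eta : R) : 0 < eta -> exists N0, forall n, (N0 <= n)%N ->
  (\int[lebesgue_tuple n.+2]_(l in [set l | level_set (p := p) V t k (dos l p)])
      (ensemble_weight V beta l)%:E <=
    (expR (- dos_speed beta n * (t - eta)))%:E)%E.
Proof.
move=> eta0.
have [W HW] := integrable_exp_V p2 gV 2 (divr_gt0 beta0 (ltr0n R 2)).
apply: (integral_weight_upper (w := fun y => expR (- (beta / 2) * (V y - 2 * `|y|)))
  beta0 _ _ HW (fun n l => @level_set_weight t k n l) eta0) => [|y].
- apply: measurableT_comp => //; apply: measurable_funM => //.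
  apply: measurable_funB; first exact: growth_measurable gV.
  by apply: measurable_funM => //; exact: normr_measurable.
- exact: expR_ge0.
Qed.

End level_set_upper.

(** If no [U n] contained [K], the differences of [K] and [U n] would generate a proper filter on
    [K], whose cluster point lies in some open [U n]. *)
Lemma compact_increasing_cover (T : topologicalType) (K : set T) (U : nat -> set T) :
  compact K -> (forall n, open (U n)) -> (forall n m, (n <= m)%N -> U n `<=` U m) ->
  K `<=` \bigcup_n U n -> exists n, K `<=` U n.
Proof.
move=> cK oU ndU KU; apply: contrapT => /forallNP nU.
pose F : set_system T := [set S | exists n, K `\` U n `<=` S].
have KUn n : exists x, K x /\ ~ U n x.
  by have /existsNP[x /not_implyP[Kx nUx]] := nU n; exists x.
have FF : ProperFilter F.
  apply: Build_ProperFilter.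
    by move=> [n HS]; have [x Kx] := KUn n; exact: HS Kx.
  split; first by exists 0%N.
    move=> S S' [n HS] [n' HS']; exists (maxn n n') => x [Kx nUx]; split.
      by apply: HS; split => // /(ndU _ _ (leq_maxl n n')).
    by apply: HS'; split => // /(ndU _ _ (leq_maxr n n')).
  by move=> S S' SS' [n HS]; exists n => x Hx; apply: SS'; exact: HS Hx.
have FK : F K by exists 0%N => x [].
have [x [Kx clx]] := cK F FF FK.
have [n _ Unx] := KU x Kx.
have FU : F (~` U n) by exists n => y [].
by have [y [nUy /nUy]] := clx _ _ FU (open_nbhs_nbhs (conj (oU n) Unx)).
Qed.

Lemma level_set_le_index (R : realType) (V : R -> R) (p : nat) (a C : R) (E : set R)
    (t : R) (n m : nat) :
  (2 <= p)%N -> growth V p a C -> (n <= m)%N ->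
  level_set (p := p) (E := E) V t n `<=` level_set V t m.
Proof.
move=> p2 gV nm nu [t' tt' Ht']; exists t' => [|c]; first exact: tt'.
have hm := moment_mean p2 (M1p_moment nu).
have [k lk] := truncated_reflect_lip gV c n%:R.
have [k' lk'] := truncated_reflect_lip gV c m%:R.
have H1 : \int[nu]_x Num.min (V (c - x)) n%:R <= \int[nu]_x Num.min (V (c - x)) m%:R.
  apply: (le_expectation hm lk lk') => x.
  by rewrite le_min !ge_min lexx/= ler_nat nm orbT.
have H2 : log_energy m.+1%:R^-1 nu <= log_energy n.+1%:R^-1 nu.
  apply: log_energy_le => //.
  by rewrite lef_pV2 ?posrE// ler_nat.
move: H1 H2 (Ht' c); move: (log_energy _ _) (log_energy _ _) (Rintegral _ _ _) (Rintegral _ _ _).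
by move=> x y z w; lra.
Qed.

(** * Lower bounds *)

Section integral_comparison.
Context d (T : measurableType d) {R : realType}.
Local Open Scope ereal_scope.

Lemma ge0_integral_le_scale (m1 m2 : {measure set T -> \bar R}) (b : R)
    (D : set T) (f : T -> \bar R) : (0 <= b)%R -> measurable D ->
  (forall A, measurable A -> m1 A <= b%:E * m2 (A `&` D)) ->
  measurable_fun setT f -> (forall x, 0 <= f x) ->
  \int[m1]_x f x <= b%:E * \int[m2]_(x in D) f x.
Proof.
move=> b0 mD m12 mf f0.
have mDC : measurable (~` D) by exact: measurableC.
have DC0 : m1 (~` D) = 0.
  apply/eqP; rewrite eq_le measure_ge0 andbT (le_trans (m12 _ mDC))//.
  by rewrite setICl measure0 mule0.
rewrite (ge0_negligible_integral mDC _ _ _ DC0)//.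
rewrite setTD setCK.
rewrite -(ge0_integral_mscale m2 mD (NngNum b0) (measurable_funTS mf) (fun x _ => f0 x)).
apply: ge0_le_measure_integral => // A mA; apply: (le_trans (m12 _ mA)).
apply: lee_wpmul2l; first by rewrite lee_fin.
by apply: le_measure; rewrite ?inE//; exact: measurableI.
Qed.

Lemma measurable_expeR : measurable_fun [set: \bar R] (@expeR R).
Proof.
apply: (@measurability _ _ _ _ _ _ _ (ErealGenOInfty.measurableE R)) => //.
move=> /= _ [_ [x ->] <-]; rewrite setTI.
have [x0|x0] := leP 0%R x; last first.
  rewrite (_ : _ @^-1` _ = setT)//; apply/seteqP; split => // y _ /=.
  by rewrite in_itv/= andbT (lt_le_trans _ (expeR_ge0 y))// lte_fin.
rewrite (_ : _ @^-1` _ = `]lne x%:E, +oo%E]%classic); first exact: emeasurable_itv.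
have xE : x%:E = expeR (lne x%:E) by rewrite lneK// in_itv/= lee_fin x0 leey.
by apply/seteqP; split => y /=; rewrite !in_itv/= andbT ?leey ?andbT xE lte_expeR.
Qed.

(* Jensen's inequality for [exp (- g)] where no integrability is needed:
   integrate the tangent line bound at [M]. *)
Lemma expe_integral_ge (P : probability T R) (g : T -> \bar R) (M : R) :
  measurable_fun setT g -> (forall x, 0 <= g x) -> \int[P]_x g x <= M%:E ->
  (expR (- M))%:E <= \int[P]_x expeR (- g x).
Proof.
move=> mg g0 gM.
have M0 : (0 <= M)%R by rewrite -lee_fin (le_trans _ gM)//; exact: integral_ge0.
have me : measurable_fun setT (fun x => expeR (- g x)).
  apply: measurableT_comp; first exact: measurable_expeR.
  exact: measurableT_comp.
have H : (expR (- M) * (1 + M))%:E <=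
    \int[P]_x (expeR (- g x) + (expR (- M))%:E * g x).
  rewrite -[leLHS](integral_cst_prob P); apply: le_integral_fun => x _.
  have := g0 x; case: (g x) => [r| |] //= r0.
    rewrite -EFinM -EFinD lee_fin.
    have : (expR (- M) * (1 + (M - r)) <= expR (- M) * expR (M - r))%R.
      by rewrite ler_pM2l ?expR_gt0// expR_ge1Dx.
    rewrite -expRD; have -> : (- M + (M - r) = - r)%R by lra.
    lra.
  by rewrite mulry gtr0_sg ?expR_gt0// mul1e leey.
rewrite ge0_integralD// in H; first last.
- exact: measurable_funeM.
- by move=> x _; rewrite mule_ge0// lee_fin expR_ge0.
- by move=> x _; exact: expeR_ge0.
rewrite ge0_integralZl// in H.
have {}H := le_trans H (leeD2l _ (lee_wpmul2l _ gM)).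
have {H} := H _; rewrite lee_fin expR_ge0 => /(_ isT).
rewrite -EFinM -leeBlDr// -EFinB => /(le_trans _); apply.
by rewrite lee_fin mulrDr mulr1 addrK.
Qed.

End integral_comparison.

Section product_probability.
Context {R : realType}.
Local Open Scope ereal_scope.
Implicit Types (nu : nat -> probR R).

(** Independent coordinates of different laws, built by the recursion of [lebesgue_tuple] so that
    the two can be compared one coordinate at a time. *)
Fixpoint prod_prob nu n : probability (n.-tuple (measurableTypeR R)) R :=
  match n with
  | 0 => \d_ [tuple]
  | n'.+1 => law (nu 0%N \x prod_prob (fun k => nu k.+1) n') (@measurable_consR R n')
  end.

Lemma ge0_integral_prod_prob nu n (f : n.+1.-tuple (measurableTypeR R) -> \bar R) :
  measurable_fun setT f -> (forall t, 0 <= f t) ->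
  \int[prod_prob nu n.+1]_t f t =
  \int[nu 0%N]_x \int[prod_prob (fun k => nu k.+1) n]_t f [tuple of x :: t].
Proof.
move=> mf f0; rewrite ge0_integral_law//.
rewrite (@fubini_tonelli1 _ _ _ _ _ (nu 0%N) (prod_prob (fun k => nu k.+1) n)
  (f \o @consR R n))//.
  by apply: measurableT_comp => //; exact: measurable_consR.
by move=> z; exact: f0.
Qed.

Lemma integral_tnth_prod_prob nu n (i : 'I_n) (f : measurableTypeR R -> \bar R) :
  measurable_fun setT f -> (forall x, 0 <= f x) ->
  \int[prod_prob nu n]_t f (tnth t i) = \int[nu i]_x f x.
Proof.
move=> mf f0; elim: n nu i => [|n IH] nu; first by case.
move=> i; rewrite ge0_integral_prod_prob//; last first.
  by apply: measurableT_comp => //; exact: measurable_tnth.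
case: (unliftP ord0 i) => [j|] ->.
  under eq_integral => x _ do under eq_integral => t _ do rewrite tnthS.
  by rewrite integral_cst_prob IH.
under eq_integral => x _ do under eq_integral => t _ do rewrite tnth0.
by under eq_integral => x _ do rewrite integral_cst_prob.
Qed.

Lemma integral_tnth2_prod_prob nu n (i j : 'I_n)
    (f : measurableTypeR R * measurableTypeR R -> \bar R) :
  (i < j)%N -> measurable_fun setT f -> (forall x, 0 <= f x) ->
  \int[prod_prob nu n]_t f (tnth t i, tnth t j) = \int[nu i]_x \int[nu j]_y f (x, y).
Proof.
move=> + mf f0; elim: n nu i j => [|n IH] nu; first by case.
move=> i j ij; rewrite ge0_integral_prod_prob//; last first.
  apply: measurableT_comp => //.
  by apply: measurable_fun_pair; exact: measurable_tnth.
case: (unliftP ord0 j) ij => [j'|] -> //.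
case: (unliftP ord0 i) => [i'|] -> ij.
  under eq_integral => x _ do under eq_integral => t _ do rewrite !tnthS.
  by rewrite integral_cst_prob IH.
apply: eq_integral => x _.
under eq_integral => t _ do rewrite tnth0 tnthS.
apply: (@integral_tnth_prod_prob (fun k => nu k.+1) n j' (fun y => f (x, y))) => //.
by apply: measurableT_comp => //; exact: measurable_fun_pair.
Qed.

Lemma measurable_box (A : nat -> set (measurableTypeR R)) n :
  (forall k, measurable (A k)) ->
  measurable [set t : n.-tuple (measurableTypeR R) | forall i : 'I_n, A i (tnth t i)].
Proof.
move=> mA; rewrite (_ : [set _ | _] = \bigcap_(i in [set: 'I_n])
    ((fun t : n.-tuple (measurableTypeR R) => tnth t i) @^-1` (A i))).
  apply: fin_bigcap_measurable => // i _; rewrite -[X in measurable X]setTI.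
  exact: measurable_tnth.
by apply/seteqP; split => t /= h i => [_|]; exact: h.
Qed.

(** The change of measure: bounding each density by a constant on its cell takes the place of an
    entropy estimate, at the price of the product of the [b i]. *)
Lemma prod_prob_le_lebesgue nu (A : nat -> set (measurableTypeR R)) (b : nat -> R) n
    (f : n.-tuple (measurableTypeR R) -> \bar R) :
  (forall k, 0 <= b k)%R -> (forall k, measurable (A k)) ->
  (forall k B, measurable B -> nu k B <= (b k)%:E * lebesgue_measure (B `&` A k)) ->
  measurable_fun setT f -> (forall t, 0 <= f t) ->
  \int[prod_prob nu n]_t f t <=
  (\prod_(i < n) b i)%R%:E *
    \int[lebesgue_tuple n]_(t in [set t : n.-tuple R | forall i : 'I_n, A i (tnth t i)]) f t.
Proof.
move=> b0 mA nuA; elim: n nu A b b0 mA nuA f => [|n IH] nu A b b0 mA nuA f mf f0.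
  rewrite big_ord0 mul1e /= (_ : [set t | _] = setT)//.
  by apply/seteqP; split => // t _ [].
pose b' := (\prod_(i < n) b i.+1)%R.
have b'0 : (0 <= b')%R by apply: prodr_ge0.
pose S' : set (n.-tuple (measurableTypeR R)) := [set t | forall i : 'I_n, A i.+1 (tnth t i)].
pose J (x : measurableTypeR R) := \int[lebesgue_tuple n]_(t in S') f [tuple of x :: t].
have mS' : measurable S' by exact: (@measurable_box (fun k => A k.+1)).
have mfc : measurable_fun [set: measurableTypeR R * n.-tuple (measurableTypeR R)]
    (f \o @consR R n).
  by apply: measurableT_comp => //; exact: measurable_consR.
have mJ : measurable_fun setT J.
  have -> : J = fubini_F (lebesgue_tuple n)
      ((f \o @consR R n) \_ ([set: measurableTypeR R] `*` S')).
    apply/funext => x; rewrite /J integral_mkcond; apply: eq_integral => t _.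
    rewrite !patchE; congr (if _ then _ else _).
    by apply/idP/idP; rewrite !inE => // -[].
  apply: measurable_fun_fubini_tonelli_F.
    apply/(measurable_restrict _ _ _) => //.
    - exact: measurableX.
    - exact: measurable_funS mfc.
  by move=> z; rewrite patchE; case: ifP => // _; exact: f0.
have J0 x : 0 <= J x by exact: integral_ge0.
rewrite ge0_integral_prod_prob//.
apply: (@le_trans _ _ (\int[nu 0%N]_x (b'%:E * J x))).
  apply: le_integral_fun => x _.
  have mfx : measurable_fun [set: n.-tuple (measurableTypeR R)] (fun t => f [tuple of x :: t]).
    have mp : measurable_fun [set: n.-tuple (measurableTypeR R)] (fun t => (x, t)).
      exact: measurable_fun_pair.
    exact: (measurableT_comp mfc mp).
  apply: (IH (fun k => nu k.+1) (fun k => A k.+1) (fun k => b k.+1)) => //.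
  by move=> k B; exact: nuA.
rewrite ge0_integralZl// big_ord_recl -/b' mulrC EFinM -muleA.
rewrite lee_wpmul2l//.
have H : \int[nu 0%N]_x J x <= (b 0%N)%:E * \int[@lebesgue_measure R]_(x in A 0%N) J x.
  by apply: ge0_integral_le_scale => // B; exact: nuA.
apply: (le_trans H); rewrite lee_wpmul2l// ?lee_fin//.
rewrite [leRHS]integral_mkcond ge0_integral_lebesgue_cons; first last.
- by move=> t; rewrite patchE; case: ifP.
- apply/(measurable_restrict _ _ _) => //.
  + exact: measurable_box.
  + exact: measurable_funS mf.
rewrite integral_mkcond; apply: le_integral_fun => x _; rewrite patchE.
case: ifPn => [|_]; last first.
  by apply: integral_ge0 => t _; rewrite patchE; case: ifP.
rewrite inE /J => Ax; rewrite integral_mkcond; apply: le_integral_fun => t _.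
rewrite !patchE; case: ifPn => [|_]; last by case: ifP.
rewrite inE => St; rewrite mem_set// => i.
by case: (unliftP ord0 i) => [j|] ->; [rewrite tnthS; exact: St|rewrite tnth0].
Qed.

End product_probability.

Section cuts.
Context {R : realType}.
Variables (rho : probR R) (B a c : R).
Hypotheses (B0 : 0 < B) (rho_carrier : rho `]a, c]%classic = 1%E)
  (rhoB : forall A, measurable A -> (rho A <= B%:E * lebesgue_measure A)%E).
Implicit Types (q : nat -> R).

Let F (x : R) : R := fine (rho `]a, x]%classic).

Let rho_itv (x y : R) : x <= y -> a <= x ->
  (rho `]x, y]%classic = (F y - F x)%:E)%E.
Proof.
move=> xy ax.
have E : `]a, y]%classic = (`]a, x] `|` `]x, y])%classic :> set (measurableTypeR R).
  by rewrite -itv_bndbnd_setU// bnd_simp.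
have := congr1 rho E; rewrite measureU//; last first.
  apply/seteqP; split => // z [] /=; rewrite !in_itv/= => /andP[_ zx] /andP[xz _].
  by move: (lt_le_trans xz zx); rewrite ltxx.
rewrite /F => ->.
have f1 : rho `]a, x]%classic \is a fin_num by exact: fin_num_measure.
have f2 : rho `]x, y]%classic \is a fin_num by exact: fin_num_measure.
by rewrite fineD// EFinB EFinD !fineK// addeAC subee// add0e.
Qed.

Let ac : a < c.
Proof.
rewrite ltNge; apply/negP => ca; move: rho_carrier.
by rewrite set_itv_ge ?bnd_simp -?leNgt// measure0 => /eqP; rewrite eqe eq_sym oner_eq0.
Qed.

Let Fa : F a = 0.
Proof. by rewrite /F set_itv_ge ?bnd_simp ?ltxx// measure0. Qed.

Let Fc : F c = 1.
Proof. by rewrite /F rho_carrier. Qed.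

Let F_lip x y : a <= x -> x <= y -> `|F y - F x| <= B * (y - x).
Proof.
move=> ax xy; have H := rho_itv xy ax.
have d0 : 0 <= F y - F x by rewrite -lee_fin -H.
rewrite ger0_norm// -lee_fin -H; apply: (le_trans (rhoB _)) => //.
by rewrite lebesgue_measure_itv/= lte_fin; case: ifP => // /negbT; rewrite -leNgt => yx;
  rewrite mule0 lee_fin mulr_ge0// ?subr_ge0// ltW.
Qed.

Let F0 x : x <= a -> F x = 0.
Proof. by move=> xa; rewrite /F set_itv_ge ?bnd_simp -?leNgt// measure0. Qed.

Let F_lipT : lip B F.
Proof.
suff H x y : x <= y -> `|F x - F y| <= B * `|x - y|.
  by move=> x y; case: (leP x y) => [/H//|/ltW/H]; rewrite distrC [X in _ * X]distrC.
move=> xy; rewrite distrC [X in _ * X]distrC (ger0_norm (x := y - x)) ?subr_ge0//.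
have [ax|/ltW xa] := leP a x; first exact: F_lip.
have [ya|/ltW ay] := leP y a.
  by rewrite !F0// subrr normr0 mulr_ge0 ?subr_ge0// ltW.
have := F_lip (lexx a) ay; rewrite Fa (F0 xa) => /le_trans; apply.
by rewrite ler_pM2l// lerB.
Qed.

(** The density bound makes the distribution function Lipschitz, so the quantiles exist by the
    intermediate value theorem. *)
Lemma quantile_cuts n : exists q,
  [/\ forall k, (k <= n.+1)%N -> a <= q k <= c,
      forall k, (k < n.+1)%N -> q k < q k.+1 &
      forall k, (k < n.+1)%N -> rho `]q k, q k.+1]%classic = (n.+1%:R^-1)%:E].
Proof.
have cF : {within `[a, c], continuous F}.
  by apply: continuous_subspaceT; exact: lip_continuous F_lipT.
have IVT_cut k : exists x, (k <= n.+1)%N -> [/\ a <= x, x <= c & F x = k%:R / n.+1%:R].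
  have [kn|_] := leqP k n.+1; last by exists a.
  have [|x] := @IVT _ F a c (k%:R / n.+1%:R) (ltW ac) cF.
    rewrite Fa Fc (min_idPl _)// (max_idPr _)// divr_ge0//=.
    by rewrite ler_pdivrMr// mul1r ler_nat.
  by rewrite in_itv/= => /andP[ax xc] Fx; exists x.
have [q Hq] := choice IVT_cut.
have qq k : (k < n.+1)%N -> q k < q k.+1.
  move=> kn; have [ax xc Fx] := Hq k (ltnW kn); have [ay yc Fy] := Hq _ kn.
  rewrite ltNge; apply/negP => yx.
  have : F (q k.+1) <= F (q k).
    by rewrite -subr_ge0 -lee_fin -(rho_itv yx ay).
  rewrite Fx Fy ler_pM2r ?invr_gt0// ler_nat ltnn.
  by [].
exists q; split => // k kn.
  by have [-> ->] := Hq k kn.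
have [ax xc Fx] := Hq k (ltnW kn); have [ay yc Fy] := Hq _ kn.
by rewrite rho_itv ?(ltW (qq _ _))// Fx Fy -mulrBl -natr1 addrAC subrr add0r mul1r.
Qed.

End cuts.

Section conditional.
Context {R : realType}.
Local Open Scope ereal_scope.
Implicit Types (rho : probR R) (D A : set (measurableTypeR R)).

Lemma conditional_prob rho D (r : R) : measurable D -> (0 < r)%R -> rho D = (r^-1)%:E ->
  exists P : probR R, forall A, P A = r%:E * rho (A `&` D).
Proof.
move=> mD r0 rD; exists (mnormalize (mrestr rho mD) rho) => A.
rewrite /= /mnormalize/= /mrestr/= setTI rD eqe invr_eq0 (gt_eqF r0)/= muleC.
by rewrite invrK.
Qed.

Lemma le_lebesgue_setI rho D (b : R) : (0 <= b)%R -> measurable D -> rho D = 1 ->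
  (forall A, measurable A -> rho A <= b%:E * lebesgue_measure A) ->
  forall A, measurable A -> rho A <= b%:E * lebesgue_measure (A `&` D).
Proof.
move=> b0 mD rD H A mA; apply: (le_trans _ (H _ (measurableI _ _ mA mD))).
have DC : rho (~` D) = 0 by rewrite probability_setC// rD subee.
have AE : A = (A `&` D) `|` (A `&` ~` D) by rewrite -setIUr setUCr setIT.
have mDC : measurable (~` D) by exact: measurableC.
have mAC : measurable (A `&` ~` D) by exact: measurableI.
have E0 : rho (A `&` ~` D) = 0.
  by apply/eqP; rewrite eq_le measure_ge0 andbT -DC le_measure// inE.
have E1 : rho A = rho (A `&` D) + rho (A `&` ~` D).
  rewrite {1}AE; apply: measureU => //; first exact: measurableI.
  by rewrite setIACA setICr setI0.
by rewrite E1 E0 adde0.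
Qed.

Lemma sum_integral_cuts rho (q : nat -> R) (f : measurableTypeR R -> \bar R) m :
  (forall k, (k < m)%N -> (q k <= q k.+1)%R) ->
  measurable_fun setT f -> (forall x, 0 <= f x) ->
  \sum_(k < m) \int[rho]_(x in `]q k, q k.+1]%classic) f x <= \int[rho]_x f x.
Proof.
move=> qq mf f0.
suff [H _] : \sum_(k < m) \int[rho]_(x in `]q k, q k.+1]%classic) f x <=
    \int[rho]_(x in `]q 0%N, q m]%classic) f x /\ (q 0%N <= q m)%R.
  by apply: (le_trans H); apply: le_integral_set.
elim: m qq => [|m IH] qq; first by rewrite big_ord0; split => //; exact: integral_ge0.
have [H q0m] := IH (fun k km => qq k (ltnW km)).
have qm := qq m (ltnSn m); split; last exact: le_trans qm.
rewrite big_ord_recr/= (itv_bndbnd_setU (_ : (BRight (q 0%N) <= BRight (q m))%O)) ?bnd_simp//.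
rewrite ge0_integral_setU//; first by rewrite leeD2r.
- exact: measurable_funTS.
- rewrite disj_set2E; apply/eqP/seteqP; split => // z [] /=.
  rewrite !in_itv/= => /andP[_ zx] /andP[xz _].
  by move: (lt_le_trans xz zx); rewrite ltxx.
Qed.

End conditional.

Lemma expectation_VC (R : realType) (V : R -> R) (p : nat) (a C : R) (nu : probR R) :
  growth V p a C -> moment p nu ->
  (\int[nu]_x (V x + C)%:E = (\int[nu]_x V x + C)%:E)%E.
Proof.
move=> gV mom; under eq_integral do rewrite EFinD.
rewrite integralD//; first last.
- exact: integrable_cst_prob.
- exact (integrable_V gV mom).
by rewrite integral_cst_prob (expectation_V gV mom).
Qed.

Section box_weight.
Context {R : realType}.
Variables (V : R -> R) (p : nat) (a C beta : R).
Hypotheses (gV : growth V p a C) (beta0 : 0 < beta).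
Implicit Types (D : R).
Local Open Scope ereal_scope.

Definition pair_energy D N (l : N.-tuple (measurableTypeR R)) : \bar R :=
  \sum_(i < N) \sum_(j < N | (i < j)%N) kap D (tnth l i - tnth l j).

Definition site_energy N (l : N.-tuple (measurableTypeR R)) : \bar R :=
  \sum_(i < N) (V (tnth l i) + C)%:E.

(** The prefactor undoes the shifts, [ln D] per pair and [C] per site, that make both energies
    nonnegative. If two points coincide the pair energy is +oo and the left-hand side vanishes. *)
Lemma weight_ge D N (l : N.-tuple (measurableTypeR R)) :
  (expR (beta * (\sum_(i < N) \sum_(j < N | (i < j)%N) ln D) + N%:R ^+ 2 * beta / 2 * C))%:E *
  expeR (- (beta%:E * pair_energy D l + (N%:R * beta / 2)%:E * site_energy l)) <=
  (ensemble_weight V beta l)%:E.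
Proof.
have siteE : site_energy l = (\sum_(i < N) (V (tnth l i) + C))%R%:E.
  by rewrite /site_energy sumEFin.
have site0 : (0 <= \sum_(i < N) (V (tnth l i) + C))%R.
  by apply: sumr_ge0 => i _; have := growth_ge gV (tnth l i); lra.
have bN : (0 <= N%:R * beta / 2)%R by rewrite divr_ge0// mulr_ge0// ltW.
have [/existsP[i /existsP[j /andP[ij /eqP lij]]]|nl] := boolP [exists i : 'I_N, exists j : 'I_N,
    (i < j)%N && (tnth l i == tnth l j)].
  have -> : pair_energy D l = +oo.
    apply/eqP; rewrite eq_le leey/= /pair_energy (bigD1 i)//= (bigD1 j)//=.
    rewrite lij subrr kap0 -addeA leeDl//.
    by rewrite adde_ge0// !sume_ge0// => *; rewrite ?sume_ge0// => *; exact: kap_ge0.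
  rewrite gt0_muley ?lte_fin// siteE addye//= mule0.
  by rewrite lee_fin /ensemble_weight mulr_ge0// ?powR_ge0// expR_ge0.
have kE (i j : 'I_N) : (i < j)%N -> kap D (tnth l i - tnth l j) =
    (Num.max 0 (ln D - ln `|tnth l i - tnth l j|))%:E.
  move=> ij; rewrite kapE// subr_eq0; apply: contraNN nl => lij.
  by apply/existsP; exists i; apply/existsP; exists j; rewrite ij.
have pairE : pair_energy D l = (\sum_(i < N) \sum_(j < N | (i < j)%N)
    Num.max 0 (ln D - ln `|tnth l i - tnth l j|))%R%:E.
  rewrite /pair_energy -sumEFin; apply: eq_bigr => i _; rewrite -sumEFin.
  by apply: eq_bigr => j /kE.
set P : R := (\sum_(i < N) \sum_(j < N | _) Num.max _ _)%R in pairE *.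
set S : R := (\sum_(i < N) (V _ + C))%R in siteE site0 *.
have -> : - (beta%:E * pair_energy D l + (N%:R * beta / 2)%:E * site_energy l) =
    (- (beta * P + N%:R * beta / 2 * S))%:E.
  by rewrite pairE siteE -!EFinM -EFinD -EFinN.
rewrite -EFinM lee_fin /ensemble_weight.
have D0 : (vandermonde l != 0)%R.
  rewrite /vandermonde; apply/prodf_neq0 => i _; apply/prodf_neq0 => j ij.
  rewrite subr_eq0; apply: contraNN nl => /eqP lij.
  by apply/existsP; exists i; apply/existsP; exists j; rewrite ij lij/=.
have -> : (`|vandermonde l| `^ beta = expR (beta * ln `|vandermonde l|))%R.
  by rewrite /powR normr_eq0 (negbTE D0).
rewrite -!expRD ler_expR.
have lnV : (ln `|vandermonde l| =
    \sum_(i < N) \sum_(j < N | (i < j)%N) ln `|tnth l i - tnth l j|)%R.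
  apply: expR_inj; rewrite lnK ?posrE ?normr_gt0// expR_sum /vandermonde normr_prod.
  apply: eq_bigr => i _; rewrite expR_sum normr_prod; apply: eq_bigr => j ij.
  rewrite distrC lnK// posrE normr_gt0 subr_eq0; apply: contraNN nl => /eqP lij.
  by apply/existsP; exists i; apply/existsP; exists j; rewrite ij lij/=.
have H : (\sum_(i < N) \sum_(j < N | (i < j)%N) ln D - \sum_(i < N) \sum_(j < N | (i < j)%N)
    Num.max 0 (ln D - ln `|tnth l i - tnth l j|) <= ln `|vandermonde l|)%R.
  rewrite lnV -sumrB; apply: ler_sum => i _; rewrite -sumrB; apply: ler_sum => j _.
  by rewrite lerBlDr -lerBlDl le_max lexx orbT.
rewrite -/P in H; have := ler_wpM2l (ltW beta0) H; rewrite /S big_split/= sum_const_ord.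
move: (\sum_(i < N) V _)%R (\sum_(i < N) \sum_(j < N | _) ln D)%R P {S siteE site0 pairE H}.
by move=> v x P; lra.
Qed.

Lemma sum_pairs_le n (f : nat -> nat -> \bar R) :
  (forall i j, f i j = f j i) -> (forall i j, 0 <= f i j) ->
  \sum_(i < n) \sum_(j < n | (i < j)%N) f i j + \sum_(i < n) \sum_(j < n | (i < j)%N) f i j <=
  \sum_(i < n) \sum_(j < n) f i j.
Proof.
move=> fs f0.
have -> : \sum_(i < n) \sum_(j < n | (i < j)%N) f i j + \sum_(i < n) \sum_(j < n | (i < j)%N) f i j =
    \sum_(i < n) (\sum_(j < n | (i < j)%N) f i j + \sum_(j < n | (j < i)%N) f i j).
  rewrite big_split/=; congr (_ + _); rewrite (exchange_big_dep xpredT)//=.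
  by apply: eq_bigr => i _; apply: eq_bigr => j _.
apply: lee_sum => i _; rewrite [leRHS](bigID (fun j : 'I_n => (i < j)%N))/=.
rewrite leeD2l// [leRHS](bigID (fun j : 'I_n => (j < i)%N))/=.
rewrite [X in _ <= X + _](eq_bigl (fun j : 'I_n => (j < i)%N)) => [|j]; last first.
  by rewrite -leqNgt; case: ltngtP.
by rewrite leeDl// sume_ge0.
Qed.

Variables (rho : probR R) (B c h D K : R) (n : nat) (q : nat -> R).
Hypotheses (B0 : (0 < B)%R) (h0 : (0 < h)%R) (h1 : (h <= 1)%R) (D1 : (1 <= D)%R)
  (rhoB : forall A, measurable A -> rho A <= B%:E * lebesgue_measure A)
  (rho_kap : kap_energy D rho <= K%:E) (rho_mom : moment p rho)
  (q_lt : forall k, (k < n.+1)%N -> (q k < q k.+1)%R)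
  (rho_q : forall k, (k < n.+1)%N -> rho `]q k, q k.+1]%classic = (n.+1%:R^-1)%:E).

(* The last cell receives the largest eigenvalue. *)
Definition cell (k : nat) : set (measurableTypeR R) :=
  if (k < n.+1)%N then `]q k, q k.+1]%classic else `[c, (c + h)%R]%classic.

(** The uniform law on [[c, c + h]], as a reflection of the uniform law on [[0, h]]. *)
Let top : probR R := tau (c + h)%R (uniform_prob h0).

Let top_carrier : top `[c, (c + h)%R]%classic = 1.
Proof.
rewrite -(uniform_prob_carrier h0 (lexx h)) /top /tau /distribution /pushforward.
congr (uniform_prob _ _); apply/seteqP; split => s /=; rewrite !in_itv/= /Defs.reflect => /andP[? ?];
  by apply/andP; split; lra.
Qed.

Let top_le A : measurable A -> top A <= (h^-1)%:E * lebesgue_measure A.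
Proof.
move=> mA; rewrite -(lebesgue_measure_reflect (c + h)%R mA).
apply: uniform_prob_le_lebesgue.
by rewrite -[X in measurable X]setTI; exact: (measurable_reflect (c + h)%R).
Qed.

Let cell_probs : exists nu : nat -> probR R, forall k,
  if (k < n.+1)%N then forall A, nu k A = n.+1%:R%:E * rho (A `&` `]q k, q k.+1]%classic)
  else nu k = top.
Proof.
suff H k : exists P : probR R,
  if (k < n.+1)%N then forall A, P A = n.+1%:R%:E * rho (A `&` `]q k, q k.+1]%classic)
  else P = top by have [nu Hnu] := choice H; exists nu.
have [kn|kn] := boolP (k < n.+1)%N; last by exists top.
by apply: conditional_prob => //; exact: rho_q.
Qed.

(** [T] bounds the mean interaction of the top point with any fixed point, [Mc] its mean potential
    shifted by [C], and [M] the mean of the whole exponent under the product of the cell laws. *)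
Let T : R := (ln D - ln h + 4)%R.
Let Mc : R := (C * (1 + (`|c| + 1) ^+ p) + C)%R.
Let M : R := (beta * (n.+1%:R ^+ 2 * K / 2 + n.+1%:R * T) +
  n.+2%:R * beta / 2 * (n.+1%:R * (\int[rho]_x V x + C) + Mc))%R.

Let mkap : measurable_fun [set: measurableTypeR R * measurableTypeR R]
  (fun z => kap D (z.1 - z.2)%R).
Proof. exact: measurable_kap2. Qed.

Let mkapB (x : R) : measurable_fun [set: measurableTypeR R]
  (fun y : measurableTypeR R => kap D (x - y)%R).
Proof. exact: measurable_kapB. Qed.

Lemma measurable_pair_kap N (i j : 'I_N) : measurable_fun [set: N.-tuple (measurableTypeR R)]
  (fun l => kap D (tnth l i - tnth l j)%R).
Proof.
have mp : measurable_fun [set: N.-tuple (measurableTypeR R)] (fun l => (tnth l i, tnth l j)).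
  by apply: measurable_fun_pair; exact: measurable_tnth.
exact: (measurableT_comp mkap mp).
Qed.

Lemma measurable_pair_energy N : measurable_fun [set: N.-tuple (measurableTypeR R)]
  (@pair_energy D N).
Proof.
apply: emeasurable_sum => i; under eq_fun do rewrite big_mkcond.
apply: emeasurable_sum => j; case: (i < j)%N => //.
exact: measurable_pair_kap.
Qed.

Let mV1 : measurable_fun [set: measurableTypeR R] (fun x : measurableTypeR R => (V x + C)%:E).
Proof.
apply/measurable_EFinP; apply: measurable_funD => //; exact: growth_measurable gV.
Qed.

Let V1_ge0 x : 0 <= (V x + C)%:E.
Proof. by rewrite lee_fin; have := growth_ge gV x; lra. Qed.

Lemma measurable_site_energy N : measurable_fun [set: N.-tuple (measurableTypeR R)]
  (@site_energy N).
Proof.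
apply: emeasurable_sum => i.
apply: (@measurableT_comp _ _ _ _ _ _ (fun x : measurableTypeR R => (V x + C)%:E)) => //.
exact: measurable_tnth.
Qed.

Lemma box_weight_ge :
  (expR (beta * (\sum_(i < n.+2) \sum_(j < n.+2 | (i < j)%N) ln D) +
     n.+2%:R ^+ 2 * beta / 2 * C - M))%:E <=
  ((n.+1%:R * B) ^+ n.+1 / h)%:E *
  \int[lebesgue_tuple n.+2]_(l in [set l : n.+2.-tuple R |
      forall i : 'I_n.+2, cell i (tnth l i)]) (ensemble_weight V beta l)%:E.
Proof.
have [nu Hnu] := cell_probs.
have nu_block k : (k < n.+1)%N ->
    forall A, nu k A = n.+1%:R%:E * rho (A `&` `]q k, q k.+1]%classic).
  by move=> kn; have := Hnu k; rewrite kn.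
have nu_top : nu n.+1 = top by have := Hnu n.+1; rewrite ltnn.
have blocks_le (f : measurableTypeR R -> \bar R) : measurable_fun setT f ->
    (forall x, 0 <= f x) -> \sum_(k < n.+1) \int[nu k]_x f x <= n.+1%:R%:E * \int[rho]_x f x.
  move=> mf f0.
  apply: (@le_trans _ _ (\sum_(k < n.+1) n.+1%:R%:E *
      \int[rho]_(x in `]q k, q k.+1]%classic) f x)).
    apply: lee_sum => k _; apply: ge0_integral_le_scale => // A mA.
    by rewrite le_eqVlt; apply/orP; left; apply/eqP; exact: nu_block.
  rewrite -ge0_sume_distrr => [|k _]; last exact: integral_ge0.
  rewrite lee_wpmul2l//; apply: sum_integral_cuts => // k kn.
  by apply: ltW; exact: q_lt.
pose H i j := \int[nu i]_x \int[nu j]_y kap D (x - y)%R.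
have H0 i j : 0 <= H i j.
  by apply: integral_ge0 => x _; apply: integral_ge0 => y _; exact: kap_ge0.
have Hsym i j : H i j = H j i.
  transitivity (\int[nu j]_y \int[nu i]_x kap D (x - y)%R).
    exact (@fubini_tonelli _ _ _ _ _ (nu i) (nu j) _ mkap (fun z => kap_ge0 D _)).
  by apply: eq_integral => y _; apply: eq_integral => x _; rewrite -kapN opprB.
have mH (P : probR R) : measurable_fun [set: measurableTypeR R]
    (fun x : measurableTypeR R => \int[P]_y kap D (x - y)%R).
  apply: (measurable_fun_fubini_tonelli_F (m2 := P)
    (fun z : measurableTypeR R * measurableTypeR R => kap D (z.1 - z.2)%R)) => //.
  by move=> z; exact: kap_ge0.
have HK : \sum_(i < n.+1) \sum_(j < n.+1) H i j <= (n.+1%:R ^+ 2 * K)%:E.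
  apply: (@le_trans _ _ (\sum_(i < n.+1) \int[nu i]_x (n.+1%:R%:E * \int[rho]_y kap D (x - y)%R))).
    apply: lee_sum => i _; rewrite /H -ge0_integral_sum//.
      apply: le_integral_fun => x _; apply: blocks_le => // y; exact: kap_ge0.
    by move=> j x _; apply: integral_ge0 => y _; exact: kap_ge0.
  apply: le_trans (blocks_le _ _ _) _.
  - exact: measurable_funeM.
  - by move=> x; rewrite mule_ge0//; apply: integral_ge0 => y _; exact: kap_ge0.
  rewrite ge0_integralZl//; last by move=> x _; apply: integral_ge0 => y _; exact: kap_ge0.
  rewrite muleA -EFinM -expr2 [X in _ <= X]EFinM; exact: lee_wpmul2l.
have Htop (i : nat) : H i n.+1 <= T%:E.
  rewrite /H -[leRHS](integral_cst_prob (nu i)); apply: le_integral_fun => x _.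
  rewrite nu_top tauE//; last by move=> y; exact: kap_ge0.
  rewrite (eq_integral (fun s : measurableTypeR R => kap D ((c + h - x) - s)%R)) => [|s _]; last first.
    by rewrite -kapN; congr (kap D _); lra.
  by apply: integral_kap_uniform; exact: le_trans D1.
have pairQ : \int[prod_prob nu n.+2]_l pair_energy D l <=
    (n.+1%:R ^+ 2 * K / 2 + n.+1%:R * T)%:E.
  have -> : \int[prod_prob nu n.+2]_l pair_energy D l =
      \sum_(i < n.+2) \sum_(j < n.+2 | (i < j)%N) H i j.
    pose k (i j : 'I_n.+2) (l : n.+2.-tuple (measurableTypeR R)) :=
      if (i < j)%N then kap D (tnth l i - tnth l j)%R else 0.
    have k0 i j l : 0 <= k i j l by rewrite /k; case: ifP => // _; exact: kap_ge0.
    have mk i j : measurable_fun setT (k i j).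
      rewrite /k; case: (i < j)%N => //; exact: measurable_pair_kap.
    have pE l : pair_energy D l = \sum_(i < n.+2) \sum_(j < n.+2) k i j l.
      by apply: eq_bigr => i _; rewrite big_mkcond.
    under eq_integral => l _ do rewrite pE.
    rewrite ge0_integral_sum//; first last.
    - by move=> i l _; exact: sume_ge0.
    - by move=> i; exact: emeasurable_sum.
    apply: eq_bigr => i _; rewrite ge0_integral_sum// [RHS]big_mkcond.
    apply: eq_bigr => j _; rewrite /k; case: ifP => ij; last by rewrite integral0.
    exact: (integral_tnth2_prod_prob nu ij mkap (fun z => kap_ge0 D _)).
  have -> : \sum_(i < n.+2) \sum_(j < n.+2 | (i < j)%N) H i j =
      \sum_(i < n.+1) \sum_(j < n.+1 | (i < j)%N) H i j + \sum_(i < n.+1) H i n.+1.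
    rewrite big_ord_recr/= [X in _ + X]big1 => [|j]; last by rewrite ltnNge -ltnS ltn_ord.
    rewrite adde0 -big_split/=; apply: eq_bigr => i _.
    by rewrite big_mkcond big_ord_recr/= ltn_ord -big_mkcond.
  rewrite EFinD; apply: leeD; last first.
    apply: (@le_trans _ _ (\sum_(i < n.+1) T%:E)); first by apply: lee_sum => i _.
    by rewrite sumEFin sum_const_ord.
  have := le_trans (sum_pairs_le n.+1 Hsym H0) HK.
  have : 0 <= \sum_(i < n.+1) \sum_(j < n.+1 | (i < j)%N) H i j.
    by apply: sume_ge0 => i _; exact: sume_ge0.
  case: (\sum_(i < n.+1) _) => [r| |] //=; rewrite -?EFinD ?lee_fin; lra.
have siteQ : \int[prod_prob nu n.+2]_l site_energy l <=
    (n.+1%:R * (\int[rho]_x V x + C) + Mc)%:E.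
  have -> : \int[prod_prob nu n.+2]_l site_energy l = \sum_(i < n.+2) \int[nu i]_x (V x + C)%:E.
    rewrite ge0_integral_sum//.
    - by apply: eq_bigr => i _; rewrite (@integral_tnth_prod_prob _ nu n.+2 i
        (fun x : measurableTypeR R => (V x + C)%:E)).
    - move=> i; apply: (@measurableT_comp _ _ _ _ _ _
        (fun x : measurableTypeR R => (V x + C)%:E)) => //; exact: measurable_tnth.
  rewrite big_ord_recr/= EFinD; apply: leeD.
    apply: (le_trans (blocks_le _ _ _)) => //.
    rewrite EFinM lee_wpmul2l//.
    by rewrite (expectation_VC gV rho_mom).
  rewrite nu_top -[leRHS](integral_cst_prob top).
  apply: (le_integral_carrier _ top_carrier) => //.
    move=> _; rewrite lee_fin /Mc; case: (gV) => _ C0 _ _ _.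
    by apply: addr_ge0; [apply: mulr_ge0; rewrite ?addr_ge0 ?exprn_ge0 ?addr_ge0// ltW|exact: ltW].
  move=> x /=; rewrite in_itv/= => /andP[cx xc]; rewrite lee_fin lerD2r.
  case: (gV) => a0 C0 _ Vhi _; apply: (le_trans (ler_norm _)); apply: (le_trans (Vhi x)).
  rewrite ler_pM2l// lerD2l lerXn2r ?nnegrE ?addr_ge0//.
  have Hn (y : R) : (c <= y)%R -> (y <= c + h)%R -> (`|y| <= `|c| + 1)%R.
    move=> cy yc; rewrite ler_norml; apply/andP.
    by have := h1; have := ler_norm c; have := ler_norm (- c); rewrite normrN; split; lra.
  exact: Hn.
have bN : (0 <= n.+2%:R * beta / 2)%R by rewrite divr_ge0// mulr_ge0// ltW.
have pair0 l : 0 <= @pair_energy D n.+2 l.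
  by apply: sume_ge0 => i _; apply: sume_ge0 => j _; exact: kap_ge0.
have site0 l : 0 <= @site_energy n.+2 l by apply: sume_ge0 => i _; exact: V1_ge0.
pose g (l : n.+2.-tuple (measurableTypeR R)) : \bar R :=
  beta%:E * pair_energy D l + (n.+2%:R * beta / 2)%:E * site_energy l.
have g0 l : 0 <= g l by rewrite adde_ge0// mule_ge0// lee_fin// ltW.
have mg : measurable_fun setT g.
  apply: emeasurable_funD; apply: measurable_funeM.
  - exact: measurable_pair_energy.
  - exact: measurable_site_energy.
have gQ : \int[prod_prob nu n.+2]_l g l <= M%:E.
  rewrite ge0_integralD//; first last.
  - by apply: measurable_funeM; exact: measurable_site_energy.
  - by move=> l _; rewrite mule_ge0.
  - by apply: measurable_funeM; exact: measurable_pair_energy.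
  - by move=> l _; rewrite mule_ge0// lee_fin ltW.
  rewrite !ge0_integralZl//; first last.
  - by rewrite lee_fin ltW.
  - exact: measurable_pair_energy.
  - exact: measurable_site_energy.
  rewrite /M EFinD; apply: leeD.
    by rewrite EFinM lee_wpmul2l// lee_fin ltW.
  by rewrite [leRHS]EFinM lee_wpmul2l.
have J := expe_integral_ge mg g0 gQ.
set c0 := (beta * _ + _)%R.
pose e (l : n.+2.-tuple (measurableTypeR R)) : \bar R := (expR c0)%:E * expeR (- g l).
have me : measurable_fun setT e.
  apply: measurable_funeM; apply: measurableT_comp; first exact: measurable_expeR.
  exact: measurableT_comp.
have e0 l : 0 <= e l by rewrite mule_ge0 ?lee_fin ?expR_ge0 ?expeR_ge0.
rewrite expRD EFinM.
apply: (@le_trans _ _ (\int[prod_prob nu n.+2]_l e l)).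
  rewrite ge0_integralZl//.
  - by rewrite lee_wpmul2l// lee_fin expR_ge0.
  - apply: measurableT_comp; first exact: measurable_expeR.
    exact: measurableT_comp.
  - by move=> l _; exact: expeR_ge0.
pose b (k : nat) : R := if (k < n.+1)%N then (n.+1%:R * B)%R else h^-1%R.
have b0 k : (0 <= b k)%R.
  by rewrite /b; case: ifP => _; [rewrite mulr_ge0// ltW|rewrite invr_ge0 ltW].
have mcell k : measurable (cell k) by rewrite /cell; case: ifP.
have nub k A : measurable A -> nu k A <= (b k)%:E * lebesgue_measure (A `&` cell k).
  move=> mA; rewrite /b /cell; have := Hnu k; case: (k < n.+1)%N => [Hk|->].
    apply: (@le_trans _ _ (n.+1%:R%:E * rho (A `&` `]q k, q k.+1]%classic))).
      by rewrite le_eqVlt; apply/orP; left; apply/eqP; exact: Hk.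
    rewrite EFinM -muleA lee_wpmul2l//; apply: rhoB; exact: measurableI.
  apply: le_lebesgue_setI top_carrier top_le _ mA => //.
  by rewrite invr_ge0 ltW.
have := prod_prob_le_lebesgue (n := n.+2) b0 mcell nub me e0.
have -> : (\prod_(i < n.+2) b i = (n.+1%:R * B) ^+ n.+1 / h)%R.
  rewrite big_ord_recr/= {2}/b ltnn; congr (_ * _)%R.
  rewrite (eq_bigr (fun=> (n.+1%:R * B)%R)) => [|i _]; last by rewrite /b ltn_ord.
  by rewrite prodr_const card_ord.
move/le_trans; apply; apply: lee_wpmul2l.
  by rewrite lee_fin divr_ge0// ?exprn_ge0 ?mulr_ge0// ltW.
by apply: le_integral_fun => l _; exact: weight_ge.
Qed.

End box_weight.

Section box_asymptotics.
Context {R : realType}.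
Variables (V : R -> R) (p : nat) (a C beta : R).
Hypotheses (gV : growth V p a C) (beta0 : 0 < beta).

Lemma linear_le_quadratic (Q eps : R) : 0 < eps ->
  exists N0, forall n, (N0 <= n)%N -> Q * n%:R <= eps * n%:R ^+ 2.
Proof.
move=> e0; exists (Num.truncn (Q / eps)).+1 => n nN.
have : Q / eps <= n%:R.
  by apply: ltW; apply: (lt_le_trans (truncnS_gt _)); rewrite ler_nat.
rewrite ler_pdivrMr// => H; rewrite expr2 mulrA ler_wpM2r//.
by rewrite mulrC.
Qed.

Lemma sum_pairs_const m (x : R) :
  \sum_(i < m) \sum_(j < m | (i < j)%N) x = (m%:R ^+ 2 - m%:R) / 2 * x.
Proof.
have := @sum_symmetric R m (fun _ _ => x) (fun _ _ => erefl).
rewrite !sum_const_ord; set S := \sum_(i < m) _ => H.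
by rewrite expr2; lra.
Qed.

(* The volume factor [(n B) ^ n] only contributes [n ln n], negligible at speed [n ^ 2]. *)
Lemma box_lower_bound (rho : probR R) (B c h D K eps : R) :
  0 < B -> 0 < h -> h <= 1 -> 1 <= D -> 0 < eps ->
  (forall A, measurable A -> rho A <= B%:E * lebesgue_measure A)%E ->
  (kap_energy D rho <= K%:E)%E -> moment p rho ->
  exists N0, forall n (q : nat -> R), (N0 <= n)%N ->
    (forall k, (k < n.+1)%N -> q k < q k.+1) ->
    (forall k, (k < n.+1)%N -> rho `]q k, q k.+1]%classic = (n.+1%:R^-1)%:E) ->
    ((expR (- dos_speed beta n * (K - ln D + \int[rho]_x V x + eps)))%:E <=
      \int[lebesgue_tuple n.+2]_(l in [set l : n.+2.-tuple R |
        forall i : 'I_n.+2, cell c h n q i (tnth l i)]) (ensemble_weight V beta l)%:E)%E.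
Proof.
move=> B0 h0 h1 D1 eps0 rhoB rhoK mom.
case: (gV) => a0 C0 _ _ _.
have K0 : 0 <= K.
  rewrite -lee_fin; apply: le_trans rhoK; apply: integral_ge0 => x _.
  by apply: integral_ge0 => y _; exact: kap_ge0.
pose v : R := \int[rho]_x V x.
have vC : 0 <= v + C.
  rewrite -lee_fin -(expectation_VC gV mom); apply: integral_ge0 => x _.
  by rewrite lee_fin; have := growth_ge gV x; lra.
pose T : R := ln D - ln h + 4.
pose Mc : R := C * (1 + (`|c| + 1) ^+ p) + C.
have T0 : 0 <= T by rewrite /T; have := ln_ge0 D1; have := ln_le0 h1; lra.
have Mc0 : 0 <= Mc by rewrite /Mc addr_ge0// ?mulr_ge0 ?addr_ge0 ?exprn_ge0 ?addr_ge0// ltW.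
(* The margin [dos_speed beta n * eps] is [4 * dl * n.+2%:R ^+ 2]. One share [dl] pays for the
   volume factor, through [ln (x * B) <= dl * x + ln (B / dl)], and another for the terms linear in
   [n]. *)
have [dl dl0 dlE] : exists2 d : R, 0 < d & d = beta * eps / 8.
  by exists (beta * eps / 8); rewrite // divr_gt0// mulr_gt0.
pose Q : R := beta * T + beta / 2 * Mc + beta / 2 * ln D + `|ln (B / dl)| - ln h.
have [N0 HN0] := linear_le_quadratic Q (divr_gt0 (mulr_gt0 beta0 eps0) (ltr0n R 8)).
exists N0 => n q nN qlt rq.
have := box_weight_ge gV beta0 c B0 h0 h1 D1 rhoB rhoK mom qlt rq.
set I := (\int[_]_(_ in _) _)%E => HI.
have n0 : 0 < n.+1%:R :> R by [].
have b0 : 0 < (n.+1%:R * B) ^+ n.+1 / h by rewrite divr_gt0// exprn_gt0// mulr_gt0.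
rewrite -lee_pdivrMl// in HI; apply: le_trans HI; rewrite -EFinM lee_fin.
rewrite -[_^-1]lnK ?posrE ?invr_gt0// -expRD ler_expR lnV ?posrE//.
rewrite ln_div ?posrE ?exprn_gt0 ?mulr_gt0// lnXn ?mulr_gt0// -[_ *+ _]mulr_natl.
have lnb : ln (n.+1%:R * B) <= dl * n.+1%:R + `|ln (B / dl)|.
  have -> : n.+1%:R * B = (dl * n.+1%:R) * (B / dl) by field; rewrite gt_eqF.
  have -> : ln ((dl * n.+1%:R) * (B / dl)) = ln (dl * n.+1%:R) + ln (B / dl).
    by apply: lnM; rewrite posrE; [exact: mulr_gt0|exact: divr_gt0].
  apply: lerD; last exact: ler_norm.
  by apply: ln_lt_self; rewrite mulr_gt0.
have {lnb} lnb := ler_wpM2l (ltW n0) lnb.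
have := HN0 n.+2 _; rewrite (leq_trans nN) => [/(_ isT)|]; last by rewrite leqW.
rewrite sum_pairs_const /dos_speed -/v -/T -/Mc.
have -> : n.+2%:R = n.+1%:R + 1 :> R by rewrite natr1.
have := normr_ge0 (ln (B / dl)).
have := ln_ge0 D1; have : ln h <= 0 by exact: ln_le0.
clear HN0; rewrite {}/Q; move: n0 lnb K0 vC T0 Mc0; rewrite dlE.
move: (`|ln _|) (ln D) (ln h) (n.+1%:R) T Mc v (ln (_ * B)).
move=> A L H m T Mc v b m0 mb K0 vC T0 Mc0 H0 L0 A0 HQ.
have P1 : 0 <= beta * K * m by rewrite !mulr_ge0// ltW.
have P1' : 0 <= beta * K by rewrite mulr_ge0// ltW.
have P2 : 0 <= beta * (v + C) * (m + 1) by rewrite !mulr_ge0// ?ltW// addr_gt0.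
have P3 : 0 <= beta * T by rewrite mulr_ge0// ltW.
have P4 : 0 <= - H * m by rewrite mulr_ge0// ?oppr_ge0// ltW.
have P5 : 0 <= beta * eps * m ^+ 2 by rewrite !mulr_ge0// ?exprn_ge0// ltW.
have P6 : 0 <= beta * eps * m by rewrite !mulr_ge0// ltW.
have P7 : 0 <= beta * eps by rewrite mulr_ge0// ltW.
lra.
Qed.

End box_asymptotics.

Section clipping.
Context {R : realType}.
Implicit Types (m x y c : R) (nu : probR R).

Definition clip m y : R := Num.max (- m) (Num.min y m).

Lemma clip_norm_le m y : 0 <= m -> `|clip m y| <= m.
Proof.
move=> m0; rewrite /clip ler_norml le_max lexx/= ge_max; apply/andP; split; first by lra.
by rewrite ge_min lexx orbT.
Qed.

Lemma clip_id m y : `|y| <= m -> clip m y = y.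
Proof.
rewrite ler_norml => /andP[my ym].
by rewrite /clip (min_idPl ym) (max_idPr my).
Qed.

Lemma clip_le m y c : - m <= c -> y <= c -> clip m y <= c.
Proof. by move=> mc yc; rewrite /clip ge_max mc ge_min yc. Qed.

Lemma norm_clip_le m y : 0 <= m -> `|clip m y| <= `|y|.
Proof.
move=> m0; have [ym|my] := leP `|y| m; first by rewrite clip_id.
exact: le_trans (clip_norm_le y m0) (ltW my).
Qed.

Lemma clip_lip m : lip 1 (clip m).
Proof.
suff H x y : x <= y -> `|clip m x - clip m y| <= 1 * `|x - y|.
  by move=> x y; case: (leP x y) => [/H//|/ltW/H]; rewrite distrC [X in _ * X]distrC.
move=> xy; rewrite mul1r distrC [leRHS]distrC (ger0_norm (x := y - x)) ?subr_ge0//.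
rewrite /clip ler_norml; apply/andP.
by case: (leP y m); case: (leP x m) => h1 h2;
  repeat (match goal with |- context[Num.max ?u ?v] => case: (leP u v) => ? end); split; lra.
Qed.

Definition clip_error m y : R := `|clip m y - y|.

Lemma clip_error_lip m : lip 2 (clip_error m).
Proof.
move=> x y; apply: (le_trans (ler_dist_dist _ _)).
have -> : clip m x - x - (clip m y - y) = (clip m x - clip m y) - (x - y) by ring.
apply: (le_trans (ler_normB _ _)).
by have := clip_lip m x y; rewrite mul1r; lra.
Qed.

Lemma clip_error_le m y : 0 <= m -> clip_error m y <= `|y|.
Proof.
move=> m0; have [ym|my] := leP `|y| m.
  by rewrite /clip_error clip_id// subrr normr0.
rewrite /clip_error /clip; move: my; rewrite !ltr_normr => /orP[ym|ym].
  rewrite (min_idPr (ltW ym)) (max_idPr _)//; last by lra.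
  by rewrite (gtr0_norm (x := y)) ?ler_norml; [apply/andP; split|]; lra.
rewrite (min_idPl _); last by lra.
rewrite (max_idPl _); last by lra.
by rewrite (ltr0_norm (x := y)) ?ler_norml; [apply/andP; split|]; lra.
Qed.

Variable p : nat.
Hypothesis p2 : (2 <= p)%N.

(** Dominates the clipping error, its [p]-th power and, up to a constant, the change of [V], so that
    one small integral controls the energy, the transport cost and the potential. *)
Definition tail m y : R := (1 + `|y| ^+ p) * (m < `|y|)%R%:R.

Lemma tail_ge0 m y : 0 <= tail m y.
Proof. by rewrite mulr_ge0// addr_ge0// exprn_ge0. Qed.

Lemma clip_error_le_tail m y : 0 <= m -> clip_error m y <= tail m y.
Proof.
move=> m0; have [ym|my] := leP `|y| m.
  by rewrite /clip_error clip_id// subrr normr0 tail_ge0.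
rewrite /tail my mulr1.
have h1 := clip_error_le y m0.
apply: (le_trans h1); have [y1|/ltW y1] := leP `|y| 1.
  by rewrite (le_trans y1)// lerDl exprn_ge0.
by rewrite (@le_trans _ _ (`|y| ^+ p))// ?lerDr// -[leLHS]expr1 ler_weXn2l// ltnW.
Qed.

Lemma clip_error_expr_le_tail m y : 0 <= m -> clip_error m y ^+ p <= tail m y.
Proof.
move=> m0; have [ym|my] := leP `|y| m.
  by rewrite /clip_error clip_id// subrr normr0 expr0n/= gtn_eqF ?tail_ge0// ltnW.
rewrite /tail my mulr1 (@le_trans _ _ (`|y| ^+ p))// ?lerDr//.
by apply: lerXn2r; rewrite ?nnegrE ?clip_error_le// normr_ge0.
Qed.

Lemma measurable_tail m c : measurable_fun [set: measurableTypeR R]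
  (fun x : measurableTypeR R => tail m (c - x)).
Proof.
apply: (@measurableT_comp _ _ _ _ _ _ (tail m : measurableTypeR R -> R)); last exact: measurable_funB.
apply: measurable_funM; first by apply: measurable_funD => //; exact: measurable_absX.
have -> : (fun y : R => (m < `|y|)%R%:R : R) = \1_[set y : R | m < `|y|].
  by apply/funext => y; rewrite indicE; congr (_%:R); congr nat_of_bool; apply/idP/idP; rewrite inE.
apply: measurable_indic; rewrite (_ : [set _ | _] = (fun y : R => `|y|) @^-1` `]m, +oo[%classic).
  by rewrite -[X in measurable X]setTI; exact: normr_measurable.
by apply/seteqP; split => y /=; rewrite in_itv/= andbT.
Qed.

(** Monotone convergence is applied to the complementary part [g n], whose integral increases to
    that of [W]. *)
Lemma tail_vanishes nu c (eta : R) : moment p nu -> 0 < eta ->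
  exists N0 : nat, forall m : nat, (N0 <= m)%N -> (\int[nu]_x (tail m%:R (c - x))%:E <= eta%:E)%E.
Proof.
move=> mom eta0.
pose W (x : R) : R := 1 + `|c - x| ^+ p.
pose g (n : nat) (x : measurableTypeR R) : R := W x * (`|c - x| <= n%:R)%R%:R.
have W0 x : 0 <= W x by rewrite addr_ge0// exprn_ge0.
have mW : measurable_fun [set: measurableTypeR R] (W : measurableTypeR R -> R).
  apply: measurable_funD => //.
  apply: (@measurableT_comp _ _ _ _ _ _ ((fun y => `|y| ^+ p) : measurableTypeR R -> R)).
    exact: measurable_absX.
  exact: measurable_funB.
have g0 n x : 0 <= g n x by rewrite mulr_ge0.
have tE n x : tail n%:R (c - x) = W x - g n x.
  by rewrite /tail /g -/(W x) ltNge; case: (_ <= _); rewrite /= ?mulr0 ?mulr1 ?subrr ?subr0.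
have mg n : measurable_fun [set: measurableTypeR R] (fun x => (g n x)%:E).
  have -> : (fun x : measurableTypeR R => (g n x)%:E) = (fun x => (W x - tail n%:R (c - x))%:E).
    by apply/funext => x; rewrite tE subKr.
  by apply/measurable_EFinP; apply: measurable_funB => //; exact: measurable_tail.
have [F WF] : exists F : R, (\int[nu]_x (W x)%:E = F%:E)%E.
  have Wint : nu.-integrable setT (fun x : measurableTypeR R => (W x)%:E).
    apply: (le_integrable _ _ _ (integrable_dominator 1 c mom)) => //.
      exact/measurable_EFinP.
    move=> x _ /=; rewrite lee_fin (ger0_norm (W0 _)); apply: (le_trans _ (ler_norm _)).
    rewrite /dominator mul1r lerD2l.
    apply: (le_trans _ (exprD_le p (normr_ge0 _) (normr_ge0 _))).
    by apply: lerXn2r; rewrite ?nnegrE ?addr_ge0//; exact: ler_normB.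
  by exists (fine (\int[nu]_x (W x)%:E)%E); rewrite fineK//; exact: integrable_fin_num.
have [N0 HN0] : exists N0, forall n, (N0 <= n)%N -> ((F - eta)%:E < \int[nu]_x (g n x)%:E)%E.
  apply: (monotone_integral_gt (g := fun n (x : measurableTypeR R) => (g n x)%:E)
    (f := fun x : measurableTypeR R => (W x)%:E)) => //.
  - move=> x n m nm; rewrite lee_fin ler_wpM2l// ler_nat.
    by case: (leP `|c - x| n%:R) => // xn; rewrite (le_trans xn)// ler_nat.
  - move=> x; apply: cvg_near_cst.
    exists (Num.truncn `|c - x|).+1 => // n /= nN.
    rewrite /g; have -> : `|c - x| <= n%:R; last by rewrite mulr1.
    by apply: ltW; apply: (lt_le_trans (truncnS_gt _)); rewrite ler_nat.
  - by rewrite WF lte_fin ltrBlDr ltrDl.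
exists N0 => m /HN0 Hm.
have : (\int[nu]_x (tail m%:R (c - x))%:E + \int[nu]_x (g m x)%:E = F%:E)%E.
  rewrite -ge0_integralD//; first last.
  - by move=> x _; rewrite lee_fin.
  - by apply/measurable_EFinP; exact: measurable_tail.
  - by move=> x _; rewrite lee_fin tail_ge0.
  by rewrite -WF; apply: eq_integral => x _; rewrite -EFinD tE subrK.
move: Hm; have : (0 <= \int[nu]_x (tail m%:R (c - x))%:E)%E.
  by apply: integral_ge0 => x _; rewrite lee_fin tail_ge0.
case: (\int[nu]_x (tail _ _)%:E)%E => [u| |]; case: (\int[nu]_x (g _ _)%:E)%E => [w| |] //=.
by rewrite !lee_fin lte_fin => u0 Fw [] uw; lra.
Qed.

End clipping.

Lemma mean_combination (R : realType) (nu : probR R) (k k' r s : R) (f g : R -> R) :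
  has_mean nu -> lip k f -> lip k' g ->
  (\int[nu]_x (r - f x + s * g x)%:E = (r - \int[nu]_x f x + s * \int[nu]_x g x)%:E)%E.
Proof.
move=> hm lf lg.
have i0 : nu.-integrable setT (fun _ : measurableTypeR R => r%:E) by exact: integrable_cst_prob.
have i1 := lip_integrable hm lf; have i2 := lip_integrable hm lg.
under eq_integral do rewrite EFinD EFinB EFinM.
rewrite integralD//; first last.
- exact: integrableZl.
- exact: integrableB.
rewrite integralB// integralZl// integral_cst_prob.
by rewrite (expectation_fin hm lf) (expectation_fin hm lg) -EFinB -EFinM -EFinD.
Qed.

Section clipped_energy.
Context {R : realType}.
Variables (V : R -> R) (p : nat) (a C : R).
Hypotheses (p2 : (2 <= p)%N) (gV : growth V p a C).
Variables (phi nu : probR R) (eps d c : R).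
Hypotheses (eps0 : 0 < eps) (eps1 : eps <= 1) (d0 : 0 < d) (d1 : d <= 1)
  (phi_carrier : phi `[0, eps]%classic = 1%E)
  (phi_kap : forall D y, 1 <= D -> (\int[phi]_s kap D (y - s) <= (kapd D d y + eps)%:E)%E)
  (mom : moment p nu).

Lemma measurable_clip_reflect m : measurable_fun [set: measurableTypeR R]
  ((fun x => clip m (c - x)) : measurableTypeR R -> R).
Proof. by apply: lip_measurable; apply: lip_reflect; exact: clip_lip. Qed.

(** The noise is subtracted, so that for [x >= 0] and [- m%:R <= c] the result stays to the left of
    [c], where the cell of the largest eigenvalue begins. *)
Definition clipped (m : nat) : probR R := smear (measurable_clip_reflect m%:R) nu phi.

(** Clipped points are at distance at most [2 * m%:R], so [kapd] is [ln D - lell d] there. As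
    [lell d] has Lipschitz constant [d^-1], clipping both points costs [2 * d^-1 * eta]; smoothing
    costs [2 * eps]. *)
Lemma clipped_kap (m : nat) (eta : R) :
  (\int[nu]_x (tail p m%:R (c - x))%:E <= eta%:E)%E ->
  (kap_energy (2 * m%:R + 1) (clipped m) <=
    (ln (2 * m%:R + 1) - log_energy d nu + 2 * d^-1 * eta + 2 * eps)%:E)%E.
Proof.
move=> tl; set D : R := 2 * m%:R + 1.
have m0 : 0 <= m%:R :> R by [].
have D1 : 1 <= D by rewrite /D; lra.
have hm := moment_mean p2 mom.
pose e (x : R) : R := clip_error m%:R (c - x).
have le : lip 2 e by apply: lip_reflect; exact: clip_error_lip.
have eE : (\int[nu]_x (e x)%:E <= eta%:E)%E.
  apply: le_trans tl; apply: le_integral_fun => x _; rewrite lee_fin.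
  exact: clip_error_le_tail.
rewrite (expectation_fin hm le) lee_fin in eE.
have di : 0 < d^-1 by rewrite invr_gt0.
have := @kap_energy_smear R D d eps _ (measurable_clip_reflect m%:R) nu phi D1 d0
  (ltW eps0) (fun y => phi_kap y D1).
move/le_trans; apply.
pose T (x : R) : R := clip m%:R (c - x).
have pw (x y : R) : kapd D d (T x - T y) + 2 * eps <=
    (ln D + 2 * eps + d^-1 * e x) - lell d (x - y) + d^-1 * e y.
  have -> : kapd D d (T x - T y) = ln D - lell d (T x - T y).
    rewrite /kapd /lell (max_idPr _)// subr_ge0 ler_ln_pos// ?lt_max ?d0 ?orbT//.
    rewrite ge_max (le_trans d1 D1) andbT (le_trans (ler_normB _ _))//.
    have := clip_norm_le (c - x) m0; have := clip_norm_le (c - y) m0.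
    by rewrite -/(T x) -/(T y) /D; lra.
  have := lell_lip d0 (T x - T y) ((c - x) - (c - y)).
  have -> : (c - x) - (c - y) = - (x - y) by ring.
  rewrite lellN => H.
  have H2 : `|T x - T y - - (x - y)| <= e x + e y.
    have -> : T x - T y - - (x - y) = (T x - (c - x)) - (T y - (c - y)) by ring.
    exact: ler_normB.
  have := le_trans H (ler_wpM2l (ltW di) H2); rewrite ler_norml => /andP[+ _].
  by rewrite mulrDr; lra.
pose L (x : R) : R := \int[nu]_y lell d (x - y).
apply: (@le_trans _ _ (\int[nu]_x \int[nu]_y
    ((ln D + 2 * eps + d^-1 * e x) - lell d (x - y) + d^-1 * e y)%:E)%E).
  by apply: le_integral_fun => x _; apply: le_integral_fun => y _; rewrite lee_fin; exact: pw.
under eq_integral => x _ do rewrite (mean_combination _ _ hm (lip_lell2 x d0) le).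
rewrite (eq_integral (fun x : measurableTypeR R => (ln D + 2 * eps + d^-1 * \int[nu]_y e y
    - L x + d^-1 * e x)%:E)) => [|x _]; last by congr EFin; rewrite /L; ring.
rewrite (mean_combination _ _ hm (lip_lell_mean d0 hm) le) lee_fin /log_energy.
have := ler_wpM2l (ltW di) eE; move: (d^-1) => u.
move: (Rintegral _ _ _) (Rintegral _ _ _) => v w; lra.
Qed.

Definition shifted_moment : R := C * \int[nu]_x (1 + `|c - x| ^+ p).

Let W (x : R) : R := 1 + `|c - x| ^+ p.

Let W_ge0 x : 0 <= W x.
Proof. by rewrite addr_ge0// exprn_ge0. Qed.

Let W_integrable : nu.-integrable setT (fun x : measurableTypeR R => (W x)%:E).
Proof.
apply: (le_integrable _ _ _ (integrable_dominator 1 c mom)) => //.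
  apply/measurable_EFinP; apply: measurable_funD => //.
  apply: (@measurableT_comp _ _ _ _ _ _ ((fun y => `|y| ^+ p) : measurableTypeR R -> R)).
    exact: measurable_absX.
  exact: measurable_funB.
move=> x _ /=; rewrite lee_fin (ger0_norm (W_ge0 _)); apply: (le_trans _ (ler_norm _)).
rewrite /dominator mul1r lerD2l.
apply: (le_trans _ (exprD_le p (normr_ge0 _) (normr_ge0 _))).
by apply: lerXn2r; rewrite ?nnegrE ?addr_ge0//; exact: ler_normB.
Qed.

Lemma measurable_clip_le m b :
  measurable [set x : measurableTypeR R | clip m (c - x) <= b].
Proof.
rewrite (_ : [set _ | _] = (fun x => clip m (c - x)) @^-1` `]-oo, b]%classic).
  by rewrite -[X in measurable X]setTI; exact: (measurable_clip_reflect m).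
by apply/seteqP; split => x /=; rewrite in_itv.
Qed.

(** The left end [- m%:R - 2] leaves room for noise of size at most 1 and is never attained, as the
    half-open cells require. *)
Lemma clipped_carrier (m : nat) b : nu [set x | clip m%:R (c - x) <= b] = 1%E ->
  clipped m `](- m%:R - 2), b]%classic = 1%E.
Proof.
move=> nub.
pose A : set (measurableTypeR R) := [set x : measurableTypeR R | clip m%:R (c - x) <= b].
have mA : measurable A by exact: measurable_clip_le.
apply: (@smear_carrier _ _ _ nu phi A (`[0, eps]%classic : set (measurableTypeR R))) => //.
move=> x s /= xb; rewrite !in_itv/= => /andP[s0 s1].
have := clip_norm_le (c - x) (ler0n R m).
rewrite ler_norml => /andP[h _].
have s2 : s <= 1 by exact: le_trans eps1.
by move: xb; rewrite /A /= => xb; apply/andP; split; lra.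
Qed.

Lemma clipped_moment (m : nat) : moment p (clipped m).
Proof.
pose b : R := m%:R + 2.
have cb : clipped m `[(- b), b]%classic = 1%E.
  apply: (@smear_carrier _ _ _ nu phi setT (`[0, eps]%classic : set (measurableTypeR R))) => //.
    by rewrite probability_setT.
  move=> x s _ /=; rewrite !in_itv/= => /andP[s0 s1].
  have := clip_norm_le (c - x) (ler0n R m); rewrite ler_norml => /andP[h h'].
  have s2 : s <= 1 by exact: le_trans eps1.
  by rewrite /b; apply/andP; split; lra.
apply: (@le_lt_trans _ _ (\int[clipped m]_x (b ^+ p)%:E)%E); last first.
  by rewrite integral_cst_prob ltry.
have b0 : 0 <= b by rewrite /b addr_ge0.
apply: (le_integral_carrier _ cb) => //.
- by apply/measurable_EFinP; exact: measurable_absX.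
- by move=> _; rewrite lee_fin exprn_ge0.
- move=> x /=; rewrite in_itv/= => h; rewrite lee_fin.
  by apply: lerXn2r; rewrite ?nnegrE// ler_norml.
Qed.

(** Clipping changes [V] only where [|c - x| > m%:R], by at most [2 * C * (1 + |c - x| ^+ p)]; the
    increment clause of [growth] bounds the effect of the noise, and clipping does not increase
    [|c - x|]. *)
Lemma clipped_potential (m : nat) (eta : R) :
  (\int[nu]_x (tail p m%:R (c - x))%:E <= eta%:E)%E ->
  \int[clipped m]_x V x <=
    \int[nu]_x V (c - x) + 2 * C * eta + eps * shifted_moment.
Proof.
move=> tl; case: (gV) => a0 C0 _ Vhi Vinc.
have VC0 y : 0 <= V y + C by have := growth_ge gV y; lra.
have t0 x : 0 <= 2 * C * tail p m%:R (c - x) by rewrite !mulr_ge0 ?tail_ge0 ?(ltW C0).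
have w0 x : 0 <= eps * C * W x by rewrite mulr_ge0 ?mulr_ge0 ?(ltW C0) ?(ltW eps0).
have mV : measurable_fun [set: measurableTypeR R] (V : measurableTypeR R -> R).
  exact: growth_measurable gV.
have mVC : measurable_fun [set: measurableTypeR R] (fun y : measurableTypeR R => (V y + C)%:E).
  by apply/measurable_EFinP; exact: measurable_funD.
have mVr : measurable_fun [set: measurableTypeR R] (fun x : measurableTypeR R => (V (c - x) + C)%:E).
  apply/measurable_EFinP; apply: measurable_funD => //.
  exact: measurable_V_reflect gV c.
have mW : measurable_fun [set: measurableTypeR R] (fun x : measurableTypeR R => (W x)%:E).
  by have /integrableP[] := W_integrable.
have mT : measurable_fun [set: measurableTypeR R] (fun x : measurableTypeR R => (tail p m%:R (c - x))%:E).
  by apply/measurable_EFinP; exact: measurable_tail.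
suff H : (\int[clipped m]_x (V x + C)%:E <=
    (\int[nu]_x V (c - x) + C + 2 * C * eta + eps * shifted_moment)%:E)%E.
  by move: H; rewrite (expectation_VC gV (clipped_moment m)) lee_fin; lra.
rewrite ge0_integral_smear//.
apply: (@le_trans _ _ (\int[nu]_x ((V (c - x) + C)%:E +
    (2 * C)%:E * (tail p m%:R (c - x))%:E + (eps * C)%:E * (W x)%:E))%E).
  apply: le_integral_fun => x _.
  set r := (_ + _ + _)%E.
  have r0 : (0 <= r)%E.
    by rewrite /r -!EFinM -!EFinD lee_fin addr_ge0// addr_ge0.
  rewrite -(integral_cst_prob phi r).
  apply: (le_integral_carrier _ phi_carrier) => //.
  - apply: (@measurableT_comp _ _ _ _ _ _ (fun y : measurableTypeR R => (V y + C)%:E)) => //.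
    exact: measurable_funB.
  - by move=> s; rewrite lee_fin.
  - move=> s /=; rewrite in_itv/= => /andP[s0 s1].
    rewrite /r -!EFinM -!EFinD lee_fin.
    have ns : `|s| = s by rewrite ger0_norm.
    pose y := c - x; pose t := clip m%:R y; rewrite -/y -/t.
    have ty : `|t| <= `|y| by exact: norm_clip_le.
    have Wt : 1 + `|t| ^+ p <= W x by rewrite lerD2l; apply: lerXn2r; rewrite ?nnegrE.
    have := Vinc t s; rewrite ns => /(_ (le_trans s1 eps1)); rewrite ler_norml => /andP[_ H1].
    have H2 : s * (C * (1 + `|t| ^+ p)) <= eps * (C * W x).
      apply: ler_pM => //; first by rewrite mulr_ge0 ?addr_ge0 ?exprn_ge0// ltW.
      by rewrite ler_pM2l.
    have H3 : V t <= V y + 2 * C * tail p m%:R y.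
      have [ym|my] := leP `|y| m%:R.
        by rewrite /t clip_id// lerDl mulr_ge0 ?tail_ge0// mulr_ge0// ltW.
      have := Vhi t; have := Vhi y; rewrite !ler_norml => /andP[h1 _] /andP[_ h2].
      rewrite /tail my mulr1; have := ler_wpM2l (ltW C0) Wt; rewrite /W -/y; lra.
    lra.
rewrite ge0_integralD//; first last.
- exact: measurable_funeM.
- by move=> x _; rewrite -EFinM lee_fin.
- by apply: emeasurable_funD => //; exact: measurable_funeM.
- by move=> x _; rewrite -EFinM -EFinD lee_fin addr_ge0.
rewrite ge0_integralD//; first last.
- exact: measurable_funeM.
- by move=> x _; rewrite -EFinM lee_fin.
- by move=> x _; rewrite lee_fin.
rewrite !ge0_integralZl//; first last.
- by rewrite lee_fin mulr_ge0// ltW.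
- by move=> x _; rewrite lee_fin tail_ge0.
- by rewrite lee_fin mulr_ge0// ltW.
- by move=> x _; rewrite lee_fin.
rewrite EFinD; apply: leeD; last first.
  rewrite /shifted_moment mulrA [leRHS]EFinM; apply: lee_wpmul2l.
    by rewrite lee_fin mulr_ge0// ltW.
  by rewrite -[leLHS]fineK//; exact: integrable_fin_num.
rewrite EFinD; apply: leeD; last first.
  by rewrite [leRHS]EFinM; apply: lee_wpmul2l => //; rewrite lee_fin mulr_ge0// ltW.
under eq_integral do rewrite EFinD.
rewrite integralD//; first last.
- exact: integrable_cst_prob.
- exact (integrable_V_reflect gV c mom).
by rewrite integral_cst_prob (expectation_V_reflect gV c mom).
Qed.

End clipped_energy.

Section box_tuples.
Context {R : realType}.
Variables (a c h : R) (n : nat) (q : nat -> R).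
Hypothesis q_in : forall k, (k <= n.+1)%N -> a <= q k <= c.
Variable l : n.+2.-tuple R.
Hypothesis lbox : forall i : 'I_n.+2, cell c h n q i (tnth l i).

Let lcell k : (k < n.+1)%N -> q k < nth 0 l k <= q k.+1.
Proof.
move=> kn; have := lbox (Ordinal (ltnW kn : (k < n.+2)%N)).
by rewrite /cell /= kn (tnth_nth 0)/= in_itv.
Qed.

Lemma box_top : c <= nth 0 l n.+1 <= c + h.
Proof.
have := lbox ord_max; rewrite /cell /= ltnn (tnth_nth 0)/=.
by rewrite in_itv.
Qed.

(** The cells follow each other from left to right and the top cell lies beyond them, so the points
    of the box are already ordered. *)
Lemma box_sort : sort <=%R l = l.
Proof.
apply: sorted_sort; first exact: le_trans.
apply/(sortedP 0) => i; rewrite size_tuple ltnS => iN.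
have /andP[_ h1] := lcell iN; apply: (le_trans h1).
have [i1|] := ltnP i.+1 n.+1; first by have /andP[/ltW] := lcell i1.
rewrite leq_eqVlt ltnNge iN orbF eqSS => /eqP ni; rewrite -ni.
have /andP[_ h2] := q_in (leqnn n.+1); apply: (le_trans h2).
by have /andP[] := box_top.
Qed.

(** [y] lies in the same cell as the [k]-th point and the top is within [h] of [c], so the gap is
    close to [c - y]. *)
Lemma box_gap k y : (k < n.+1)%N -> q k < y <= q k.+1 ->
  `|y + gap l k - c| <= h + (q k.+1 - q k).
Proof.
move=> kn /andP[y1 y2]; rewrite /gap box_sort.
have /andP[t1 t2] := box_top; have /andP[s1 s2] := lcell kn.
by rewrite ler_norml; apply/andP; split; lra.
Qed.

End box_tuples.

Section step_coupling.
Context {R : realType}.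
Variables (p : nat) (p2 : (2 <= p)%N) (phi nu : probR R) (eps c h a : R) (m n : nat)
  (q : nat -> R).
Hypotheses (eps0 : 0 < eps) (eps1 : eps <= 1) (h0 : 0 < h)
  (phi_carrier : phi `[0, eps]%classic = 1%E)
  (q_in : forall k, (k <= n.+1)%N -> a <= q k <= c)
  (q_lt : forall k, (k < n.+1)%N -> q k < q k.+1)
  (clipped_q : forall k, (k < n.+1)%N ->
    clipped phi nu c m `]q k, q k.+1]%classic = (n.+1%:R^-1)%:E).

Let Y (z : measurableTypeR R * measurableTypeR R) : measurableTypeR R :=
  clip m%:R (c - z.1) - z.2.

Let I (k : nat) : set (measurableTypeR R) := `]q k, q k.+1]%classic.

Let mI k : measurable (I k).
Proof. exact: measurable_itv. Qed.

(** With [v] the sequence of gaps, this map transports the clipped and smoothed law onto the measure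
    of the gaps. *)
Definition step (v : nat -> R) (y : measurableTypeR R) : measurableTypeR R :=
  \sum_(k < n.+1) v k * \1_(I k) y.

Lemma measurable_step v : measurable_fun setT (step v).
Proof.
by apply: measurable_sum => k; exact: measurable_funM.
Qed.

Lemma step_cell v k y : (k < n.+1)%N -> I k y -> step v y = v k.
Proof.
move=> kn Iy; rewrite /step (bigD1 (Ordinal kn))//= indicE mem_set// mulr1.
rewrite big1 ?addr0// => j; rewrite -val_eqE/= => jk.
rewrite indicE memNset ?mulr0//.
move: Iy; rewrite /I /= !in_itv/= => /andP[ky yk] /andP[jy yj].
have qle i i' : (i <= i')%N -> (i' <= n.+1)%N -> q i <= q i'.
  elim: i' => [|i' IH]; first by rewrite leqn0 => /eqP ->.
  rewrite leq_eqVlt => /orP[/eqP -> //|ii'] i'n.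
  by apply: (le_trans (IH ii' (ltnW i'n))); apply: ltW; exact: q_lt.
move: jk; rewrite neq_ltn => /orP[jk|kj].
  by have := lt_le_trans ky (le_trans yj (qle _ _ jk (ltnW kn))); rewrite ltxx.
by have := lt_le_trans jy (le_trans yk (qle _ _ kj (ltnW (ltn_ord j)))); rewrite ltxx.
Qed.

Lemma cells_cover y : q 0%N < y <= q n.+1 -> exists2 k, (k < n.+1)%N & I k y.
Proof.
elim: n.+1 => [|j IH] /andP[qy yq]; first by have := lt_le_trans qy yq; rewrite ltxx.
have [yj|jy] := leP y (q j); first by have [|k kj Ik] := IH _; [rewrite qy|exists k; first exact: ltnW].
by exists j => //; rewrite /I /= in_itv/= jy.
Qed.

Let clip' : probR R := clipped phi nu c m.

Let U : set (measurableTypeR R) := `]q 0%N, q n.+1]%classic.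

Let qle i i' : (i <= i')%N -> (i' <= n.+1)%N -> q i <= q i'.
Proof.
elim: i' => [|i' IH]; first by rewrite leqn0 => /eqP ->.
rewrite leq_eqVlt => /orP[/eqP -> //|ii'] i'n.
by apply: (le_trans (IH ii' (ltnW i'n))); apply: ltW; exact: q_lt.
Qed.

Lemma clipped_step_ge (A : set (measurableTypeR R)) (g : nat -> R) : measurable A ->
  (forall k, (k < n.+1)%N -> 0 <= g k) ->
  (forall k y, (k < n.+1)%N -> I k y -> g k <= \1_A y) ->
  ((n.+1%:R^-1 * \sum_(k < n.+1) g k)%:E <= clip' A)%E.
Proof.
move=> mA g0 gA.
have -> : clip' A = (\int[clip']_y (\1_A y)%:E)%E by rewrite integral_indic// setIT.
have mA1 : measurable_fun [set: measurableTypeR R] (fun y : measurableTypeR R => (\1_A y : R)%:E).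
  by apply/measurable_EFinP; exact: measurable_indic.
have A0 (y : measurableTypeR R) : (0 <= (\1_A y : R)%:E)%E by rewrite lee_fin.
have := @sum_integral_cuts R clip' q _ n.+1 (fun k kn => ltW (q_lt kn)) mA1 A0.
apply: le_trans.
rewrite mulr_sumr -sumEFin; apply: lee_sum => k _.
apply: (@le_trans _ _ (\int[clip']_(y in I k) (g k)%:E)%E).
  rewrite integral_cst// mulrC EFinM lee_wpmul2l ?lee_fin ?g0//.
  by rewrite le_eqVlt; apply/orP; left; apply/eqP/esym; exact: clipped_q.
by apply: le_integral_fun => y Iy; rewrite lee_fin; exact: gA.
Qed.

Lemma clipped_cuts : clip' U = 1%E.
Proof.
have mU : measurable U by exact: measurable_itv.
apply/eqP; rewrite eq_le probability_le1//=.
apply: (le_trans _ (@clipped_step_ge U (fun=> 1) mU _ _)) => //.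
  by rewrite sum_const_ord mulr1 mulVf.
move=> k y kn; rewrite /I /= in_itv/= => /andP[qy yq].
rewrite indicE mem_set// /U /= in_itv/=.
rewrite (le_lt_trans (qle (leq0n k) (ltnW kn)) qy)/=.
exact: le_trans yq (qle kn (leqnn _)).
Qed.

Variable l : n.+2.-tuple R.

(** Every cell has the mass [n.+1%:R^-1] of an atom, which gives one inequality for every [A].
    Applied to the complement it gives the other, both sides being probabilities. *)
Lemma law_step_dos (A : set (measurableTypeR R)) : measurable A ->
  clip' (step (gap l) @^-1` A) = dos_measure l A.
Proof.
have H (D : set (measurableTypeR R)) : measurable D ->
    (dos_measure l D <= clip' (step (gap l) @^-1` D))%E.
  move=> mD; rewrite dos_measureE sumEFin -EFinM.
  apply: (@clipped_step_ge _ (fun k => \1_D (gap l k))) => //.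
    by rewrite -[X in measurable X]setTI; exact: (measurable_step (gap l)).
  move=> k y kn Iy; rewrite !indicE ler_nat.
  by case: (boolP (gap l k \in D)) => //; rewrite inE => Dk; rewrite mem_set//= (step_cell _ kn).
move=> mA; apply/eqP; rewrite eq_le H// andbT.
have mS : measurable (step (gap l) @^-1` A).
  by rewrite -[X in measurable X]setTI; exact: (measurable_step (gap l)).
have : (1 - dos_measure l A <= 1 - clip' (step (gap l) @^-1` A))%E.
  by rewrite -(probability_setC _ mA) -(probability_setC _ mS); exact: H (measurableC mA).
have f1 : clip' (step (gap l) @^-1` A) \is a fin_num by exact: fin_num_measure.
have f2 : dos_measure l A \is a fin_num by exact: fin_num_measure.
move: f1 f2; case: (clip' _) => [u| |] //; case: (dos_measure l A) => [v| |] // _ _.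
by rewrite -!EFinB !lee_fin; lra.
Qed.

Hypothesis lbox : forall i : 'I_n.+2, cell c h n q i (tnth l i).

(** [x] is coupled with the gap of the cell that receives its clipped and smoothed reflection. Their
    distance is at most the clipping error plus [eps], [h] and the length of the cell; using
    [exprD_le] twice on these four terms gives [4 ^+ p]. *)
Lemma wasserstein_step_le (eta e : R) : 0 <= e ->
  (\int[nu]_x (tail p m%:R (c - x))%:E <= eta%:E)%E ->
  4 ^+ p * (eta + eps ^+ p + h ^+ p + n.+1%:R^-1 * (c - a) ^+ p) <= e ^+ p ->
  (wasserstein p nu (dos l p) <= e%:E)%E.
Proof.
move=> e0 tl He.
have mY : measurable_fun setT Y := measurable_smear_map (measurable_clip_reflect c m%:R).
have mZ : measurable_fun setT (fun z => (z.1, step (gap l) (Y z)) :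
    measurableTypeR R * measurableTypeR R).
  apply: measurable_fun_pair; first exact: measurable_fst.
  by apply: measurableT_comp mY; exact: measurable_step.
pose pi := law (nu \x phi)%E mZ.
have cpi : coupling nu (dos l p) pi.
  split=> A mA.
    rewrite /pi lawE (_ : _ @^-1` _ = A `*` setT).
      transitivity (nu A * phi setT)%E; first exact: product_measure1E.
      by rewrite probability_setT mule1.
    by apply/seteqP; split => z /= [].
  rewrite /pi lawE /= -(law_step_dos mA) /clip' /clipped /smear lawE.
  by congr (_ _); apply/seteqP; split => z //= [].
have p0 : (0 < p)%N by exact: ltnW.
have cost : (\int[pi]_z (`|z.1 - z.2| ^+ p)%:E <= (e ^+ p)%:E)%E.
  pose E (x : R) : R := clip_error m%:R (c - x).
  pose w (k : nat) : R := (q k.+1 - q k) ^+ p.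
  pose b (z : measurableTypeR R * measurableTypeR R) : \bar R :=
    ((4 ^+ p)%:E * ((E z.1 ^+ p + (eps ^+ p + h ^+ p))%:E + (step w (Y z))%:E))%E.
  have E0 x : 0 <= E x by exact: normr_ge0.
  have w0 k : (k < n.+1)%N -> 0 <= w k.
    by move=> kn; rewrite exprn_ge0// subr_ge0 ltW// q_lt.
  have st0 y : 0 <= step w y.
    by apply: sumr_ge0 => k _; rewrite mulr_ge0// w0.
  have mE : measurable_fun [set: measurableTypeR R]
      (fun x : measurableTypeR R => E x ^+ p + (eps ^+ p + h ^+ p)).
    apply: measurable_funD => //; apply: measurable_funX.
    by apply: lip_measurable; apply: lip_reflect; exact: clip_error_lip.
  have mb : measurable_fun setT b.
    apply: measurable_funeM; apply: emeasurable_funD.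
      by apply/measurable_EFinP; apply: (measurableT_comp mE).
    apply/measurable_EFinP; apply: (measurableT_comp _ mY); exact: measurable_step.
  have b0 z : (0 <= b z)%E.
    rewrite /b -EFinD -EFinM lee_fin mulr_ge0 ?exprn_ge0// addr_ge0// addr_ge0 ?exprn_ge0//.
    by rewrite addr_ge0 ?exprn_ge0// ltW.
  apply: (@le_trans _ _ (\int[(nu \x phi)%E]_z b z)%E).
    rewrite ge0_integral_law//; first last.
    - apply/measurable_EFinP; apply: measurable_funX; apply: measurableT_comp => //.
      exact: measurable_funB.
    have aeU : {ae (nu \x phi)%E, forall z, U (Y z)}.
      apply: ae_carrier; last exact: clipped_cuts.
      by rewrite -[X in measurable X]setTI; apply: mY => //; exact: measurable_itv.
    have aeS : {ae (nu \x phi)%E, forall z : measurableTypeR R * measurableTypeR R, 0 <= z.2 <= eps}.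
      pose S : set (measurableTypeR R) := `[0, eps]%classic.
      have mS0 : measurable S by exact: measurable_itv.
      have mS : measurable ([set: measurableTypeR R] `*` S) by exact: measurableX.
      have PS : (nu \x phi)%E ([set: measurableTypeR R] `*` S) = 1%E.
        transitivity (nu setT * phi S)%E; first exact: product_measure1E.
        by rewrite probability_setT mul1e.
      by apply: filterS (ae_carrier mS PS) => z [_]; rewrite /S /= in_itv.
    apply: ae_ge0_le_integral => //.
      apply/measurable_EFinP; apply: measurable_funX; apply: measurableT_comp => //.
      apply: measurable_funB; first exact: measurable_fst.
      by apply: measurableT_comp mY; exact: measurable_step.
    apply: filterS2 aeU aeS => -[x s] /= UY /andP[s0 s1] _.
    have [k kn Ik] : exists2 k, (k < n.+1)%N & I k (Y (x, s)).
      by apply: cells_cover; move: UY; rewrite /U /= in_itv.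
    rewrite /b !(step_cell _ kn Ik) -EFinD -EFinM lee_fin/=.
    have := box_gap q_in lbox kn (y := Y (x, s)).
    move: Ik; rewrite /I /= in_itv/= => Ik /(_ Ik) G.
    set g := gap l k in G *; set v := q k.+1 - q k in G *.
    have v0 : 0 <= v by rewrite subr_ge0 ltW// q_lt.
    have D : `|x - g| <= (E x + eps) + (h + v).
      have -> : x - g = (clip m%:R (c - x) - (c - x)) - s - (Y (x, s) + g - c).
        by rewrite /Y /=; ring.
      apply: (le_trans (ler_normB _ _)); apply: lerD G.
      apply: (le_trans (ler_normB _ _)); apply: lerD => //.
      by rewrite ger0_norm.
    have h0' := ltW h0; have e0' := ltW eps0.
    apply: (@le_trans _ _ (((E x + eps) + (h + v)) ^+ p)).
      apply: lerXn2r => //; rewrite nnegrE.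
      exact: addr_ge0 (addr_ge0 (E0 x) e0') (addr_ge0 h0' v0).
    have H1 := exprD_le p (addr_ge0 (E0 x) e0') (addr_ge0 h0' v0).
    have H2 := exprD_le p (E0 x) e0'; have H3 := exprD_le p h0' v0.
    apply: (le_trans H1); have -> : 4 ^+ p = 2 ^+ p * 2 ^+ p :> R.
      by rewrite -exprMn; congr (_ ^+ _); ring.
    rewrite -mulrA ler_wpM2l ?exprn_ge0//.
    by rewrite /w -/v; lra.
  rewrite /b ge0_integralZl//; first last.
  - by move=> z _; rewrite -EFinD lee_fin addr_ge0// addr_ge0 ?exprn_ge0// addr_ge0 ?exprn_ge0// ltW.
  - apply: emeasurable_funD.
      by apply/measurable_EFinP; apply: (measurableT_comp mE).
    apply/measurable_EFinP; apply: (measurableT_comp _ mY); exact: measurable_step.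
  apply: (@le_trans _ _ ((4 ^+ p)%:E * (eta + eps ^+ p + h ^+ p + n.+1%:R^-1 * (c - a) ^+ p)%:E)%E); last first.
    by rewrite -EFinM lee_fin.
  apply: lee_wpmul2l; first by rewrite lee_fin exprn_ge0.
  rewrite ge0_integralD//; first last.
  - apply/measurable_EFinP; apply: (measurableT_comp _ mY); exact: measurable_step.
  - by move=> z _; rewrite lee_fin.
  - by apply/measurable_EFinP; apply: (measurableT_comp mE).
  - by move=> z _; rewrite lee_fin addr_ge0 ?exprn_ge0// addr_ge0 ?exprn_ge0// ltW.
  rewrite EFinD; apply: leeD.
    rewrite (@fubini_tonelli1 _ _ _ _ _ nu phi (fun z : measurableTypeR R * measurableTypeR R =>
      (E z.1 ^+ p + (eps ^+ p + h ^+ p))%:E)).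
    - rewrite (eq_integral (fun x : measurableTypeR R => (E x ^+ p)%:E +
        (eps ^+ p + h ^+ p)%:E)%E) => [|x _]; last by rewrite /fubini_F/= integral_cst_prob EFinD.
      rewrite ge0_integralD//; first last.
      + by move=> x _; rewrite lee_fin addr_ge0 ?exprn_ge0// ltW.
      + apply/measurable_EFinP; apply: measurable_funX.
        by apply: lip_measurable; apply: lip_reflect; exact: clip_error_lip.
      + by move=> x _; rewrite lee_fin exprn_ge0.
      rewrite integral_cst_prob.
      apply: (@le_trans _ _ (eta%:E + (eps ^+ p + h ^+ p)%:E)%E); last first.
        by rewrite -EFinD lee_fin addrA.
      apply: leeD => //.
      apply: le_trans tl; apply: le_integral_fun => x _; rewrite lee_fin.
      exact: clip_error_expr_le_tail.
    - by apply/measurable_EFinP; apply: (measurableT_comp mE).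
    - by move=> z; rewrite lee_fin addr_ge0 ?exprn_ge0// addr_ge0 ?exprn_ge0// ltW.
  have -> : (\int[(nu \x phi)%E]_z (step w (Y z))%:E = \int[clip']_y (step w y)%:E)%E.
    rewrite ge0_integral_law//.
    by apply/measurable_EFinP; exact: measurable_step.
  under eq_integral => y _ do rewrite /step -sumEFin.
  rewrite ge0_integral_sum//; first last.
  - by move=> k y _; rewrite lee_fin mulr_ge0// w0.
  - by move=> k; apply/measurable_EFinP; exact: measurable_funM.
  rewrite (eq_bigr (fun k : 'I_n.+1 => (w k * n.+1%:R^-1)%:E)) => [|k _]; last first.
    under eq_integral do rewrite EFinM.
    rewrite ge0_integralZl//; first last.
    - by rewrite lee_fin w0.
    - by apply/measurable_EFinP.
    rewrite integral_indic// setIT EFinM; congr (_ * _)%E.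
    exact: clipped_q.
  rewrite sumEFin lee_fin -mulr_suml mulrC ler_wpM2l//.
  have ca k : (k < n.+1)%N -> 0 <= q k.+1 - q k <= c - a.
    move=> kn; have /andP[? ?] := q_in (ltnW kn); have /andP[? ?] := q_in kn.
    by have := q_lt kn => ?; apply/andP; split; lra.
  (* One factor of each [p]-th power is kept and the others are bounded by [c - a]; the lengths then
     telescope, so that long cells cost little on average. *)
  apply: (@le_trans _ _ (\sum_(k < n.+1) (c - a) ^+ p.-1 * (q k.+1 - q k))).
    apply: ler_sum => k _; rewrite /w -{1}(prednK p0) exprSr.
    have /andP[k0 kc] := ca k (ltn_ord k).
    by rewrite ler_wpM2r// lerXn2r// ?nnegrE// (le_trans k0).
  have /andP[? ?] := q_in (leq0n n.+1); have /andP[? ?] := q_in (leqnn n.+1).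
  rewrite -mulr_sumr -(big_mkord xpredT (fun k => q k.+1 - q k)) telescope_sumr//.
  rewrite -[in leRHS](prednK p0) exprSr ler_wpM2l// ?exprn_ge0//; lra.
have W0 : (0 <= ereal_inf [set \int[pi]_z (`|z.1 - z.2| ^+ p)%:E
    | pi in [set pi | coupling nu (dos l p) pi]])%E.
  apply: le_ereal_inf_tmp => _ [pi' _ <-]; apply: integral_ge0 => z _.
  by rewrite lee_fin exprn_ge0.
have -> : e%:E = ((e ^+ p)%:E `^ (p%:R^-1))%E.
  rewrite poweR_EFin -powR_mulrn// -powRrM divff ?powRr1//.
  by rewrite pnatr_eq0 -lt0n.
apply: gt0_ler_poweR => //; rewrite ?invr_ge0// ?in_itv/= ?leey ?andbT//.
  by rewrite lee_fin exprn_ge0.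
apply: (le_trans _ cost); apply: ereal_inf_lbound; exists pi => //.
Qed.

End step_coupling.

Section lower_bounds.
Context {R : realType}.
Variables (V : R -> R) (p : nat) (a C beta : R).
Hypotheses (p2 : (2 <= p)%N) (gV : growth V p a C) (beta0 : 0 < beta).

(** The order of the choices matters: the noise scale [s], which fixes the kernel and its truncation
    [d]; then [eta], small compared with [d]; then the clipping level [m]; and finally [n]. *)
Lemma clipped_lower (nu : probR R) (c S eps delta : R) : moment p nu ->
  (- Sigma nu)%E = S%:E -> 0 < eps -> 0 < delta ->
  exists (phi : probR R) (B s : R) (m0 : nat),
    [/\ 0 < s <= 1 /\ s <= delta, 0 < B, phi `[0, s]%classic = 1%E,
        forall A, measurable A -> (phi A <= B%:E * lebesgue_measure A)%E &
    forall m : nat, (m0 <= m)%N ->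
      (\int[nu]_x (tail p m%:R (c - x))%:E <= delta%:E)%E /\
      forall b h, 0 < h -> h <= 1 -> exists N0, forall n (q : nat -> R), (N0 <= n)%N ->
        (forall k, (k < n.+1)%N -> q k < q k.+1) ->
        (forall k, (k < n.+1)%N ->
          clipped phi nu c m `]q k, q k.+1]%classic = (n.+1%:R^-1)%:E) ->
        ((expR (- dos_speed beta n * (S + \int[nu]_x V (c - x) + eps)))%:E <=
          \int[lebesgue_tuple n.+2]_(l in [set l : n.+2.-tuple R |
            forall i : 'I_n.+2, cell b h n q i (tnth l i)]) (ensemble_weight V beta l)%:E)%E].
Proof.
move=> mom SE eps0 delta0; have hm := moment_mean p2 mom.
case: (gV) => a0 C0 _ _ _.
pose F := shifted_moment p C nu c.
have F0 : 0 <= F.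
  apply: mulr_ge0; [exact: ltW|apply: Rintegral_ge0 => x _].
  by rewrite addr_ge0// exprn_ge0.
(* Small against [delta] for the transport cost, against [eps] for the logarithmic energy, and
   against [eps / (F + 1)] for the potential. *)
pose s : R := Num.min (Num.min 1 delta) (Num.min (eps / 16) (eps / 8 / (F + 1))).
have s0 : 0 < s by rewrite !lt_min ltr01 delta0 !divr_gt0//; lra.
have s1 : s <= 1 by rewrite /s !ge_min lexx.
have sd : s <= delta by rewrite /s !ge_min lexx orbT.
have se : s <= eps / 16 by rewrite /s !ge_min lexx !orbT.
have sF : s * F <= eps / 8.
  have : s * (F + 1) <= eps / 8.
    by rewrite -ler_pdivlMr; [rewrite /s !ge_min lexx !orbT|lra].
  by have := s0; lra.
have [phi [B [d [B0 /andP[d0 d1] phi1 phiB Hphi]]]] := smoothing_kernel s0.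
pose eta : R := Num.min delta (Num.min (d * eps / 16) (eps / 16 / C)).
have eta0 : 0 < eta by rewrite !lt_min delta0 !divr_gt0// mulr_gt0.
have etad : eta <= delta by rewrite /eta ge_min lexx.
have eta1 : d^-1 * eta <= eps / 16.
  rewrite mulrC ler_pdivrMr//; have : eta <= d * eps / 16 by rewrite /eta !ge_min lexx orbT.
  lra.
have eta2 : C * eta <= eps / 16.
  by rewrite mulrC -ler_pdivlMr// /eta !ge_min lexx !orbT.
have [m0 Hm0] := tail_vanishes c mom eta0.
exists phi, B, s, m0; split => //; first by rewrite s0 s1.
move=> m /Hm0 tl; split; first by apply: (le_trans tl); rewrite lee_fin.
move=> b h h0 h1.
have kE := clipped_kap p2 s0 d0 d1 Hphi mom tl.
have vE := clipped_potential gV s0 s1 phi1 mom tl.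
have cB A : measurable A -> (clipped phi nu c m A <= B%:E * lebesgue_measure A)%E.
  by move=> mA; apply: smear_le_lebesgue => //; exact: ltW.
have cm : moment p (clipped phi nu c m) by exact (clipped_moment p nu c s1 phi1 m).
have D1 : 1 <= 2 * m%:R + 1 :> R by have := ler0n R m; lra.
have eps4 : 0 < eps / 4 by rewrite divr_gt0.
have [N0 HN0] := box_lower_bound gV beta0 b B0 h0 h1 D1 eps4 cB kE cm.
exists N0 => n q nN qlt qc; apply: le_trans (HN0 n q nN qlt qc).
rewrite lee_fin ler_expR !mulNr lerN2 ler_pM2l ?dos_speed_gt0//.
have SL : - log_energy d nu <= S.
  have := Sigma_le_log_energy d0 hm; rewrite -leeN2 SE.
  by rewrite lee_fin.
move: vE; rewrite -/F; move: (ln _) (log_energy _ _) SL (Rintegral _ _ _) (Rintegral _ _ _).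
by move=> x y yS z w; lra.
Qed.

Lemma dos_lower (nu : M1p (`[0, +oo[%classic : set R) p) (c S eps e : R) :
  (- Sigma nu)%E = S%:E -> 0 < eps -> 0 < e ->
  exists N0, forall n, (N0 <= n)%N ->
    ((expR (- dos_speed beta n * (S + \int[nu]_x V (c - x) + eps)))%:E <=
      \int[lebesgue_tuple n.+2]_(l in [set l : n.+2.-tuple R |
        (wasserstein p nu (dos l p) < e%:E)%E]) (ensemble_weight V beta l)%:E)%E.
Proof.
move=> SE eps0 e0; have mom := M1p_moment nu.
(* Of the four terms in [wasserstein_step_le], three are at most [r] and the one with the cell
   lengths at most [3 * r]. Aiming at [e / 2] makes the final inequality strict. *)
pose r : R := (e / 2) ^+ p / 4 ^+ p / 6.
have r0 : 0 < r by rewrite !divr_gt0// ?exprn_gt0// divr_gt0.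
pose delta := Num.min 1 r.
have delta0 : 0 < delta by rewrite lt_min ltr01.
have [phi [B [s [m0 [[/andP[s0 s1] sd] B0 phi1 phiB H]]]]] := clipped_lower c mom SE eps0 delta0.
pose m := maxn m0 (Num.truncn `|c|).+1.
have cm : - m%:R <= c.
  have : `|c| <= m%:R.
    by apply: ltW; apply: (lt_le_trans (truncnS_gt _)); rewrite ler_nat leq_maxr.
  by rewrite ler_norml => /andP[].
have [tl {}H] := H m (leq_maxl _ _).
have [N0 {}H] := H c delta delta0 (ltac:(by rewrite ge_min lexx)).
have cB A : measurable A -> (clipped phi nu c m A <= B%:E * lebesgue_measure A)%E.
  by move=> mA; apply: smear_le_lebesgue => //; exact: ltW.
have car : clipped phi nu c m `](- m%:R - 2), c]%classic = 1%E.
  apply: (clipped_carrier s1 phi1).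
  apply/eqP; rewrite eq_le probability_le1/=; last exact: measurable_clip_le.
  rewrite -(M1p_carrier nu) le_measure// ?inE//; first exact: measurable_clip_le.
  move=> x /=; rewrite in_itv/= andbT => x0.
  by apply: clip_le => //; lra.
pose Lp : R := (c - (- m%:R - 2)) ^+ p.
have [N1 HN1] : exists N1 : nat, forall n, (N1 <= n)%N -> n.+1%:R^-1 * Lp <= 3 * r.
  exists (Num.truncn (Lp / (3 * r))).+1 => n nN.
  have r3 : 0 < 3 * r by lra.
  have : Lp / (3 * r) <= n.+1%:R.
    by apply: ltW; apply: (lt_le_trans (truncnS_gt _)); rewrite ler_nat (leq_trans nN).
  by rewrite ler_pdivrMr// [X in _ -> X <= _]mulrC ler_pdivrMr// mulrC.
exists (maxn N0 N1) => n; rewrite geq_max => /andP[n0 n1].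
have [q [q_in q_lt q_c]] := quantile_cuts B0 car cB n.
apply: (le_trans (H n q n0 q_lt q_c)).
apply: le_integral_set => [l|l lbox] /=.
  by rewrite lee_fin mulr_ge0 ?powR_ge0 ?expR_ge0.
apply: (@le_lt_trans _ _ (e / 2)%:E); last by rewrite lte_fin; lra.
have e2 : 0 <= e / 2 by rewrite divr_ge0// ltW.
apply: (wasserstein_step_le p2 s0 delta0 phi1 q_in q_lt q_c lbox e2 tl).
have dr : delta <= r by rewrite ge_min lexx orbT.
have dp x : 0 <= x -> x <= delta -> x ^+ p <= r.
  move=> x0 xd; apply: (le_trans _ dr); apply: (le_trans _ xd).
  rewrite -[leRHS]expr1 ler_wiXn2l ?(ltnW p2)//.
  by rewrite (le_trans xd)// ge_min lexx.
have := dp s (ltW s0) sd; have := dp delta (ltW delta0) (lexx _); have := HN1 n n1.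
rewrite -/Lp => h1 h2 h3.
have -> : (e / 2) ^+ p = 4 ^+ p * (6 * r).
  by rewrite /r; field; rewrite expf_neq0.
have sum_le (x y z w v : R) : x <= v -> y <= v -> z <= v -> w <= 3 * v ->
    x + y + z + w <= 6 * v by lra.
by apply: ler_wpM2l; [rewrite exprn_ge0|exact: sum_le].
Qed.

Lemma partition_function_lower (eps : R) : 0 < eps ->
  exists N0, forall n, (N0 <= n)%N ->
    ((expR (- dos_speed beta n * (fine (c_ V) + eps)))%:E <= partition_function V beta n.+2)%E.
Proof.
move=> eps0; have cfin := c_fin_num p2 gV; have eps2 : 0 < eps / 2 by rewrite divr_gt0.
have : (c_ V < (fine (c_ V) + eps / 2)%:E)%E.
  by rewrite -{1}(fineK cfin) lte_fin ltrDl.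
move=> /ereal_inf_lt[_ [rho iV <-] Hrho].
have mom0 : moment p rho := V_integrable_moment gV iV.
(* [tau 0] is an involution: reflecting the almost minimiser beforehand makes the reflected measure
   in [clipped_lower] equal to [rho]. *)
pose nu := tau 0 rho.
have mom : moment p nu.
  rewrite /moment tauE//.
    by under eq_integral do rewrite sub0r normrN.
  by apply/measurable_EFinP; exact: measurable_absX.
have VE : \int[nu]_x V (0 - x) = \int[rho]_x V x.
  apply: EFin_inj.
  rewrite -(expectation_V_reflect gV 0 mom) -(expectation_V gV mom0).
  rewrite /nu /tau integral_distribution//.
  - by apply: eq_integral => x _; rewrite /= /Defs.reflect !sub0r opprK.
  - apply/measurable_EFinP; exact: measurable_V_reflect gV 0.
  - rewrite (_ : _ \o _ = fun x : measurableTypeR R => (V x)%:E); last first.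
      by apply/funext => x; rewrite /= /Defs.reflect !sub0r opprK.
    exact (integrable_V gV mom0).
rewrite (expectation_V gV mom0) in Hrho.
have [S SE HS] : exists2 S : R, (- Sigma nu)%E = S%:E & S + \int[rho]_x V x < fine (c_ V) + eps / 2.
  rewrite Sigma_tau; have := Sigma_lty p2 mom0; move: Hrho.
  case: (Sigma rho) => [u| |] //= H _.
  by exists (- u); rewrite // -lte_fin EFinD.
have [phi [B [s [m0 [[/andP[s0 s1] sd] B0 phi1 phiB H]]]]] := clipped_lower 0 mom SE eps2 ltr01.
have [tl {}H] := H m0 (leqnn _).
(* No transport estimate is needed here, so the top cell may start at the upper clipping level and
   have length 1. *)
have [N0 {}H] := H m0%:R 1 ltr01 (lexx _).
have cB A : measurable A -> (clipped phi nu 0 m0 A <= B%:E * lebesgue_measure A)%E.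
  by move=> mA; apply: smear_le_lebesgue => //; exact: ltW.
have car : clipped phi nu 0 m0 `](- m0%:R - 2), m0%:R]%classic = 1%E.
  apply: (clipped_carrier s1 phi1); rewrite (_ : [set _ | _] = setT) ?probability_setT//.
  apply/seteqP; split => // x _ /=.
  by have := clip_norm_le (0 - x) (ler0n R m0); rewrite ler_norml => /andP[].
exists N0 => n n0; have [q [q_in q_lt q_c]] := quantile_cuts B0 car cB n.
apply: (@le_trans _ _ (expR (- dos_speed beta n * (S + \int[nu]_x V (0 - x) + eps / 2)))%:E).
  rewrite lee_fin ler_expR !mulNr lerN2 ler_pM2l ?dos_speed_gt0// VE.
  by move: HS; move: (Rintegral _ _ _) => z; lra.
apply: (le_trans (H n q n0 q_lt q_c)); apply: le_integral_set => // l.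
by rewrite lee_fin mulr_ge0 ?powR_ge0 ?expR_ge0.
Qed.

End lower_bounds.

(** * Large deviation bounds *)

Section rates.
Context {R : realType}.
Local Open Scope ereal_scope.
Implicit Types (u : nat -> \bar R) (x : \bar R).

Lemma limn_esup_le_near u x N : (forall n, (N <= n)%N -> u n <= x) -> limn_esup u <= x.
Proof.
move=> H; rewrite limn_esup_lim; apply: lime_le; first exact: is_cvg_esups.
exists N => // n /= Nn; apply: ge_ereal_sup => _ [k /= nk <-].
by apply: H; exact: leq_trans nk.
Qed.

Lemma limn_einf_ge_near u x N : (forall n, (N <= n)%N -> x <= u n) -> x <= limn_einf u.
Proof.
move=> H; rewrite limn_einf_lim; apply: lime_ge; first exact: is_cvg_einfs.
exists N => // n /= Nn; apply: le_ereal_inf_tmp => _ [k /= nk <-].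
by apply: H; exact: leq_trans nk.
Qed.

Lemma lne_expR_mono (P P' : \bar R) : 0 <= P -> P <= P' -> lne P <= lne P'.
Proof.
by move=> P0 PP'; rewrite lee_lne// in_itv/= ?leey ?andbT// (le_trans P0).
Qed.

Lemma scaled_lne_ge (v r : R) (P : \bar R) : (0 < v)%R ->
  (expR (- v * r))%:E <= P -> (- r)%:E <= (v^-1)%:E * lne P.
Proof.
move=> v0 H; have := lne_expR_mono _ H; rewrite lee_fin expR_ge0 => /(_ isT).
rewrite lne_EFin ?expR_gt0// expRK => H'.
have -> : (- r)%:E = (v^-1)%:E * (- v * r)%:E.
  by rewrite -EFinM; congr EFin; rewrite mulNr mulrN mulKf// gt_eqF.
by rewrite lee_wpmul2l// lee_fin invr_ge0 ltW.
Qed.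

Lemma scaled_lne_le (v r : R) (P : \bar R) : (0 < v)%R -> 0 <= P ->
  P <= (expR (- v * r))%:E -> (v^-1)%:E * lne P <= (- r)%:E.
Proof.
move=> v0 P0 H; have := lne_expR_mono P0 H.
rewrite lne_EFin ?expR_gt0// expRK => H'.
have -> : (- r)%:E = (v^-1)%:E * (- v * r)%:E.
  by rewrite -EFinM; congr EFin; rewrite mulNr mulrN mulKf// gt_eqF.
by rewrite lee_wpmul2l// lee_fin invr_ge0 ltW.
Qed.

Lemma ratio_ge (v x y : R) (I Z : \bar R) : 0 <= Z ->
  (expR (- v * x))%:E <= I -> Z <= (expR (- v * y))%:E ->
  (expR (- v * (x - y)))%:E <= Z^-1 * I.
Proof.
case: Z => [z| |] //; rewrite ?lee_fin => z0 HI.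
have I0 : 0 <= I by apply: le_trans HI; rewrite lee_fin expR_ge0.
(* For [Z = 0] the inverse is +oo and the bound is trivial. *)
have [->|zn0] := eqVneq z 0%R; rewrite ?lee_fin => zy.
  rewrite inver eqxx gt0_mulye ?leey//.
  by apply: lt_le_trans HI; rewrite lte_fin expR_gt0.
rewrite inver (negbTE zn0).
have zp : (0 < z)%R by rewrite lt_neqAle eq_sym zn0.
apply: (@le_trans _ _ ((z^-1)%:E * (expR (- v * x))%:E)); last first.
  by rewrite lee_wpmul2l// lee_fin invr_ge0.
rewrite -EFinM lee_fin mulrBr expRD mulrC ler_wpM2r ?expR_ge0//.
by rewrite expRN lef_pV2 ?posrE ?expR_gt0.
Qed.

Lemma ratio_le (v x y : R) (I Z : \bar R) : 0 <= I ->
  I <= (expR (- v * x))%:E -> (expR (- v * y))%:E <= Z ->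
  Z^-1 * I <= (expR (- v * (x - y)))%:E.
Proof.
move=> I0 HI; case: Z => [z| |] //; rewrite ?lee_fin => zy.
  have zp : (0 < z)%R by apply: lt_le_trans zy; exact: expR_gt0.
  rewrite inver (gt_eqF zp).
  apply: (@le_trans _ _ ((z^-1)%:E * (expR (- v * x))%:E)).
    by rewrite lee_wpmul2l// lee_fin invr_ge0 ltW.
  rewrite -EFinM lee_fin mulrBr expRD mulrC ler_wpM2l ?expR_ge0//.
  by rewrite expRN lef_pV2 ?posrE ?expR_gt0.
by rewrite invey mul0e lee_fin expR_ge0.
Qed.

Lemma le_of_lt_real (x y : \bar R) : (forall t : R, t%:E < x -> t%:E <= y) -> x <= y.
Proof.
move=> H; apply/lee_subgt0Pr => e e0.
case: x H => [r| |] H; last by rewrite leNye.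
  by rewrite -EFinB; apply: H; rewrite lte_fin ltrBlDr ltrDl.
rewrite addye// leye_eq; case: y H => [r| |] H //.
  by have := H (r + 1)%R (ltry _); rewrite lee_fin; lra.
by have := H 0%R (ltry _).
Qed.

End rates.

Section large_deviations.
Context {R : realType}.
Variables (V : R -> R) (p : nat) (a C beta : R).
Hypotheses (p2 : (2 <= p)%N) (gV : growth V p a C) (beta0 : 0 < beta).
Let E : set R := `[0, +oo[%classic.
Local Open Scope ereal_scope.

Let weight_ge0 n (l : n.-tuple R) : 0 <= (ensemble_weight V beta l)%:E.
Proof. by rewrite lee_fin mulr_ge0 ?powR_ge0 ?expR_ge0. Qed.

Lemma ldp_lower (G : set (M1p E p)) : open G ->
  - ereal_inf [set I_DOS V (nu : M1p E p) | nu in G] <=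
  limn_einf (fun n => ((dos_speed beta n)^-1)%:E * lne (dos_law V beta n G)).
Proof.
move=> oG; rewrite leeNl; apply: le_ereal_inf_tmp => _ [nu Gnu <-].
apply: le_ereal_inf_tmp => _ [c _ <-]; rewrite leeNl.
have mom := M1p_moment nu; have cfin := c_fin_num p2 gV.
rewrite (I_tauE gV c mom).
(* If [Sigma nu] is -oo then [I_tau] is +oo and there is nothing to prove. *)
have := Sigma_lty p2 mom; case SE : (Sigma nu) => [S| |] // _; last first.
  by rewrite /= -(fineK cfin) leNye.
have SE' : - Sigma nu = (- S)%R%:E by rewrite SE.
have [e e0 He] := oG nu Gnu.
apply/lee_subgt0Pr => eps eps0; have eps2 : (0 < eps / 2)%R by rewrite divr_gt0.
have [N0 HN0] := dos_lower p2 gV beta0 c SE' eps2 e0.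
have [N1 HN1] := partition_function_upper p2 gV beta0 eps2.
apply: (@limn_einf_ge_near _ _ _ (maxn N0 N1)) => n; rewrite geq_max => /andP[n0 n1].
set v := (\int[nu]_x _)%R.
have -> : - (- S%:E + v%:E - c_ V) - eps%:E = (- (- S + v - fine (c_ V)) - eps)%R%:E.
  by rewrite -{1}(fineK cfin).
have -> : (- (- S + v - fine (c_ V)) - eps = - ((- S + v + eps / 2) - (fine (c_ V) - eps / 2)))%R by lra.
apply: scaled_lne_ge; first exact: dos_speed_gt0.
rewrite /dos_law /ensemble; apply: ratio_ge (HN1 n n1).
  by apply: integral_ge0 => l _.
apply: (le_trans (HN0 n n0)); apply: le_integral_set => // l.
exact: (He (dos l p)).
Qed.

Lemma ldp_upper (K : set (M1p E p)) : compact K ->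
  limn_esup (fun n => ((dos_speed beta n)^-1)%:E * lne (dos_law V beta n K)) <=
  - ereal_inf [set I_DOS V (nu : M1p E p) | nu in K].
Proof.
move=> cK; rewrite leeNr; apply: le_of_lt_real => t tK.
have [k Kk] : exists k, K `<=` level_set V (t + fine (c_ V)) k.
  apply: (compact_increasing_cover cK).
  - by move=> n; exact (@level_set_open R V p a C p2 gV E (t + fine (c_ V))%R n).
  - by move=> n m nm; exact (level_set_le_index p2 gV nm).
  - move=> nu Knu.
    have tI : t%:E < I_DOS V nu by apply: (lt_le_trans tK); apply: ereal_inf_lbound; exists nu.
    by have [N /(_ N (leqnn _)) HN] := level_set_I_DOS p2 gV tI; exists N.
rewrite leeNr; apply/lee_addgt0Pr => eps eps0.
have eps2 : (0 < eps / 2)%R by rewrite divr_gt0.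
have [N0 HN0] := level_set_upper p2 gV beta0 (t + fine (c_ V))%R k eps2.
have [N1 HN1] := partition_function_lower p2 gV beta0 eps2.
apply: (@limn_esup_le_near _ _ _ (maxn N0 N1)) => n; rewrite geq_max => /andP[n0 n1].
rewrite -EFinN -EFinD.
have -> : (- t + eps = - ((t + fine (c_ V) - eps / 2) - (fine (c_ V) + eps / 2)))%R by lra.
have I0 : 0 <= \int[lebesgue_tuple n.+2]_(l in [set l : n.+2.-tuple R | K (dos l p)])
    (ensemble_weight V beta l)%:E by exact: integral_ge0.
apply: scaled_lne_le; first exact: dos_speed_gt0.
  rewrite /dos_law /ensemble mule_ge0// inve_ge0.
  by apply: integral_ge0 => l _.
rewrite /dos_law /ensemble; apply: ratio_le I0 _ (HN1 n n1).
apply: le_trans (HN0 n n0); apply: le_integral_set => // l /=.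
exact: Kk.
Qed.

End large_deviations.

Theorem theorem2p9 (R : realType) (V : {poly R}) (p : nat) (beta : R)
    (p_ge2 : (2 <= p)%N) (p_even : ~~ odd p) (degV : size V = p.+1)
    (V_convex : convex_function (setT : set R^o) (fun x => V.[x]))
    (beta_gt0 : 0 < beta) :
  weak_ldp (dos_law (horner V) beta (p := p)) (dos_speed beta)
    (fun nu : M1p (`[0, +oo[%classic : set R) p => I_DOS (horner V) nu) /\
  forall nu : M1p (`[0, +oo[%classic : set R) p,
    I_DOS (horner V) nu = (- Sigma nu + G_ (horner V) nu - c_ (horner V))%E.
Proof.
have [a [C gV]] := poly_growth p_ge2 p_even degV V_convex.
split; last by move=> nu; exact (I_DOSE p_ge2 gV (M1p_moment nu)).
split; first exact (I_DOS_lsc p_ge2 gV _).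
- exact (ldp_lower p_ge2 gV beta_gt0).
- exact (ldp_upper p_ge2 gV beta_gt0).
Qed.
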